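(* Let an analytic divergence free velocity $(u,v)$ be prescribed in a neighborhood of the point $(x_1,x_2)=(0,0)$ such that $uv\neq 0$ at this point. Set $(x_1',x_2')=(x_1+x_2,\,x_1-x_2)$. On $x_1'=0$ (respectively $x_2'=0$), prescribe the analytic initial data: $g_{11}=g_{22}=1$, $\partial_{x_1'}g_{11}=\partial_{x_1'}g_{22}=0$, and $g_{12}$ satisfying the ordinary differential equation $$\partial_{x_2'}g_{12}=\frac1{2N}\big[g_{12}(\partial_1N-\partial_2M)+(-\partial_1M+\partial_2L)\big]-\frac1{2L}\big[(\partial_1N-\partial_2M)+g_{12}(-\partial_1M+\partial_2L)\big]$$ with initial condition $g_{12}=0$ at $x_2'=0$, so that $g_{ij}=\delta_{ij}$ at $(x_1',x_2')=(0,0)$ (respectively, $g_{11}=g_{22}=1$, $\partial_{x_2'}g_{11}=\partial_{x_2'}g_{22}=0$, and a similar ordinary differential equation and initial data for $g_{12}$ on $x_2'=0$). Then the initial data system $$\partial_1U+\partial_2V=0,$$ $$\partial_1\big(\Gamma^1_{22}L-2\Gamma^1_{12}M+\Gamma^1_{11}N\big)+\partial_2\big(\Gamma^2_{22}L-2\Gamma^2_{12}M+\Gamma^2_{11}N\big)=0,$$ $$\partial_1N-\partial_2M=-\Gamma^1_{22}L+2\Gamma^1_{12}M-\Gamma^1_{11}N,$$ $$\partial_1M-\partial_2L=\Gamma^2_{22}L-2\Gamma^2_{12}M+\Gamma^2_{11}N,$$ $$LN-M^2=\kappa$$ has a local analytic solution $(g_{11},g_{12},g_{22})$.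
   Context: $\partial_i=\partial/\partial x_i$, $\partial_{ij}=\partial_i\partial_j$. $\mathbf g=(g_{ij})$ is a Riemannian metric in two dimensions, $\Gamma^k_{ij}=\frac12g^{kl}(\partial_jg_{il}+\partial_ig_{jl}-\partial_lg_{ij})$ are its Christoffel symbols and $\kappa$ is its Gauss curvature. The quantities $L,M,N$ are given by the fluid variables: $L=v^2+p$, $M=-uv$, $N=u^2+p$, where $p$ is the pressure determined from $(u,v)$ by the Poisson equation $\partial_{11}(u^2)+2\partial_{12}(uv)+\partial_{22}(v^2)=-\Delta p$ (taken analytic, and positive by adding a sufficiently large constant). The functions $U,V$ express the velocity through $(L,M,N)$: $$U=\Big(\tfrac12\big[-(L-N)+\sqrt{(L-N)^2+4M^2}\big]\Big)^{1/2},\qquad V=\Big(\tfrac12\big[(L-N)+\sqrt{(L-N)^2+4M^2}\big]\Big)^{1/2},$$ with the convention $(u,v)=(U,V)$ (the choice $(u,v)=-(U,V)$ being handled similarly), so the first equation of the system is the divergence free condition. The last three equations of the system are the Codazzi equations and the Gauss equation for a surface in $\mathbb R^3$ with first fundamental form $\mathbf g$ and second fundamental form, divided by $\sqrt{\det\mathbf g}$, equal to $(L,M,N)$.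
   Formalization: The right-hand side of the ordinary differential equation for g12 is taken with the opposite overall sign, since the printed sign contradicts the Codazzi equations; U, V in the first equation carry the signs of u, v, so that uv<0 is also covered. *)

(* Defs.v *)
From Stdlib Require Export Reals.
From Coquelicot Require Export Coquelicot.
Open Scope R_scope.

Definition field2 := R -> R -> R.

(** Double power series, summed by total degree and converging absolutely. *)
Definition analytic_at (f : field2) (x y : R) : Prop :=
  exists (a : nat -> nat -> R) (r : posreal),
    forall h k : R, Rabs h < r -> Rabs k < r ->
      ex_series (fun n : nat =>
        sum_n (fun i => Rabs (a i (n - i)%nat * h ^ i * k ^ (n - i))) n) /\
      is_series (fun n : nat =>
        sum_n (fun i => a i (n - i)%nat * h ^ i * k ^ (n - i)) n)
        (f (x + h) (y + k)).

Definition analytic_near0 (f : field2) : Prop :=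
  locally_2d (fun x y => analytic_at f x y) 0 0.

Inductive axis : Set := X1 | X2.

Definition D (i : axis) (f : field2) : field2 := fun x y =>
  match i with
  | X1 => Derive (fun z => f z y) x
  | X2 => Derive (fun z => f x z) y
  end.

Definition sum_axis (F : axis -> R) : R := F X1 + F X2.

Definition laplacian (f : field2) : field2 := fun x y =>
  D X1 (D X1 f) x y + D X2 (D X2 f) x y.

(** ** Fluid variables *)

Definition divergence_free (u v : field2) : Prop :=
  locally_2d (fun x y => D X1 u x y + D X2 v x y = 0) 0 0.

Definition pressure_equation (u v p : field2) : Prop :=
  locally_2d (fun x y =>
    D X1 (D X1 (fun a b => u a b ^ 2)) x y
    + 2 * D X1 (D X2 (fun a b => u a b * v a b)) x y
    + D X2 (D X2 (fun a b => v a b ^ 2)) x y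
    = - laplacian p x y) 0 0.

Definition Lof (u v p : field2) : field2 := fun x y => v x y ^ 2 + p x y.
Definition Mof (u v p : field2) : field2 := fun x y => - (u x y * v x y).
Definition Nof (u v p : field2) : field2 := fun x y => u x y ^ 2 + p x y.

Definition Uof (L M N : field2) : field2 := fun x y =>
  sqrt (/ 2 * (- (L x y - N x y)
               + sqrt ((L x y - N x y) ^ 2 + 4 * M x y ^ 2))).
Definition Vof (L M N : field2) : field2 := fun x y =>
  sqrt (/ 2 * ((L x y - N x y)
               + sqrt ((L x y - N x y) ^ 2 + 4 * M x y ^ 2))).

(** [U] and [V] are nonnegative square roots, so [(L, M, N)] determines the
    velocity up to the signs of its components.  [s = t = 1] is the convention
    [(u, v) = (U, V)] and [s = t = -1] is [(u, v) = - (U, V)]; opposite signs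
    occur when [u v < 0]. *)
Definition velocity_branch (s t : R) (u v p : field2) : Prop :=
  (s = 1 \/ s = -1) /\ (t = 1 \/ t = -1) /\
  locally_2d (fun x y =>
    u x y = s * Uof (Lof u v p) (Mof u v p) (Nof u v p) x y /\
    v x y = t * Vof (Lof u v p) (Mof u v p) (Nof u v p) x y) 0 0.

(** ** Riemannian metrics in two dimensions *)

Record metric := Metric { g11 : field2; g12 : field2; g22 : field2 }.

Definition gcomp (g : metric) (i j : axis) : field2 :=
  match i, j with
  | X1, X1 => g11 g
  | X2, X2 => g22 g
  | _, _ => g12 g
  end.

Definition gdet (g : metric) : field2 := fun x y =>
  g11 g x y * g22 g x y - g12 g x y ^ 2.

Definition ginv (g : metric) (i j : axis) : field2 := fun x y =>
  match i, j with
  | X1, X1 => g22 g x y / gdet g x y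
  | X2, X2 => g11 g x y / gdet g x y
  | _, _ => - g12 g x y / gdet g x y
  end.

Definition analytic_metric (g : metric) : Prop :=
  forall i j, analytic_near0 (gcomp g i j).

Definition riemannian (g : metric) : Prop :=
  locally_2d (fun x y => 0 < g11 g x y /\ 0 < gdet g x y) 0 0.

(** [Gamma g k i j] is the Christoffel symbol with upper index [k]. *)
Definition Gamma (g : metric) (k i j : axis) : field2 := fun x y =>
  / 2 * sum_axis (fun l =>
    ginv g k l x y *
      (D j (gcomp g i l) x y + D i (gcomp g j l) x y - D l (gcomp g i j) x y)).

(** Component along the coordinate field [l] of the curvature
    [nabla_1 nabla_2 e_2 - nabla_2 nabla_1 e_2]. *)
Definition Riem (g : metric) (l : axis) : field2 := fun x y =>
  D X1 (Gamma g l X2 X2) x y - D X2 (Gamma g l X1 X2) x y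
  + sum_axis (fun m =>
      Gamma g m X2 X2 x y * Gamma g l X1 m x y
      - Gamma g m X1 X2 x y * Gamma g l X2 m x y).

Definition gauss_curvature (g : metric) : field2 := fun x y =>
  sum_axis (fun l => gcomp g X1 l x y * Riem g l x y) / gdet g x y.

(** ** The system *)

(** [Gamma^k_22 L - 2 Gamma^k_12 M + Gamma^k_11 N]. *)
Definition codazzi_term (L M N : field2) (g : metric) (k : axis) : field2 :=
  fun x y =>
    Gamma g k X2 X2 x y * L x y - 2 * Gamma g k X1 X2 x y * M x y
    + Gamma g k X1 X1 x y * N x y.

Definition solves_system (s t : R) (L M N : field2) (g : metric) : Prop :=
  locally_2d (fun x y =>
    D X1 (fun a b => s * Uof L M N a b) x y
      + D X2 (fun a b => t * Vof L M N a b) x y = 0 /\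
    D X1 (codazzi_term L M N g X1) x y
      + D X2 (codazzi_term L M N g X2) x y = 0 /\
    D X1 N x y - D X2 M x y
      = - Gamma g X1 X2 X2 x y * L x y + 2 * Gamma g X1 X1 X2 x y * M x y
        - Gamma g X1 X1 X1 x y * N x y /\
    D X1 M x y - D X2 L x y
      = Gamma g X2 X2 X2 x y * L x y - 2 * Gamma g X2 X1 X2 x y * M x y
        + Gamma g X2 X1 X1 x y * N x y /\
    L x y * N x y - M x y ^ 2 = gauss_curvature g x y) 0 0.

(** ** Initial data *)

(** [f] in the coordinates [(x1', x2') = (x1 + x2, x1 - x2)]. *)
Definition primed (f : field2) : field2 := fun a b =>
  f ((a + b) / 2) ((a - b) / 2).

(** When [g11 = g22 = 1] and the first derivatives of [g11], [g22] vanish, the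
    two Codazzi equations reduce to
      [N * d_1 g12 = - (g12 * (d_1 N - d_2 M) + (- d_1 M + d_2 L))],
      [L * d_2 g12 = - ((d_1 N - d_2 M) + g12 * (- d_1 M + d_2 L))].
    The two slopes below are the resulting values of
    [d_{x2'} g12 = (d_1 g12 - d_2 g12) / 2] and
    [d_{x1'} g12 = (d_1 g12 + d_2 g12) / 2].  With the opposite overall sign
    the initial data would contradict the Codazzi equations. *)
Definition slope_x2' (L M N f : field2) : field2 := fun x y =>
  - (/ (2 * N x y) *
       (f x y * (D X1 N x y - D X2 M x y) + (- D X1 M x y + D X2 L x y))
     - / (2 * L x y) *
       ((D X1 N x y - D X2 M x y) + f x y * (- D X1 M x y + D X2 L x y))).

Definition slope_x1' (L M N f : field2) : field2 := fun x y =>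
  - (/ (2 * N x y) *
       (f x y * (D X1 N x y - D X2 M x y) + (- D X1 M x y + D X2 L x y))
     + / (2 * L x y) *
       ((D X1 N x y - D X2 M x y) + f x y * (- D X1 M x y + D X2 L x y))).

Definition initial_data_x1' (L M N : field2) (g : metric) : Prop :=
  locally 0 (fun b : R =>
    primed (g11 g) 0 b = 1 /\ primed (g22 g) 0 b = 1 /\
    D X1 (primed (g11 g)) 0 b = 0 /\ D X1 (primed (g22 g)) 0 b = 0 /\
    D X2 (primed (g12 g)) 0 b = primed (slope_x2' L M N (g12 g)) 0 b) /\
  primed (g12 g) 0 0 = 0.

Definition initial_data_x2' (L M N : field2) (g : metric) : Prop :=
  locally 0 (fun a : R =>
    primed (g11 g) a 0 = 1 /\ primed (g22 g) a 0 = 1 /\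
    D X2 (primed (g11 g)) a 0 = 0 /\ D X2 (primed (g22 g)) a 0 = 0 /\
    D X1 (primed (g12 g)) a 0 = primed (slope_x1' L M N (g12 g)) a 0) /\
  primed (g12 g) 0 0 = 0.

(* Main.v *)
Require Import Defs.
From Stdlib Require Import Lra Lia Psatz List ClassicalEpsilon.

(** The Codazzi equations are linear in the first derivatives of the metric and
    give [d_1 g12 = Q] and [d_2 g12 = P], where [P] and [Q] involve only the metric
    and the first derivatives of [g11] and [g22].  Writing [d_12 g12] as [d_1 P],
    respectively as [d_2 Q], in the Gauss equation yields one equation for [g11]
    and one for [g22], both with principal part [N d_11 - 2 M d_12 + L d_22].  On
    the directions [(1, 1)] and [(1, -1)] this form takes the values
    [(u + v)^2 + 2 p] and [(u - v)^2 + 2 p], so neither initial line is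
    characteristic.  The Cauchy-Kovalevskaya theorem solves these two equations
    together with [d_1 g12 = Q].  The two forms of the Gauss equation then give
    [d_1 P = d_2 Q], so [d_2 g12 - P] is constant along [d_1]; it vanishes on the
    initial line by the ordinary differential equation prescribed there.  The
    second equation of the system is the divergence of the Codazzi equations and
    amounts to the Poisson equation for the pressure.

    The Cauchy-Kovalevskaya theorem is proved for systems solved for the
    [x]-derivatives and polynomial in the unknowns: the coefficients of the formal
    solution are dominated by those of [sum_n (rho x + sg y)^n / (n + 1)^2] for
    [rho] large compared with [sg], because [1 / (n + 1)^2] reproduces itself, up
    to a factor, under Cauchy products. *)

(** * Double series *)

(** [P] contains [/ 2 * D1 g22] and [Q] contains [/ 2 * D2 g11]. Hence [- 2 D1 P] cancels [D11 g22]
    in the Gauss equation and [- 2 D2 Q] cancels [D22 g11]: this is why each form involves second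
    derivatives of only one of [g11], [g22]. Right-hand sides polynomial in the unknowns suffice
    because a reciprocal can be traded for an unknown: [q = 1 / det g] obeys
    [D1 q = - q^2 D1 (det g)], and the same device applied to a given germ yields the quotients by
    [L] and [N]. Lowering the order adds derivatives of [g11] and [g22] to the unknowns. Every added
    unknown leaves an identity to be recovered, always in the same way: its defect has zero
    [x]-derivative and vanishes on the initial line. Series are controlled by geometric bounds that
    each operation may worsen, and equations are asserted on some neighbourhood of the origin, so no
    optimal radius is ever tracked. *)

Lemma sum_f_R0_swap (c : nat -> nat -> R) (m n : nat) :
  sum_f_R0 (fun i => sum_f_R0 (c i) n) m =
  sum_f_R0 (fun j => sum_f_R0 (fun i => c i j) m) n.
Proof.
  induction m as [|m IH]; simpl; [easy|].
  rewrite IH, <- sum_plus. now apply sum_eq.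
Qed.

(** Both sides run over the triangle [i + j <= n], by antidiagonals on the left and by rows on the
    right. *)
Lemma sum_f_R0_triangle_diag (c : nat -> nat -> R) (n : nat) :
  sum_f_R0 (fun m => sum_f_R0 (fun i => c i (m - i)%nat) m) n =
  sum_f_R0 (fun i => sum_f_R0 (c i) (n - i)%nat) n.
Proof.
  induction n as [|n IH]; [easy|].
  rewrite 2!tech5, IH, tech5, Nat.sub_diag, <- Rplus_assoc, <- sum_plus.
  simpl (sum_f_R0 (c (S n)) 0). f_equal.
  apply sum_eq. intros i Hi.
  replace (S n - i)%nat with (S (n - i)) by lia. easy.
Qed.

Lemma sum_f_R0_rev (f : nat -> R) (n : nat) :
  sum_f_R0 (fun i => f (n - i)%nat) n = sum_f_R0 f n.
Proof.
  revert f. induction n as [|n IH]; intros f; [easy|].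
  rewrite (decomp_sum (fun i => f (S n - i)%nat)) by lia.
  simpl pred. rewrite tech5, Rplus_comm, Nat.sub_0_r. f_equal.
  rewrite <- (IH f). now apply sum_eq.
Qed.

Lemma sum_f_R0_nonneg (f : nat -> R) (n : nat) :
  (forall i, (i <= n)%nat -> 0 <= f i) -> 0 <= sum_f_R0 f n.
Proof.
  induction n as [|n IH]; intros H; simpl; [now apply H|].
  apply Rplus_le_le_0_compat; [apply IH; intros i Hi|]; apply H; lia.
Qed.

Lemma ex_series_geom_bound (a : nat -> R) (K r : R) :
  0 <= r < 1 -> (forall n, Rabs (a n) <= K * r ^ n) ->
  ex_series (fun n => Rabs (a n)).
Proof.
  intros Hr Ha.
  apply (ex_series_le (K := R_AbsRing) (V := R_CompleteNormedModule)
           _ (fun n => K * r ^ n)).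
  - intros n. unfold norm; simpl. unfold abs; simpl. rewrite Rabs_Rabsolu. apply Ha.
  - apply (ex_series_scal_l K (fun n => r ^ n)). apply ex_series_geom.
    rewrite Rabs_pos_eq; lra.
Qed.

Lemma Series_geom_bound (a : nat -> R) (K r : R) :
  0 <= r < 1 -> (forall n, Rabs (a n) <= K * r ^ n) ->
  Rabs (Series a) <= K / (1 - r).
Proof.
  intros Hr Ha.
  eapply Rle_trans; [apply Series_Rabs; now apply (ex_series_geom_bound a K r)|].
  eapply Rle_trans; [apply Series_le with (b := fun n => K * r ^ n)|].
  - intros n. split; [apply Rabs_pos|apply Ha].
  - apply (ex_series_scal_l K (fun n => r ^ n)). apply ex_series_geom.
    rewrite Rabs_pos_eq; lra.
  - rewrite Series_scal_l, Series_geom; [apply Rle_refl|rewrite Rabs_pos_eq; lra].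
Qed.

Lemma Series_geom_tail (a : nat -> R) (K r : R) (m : nat) :
  0 <= r < 1 -> (forall n, Rabs (a n) <= K * r ^ n) ->
  Rabs (Series a - sum_f_R0 a m) <= K * r ^ S m / (1 - r).
Proof.
  intros Hr Ha.
  rewrite (Series_incr_n a (S m)); [|lia|apply ex_series_Rabs, (ex_series_geom_bound a K r); assumption].
  simpl pred.
  match goal with |- Rabs (?x + ?y - ?x) <= _ => replace (x + y - x) with y by ring end.
  apply Series_geom_bound; [easy|]. intros n.
  eapply Rle_trans; [apply Ha|]. rewrite pow_add. right; ring.
Qed.

(** This is the general term of the differentiated geometric series, which converges inside the unit
    disc. *)
Lemma is_lim_seq_arith_geom (r : R) :
  0 <= r < 1 -> is_lim_seq (fun n => INR (S n) * r ^ n) 0.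
Proof.
  intros Hr.
  assert (H : Rbar_lt (Rabs r) (CV_radius (fun _ => 1))).
  { apply Rbar_lt_le_trans with (Finite ((r + 1) / 2)).
    - simpl. rewrite Rabs_pos_eq; lra.
    - apply (proj1 (CV_radius_bounded (fun _ => 1))). exists 1. intros n.
      rewrite Rmult_1_l, <- RPow_abs, Rabs_pos_eq by lra.
      apply Rle_trans with (1 ^ n); [apply pow_incr; lra|rewrite pow1; lra]. }
  apply ex_pseries_derive in H.
  apply (ex_pseries_R (PS_derive (fun _ => 1)) r) in H.
  apply ex_series_lim_0 in H.
  revert H. apply is_lim_seq_ext. intros n. unfold PS_derive. ring.
Qed.

(** The partial sums by rows and by antidiagonals differ by [d n], a sum of [n + 1] row tails. The
    tail of row [i] starts at column [n - i + 1], so each tail is of order [r ^ n] and [d n] tends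
    to 0. *)
Lemma is_series_diag (c : nat -> nat -> R) (K r : R) :
  0 <= r < 1 -> (forall i j, Rabs (c i j) <= K * r ^ (i + j)) ->
  is_series (fun n => sum_f_R0 (fun i => c i (n - i)%nat) n)
    (Series (fun i => Series (c i))).
Proof.
  intros Hr Hc.
  assert (Hci : forall i j, Rabs (c i j) <= K * r ^ i * r ^ j).
  { intros i j. eapply Rle_trans; [apply Hc|]. rewrite pow_add. right; ring. }
  assert (HS : forall i, Rabs (Series (c i)) <= K / (1 - r) * r ^ i).
  { intros i. eapply Rle_trans; [apply (Series_geom_bound (c i) (K * r ^ i) r Hr), Hci|].
    unfold Rdiv. lra. }
  assert (H1 : is_lim_seq (sum_n (fun i => Series (c i))) (Series (fun i => Series (c i)))).
  { apply Series_correct, ex_series_Rabs, (ex_series_geom_bound _ (K / (1 - r)) r); assumption. }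
  set (d := fun n => sum_f_R0 (fun i => Series (c i) - sum_f_R0 (c i) (n - i)) n).
  assert (H2 : is_lim_seq d 0).
  { apply is_lim_seq_abs_0.
    apply is_lim_seq_le_le with (u := fun _ => 0)
      (w := fun n => K * r / (1 - r) * (INR (S n) * r ^ n)).
    - intros n. split; [apply Rabs_pos|]. unfold d.
      eapply Rle_trans; [apply Rsum_abs|].
      eapply Rle_trans; [apply sum_Rle with (Bn := fun _ => K * r / (1 - r) * r ^ n)|].
      + intros i Hi. eapply Rle_trans; [apply (Series_geom_tail (c i) (K * r ^ i) r _ Hr), Hci|].
        right. unfold Rdiv. replace n with (i + (n - i))%nat at 2 by lia.
        rewrite pow_add. simpl. ring.
      + rewrite sum_cte. lra.
    - apply is_lim_seq_const.
    - replace (Finite 0) with (Rbar_mult (K * r / (1 - r)) 0)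
        by (simpl; f_equal; ring).
      apply is_lim_seq_scal_l, is_lim_seq_arith_geom, Hr. }
  change (is_lim_seq (sum_n (fun n => sum_f_R0 (fun i => c i (n - i)%nat) n))
    (Series (fun i => Series (c i)))).
  apply is_lim_seq_ext with (fun n => sum_n (fun i => Series (c i)) n - d n).
  - intros n. rewrite 2!sum_n_Reals, sum_f_R0_triangle_diag. unfold d.
    rewrite <- minus_sum. apply sum_eq. intros. ring.
  - replace (Finite (Series (fun i => Series (c i))))
      with (Finite (Series (fun i => Series (c i)) - 0)) by (f_equal; ring).
    apply is_lim_seq_minus'; assumption.
Qed.

Lemma Series_switch (c : nat -> nat -> R) (K r : R) :
  0 <= r < 1 -> (forall i j, Rabs (c i j) <= K * r ^ (i + j)) ->
  Series (fun i => Series (fun j => c i j)) = Series (fun j => Series (fun i => c i j)).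
Proof.
  intros Hr Hc.
  etransitivity; [symmetry; exact (is_series_unique _ _ (is_series_diag c K r Hr Hc))|].
  apply is_series_unique.
  eapply is_series_ext; [|apply (is_series_diag (fun j i => c i j) K r Hr)].
  - intros n. simpl. rewrite <- sum_f_R0_rev. apply sum_eq. intros i Hi.
    f_equal. lia.
  - intros i j. rewrite Nat.add_comm. apply Hc.
Qed.

(** * Double power series *)

Definition series2 := nat -> nat -> R.

(** Cauchy estimates on a bidisc of radius [1 / r]. *)
Definition geom_bound (a : series2) (K r : R) : Prop :=
  0 <= K /\ 1 <= r /\ forall i j, Rabs (a i j) <= K * r ^ (i + j).

(** Summed by rows; [eval_diag] identifies it with the sum by total degree. *)
Definition eval (a : series2) (x y : R) : R := PSeries (fun i => PSeries (a i) y) x.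

Definition add2 (a b : series2) : series2 := fun i j => a i j + b i j.
Definition mul2 (a b : series2) : series2 := fun i j =>
  sum_f_R0 (fun k => PS_mult (a k) (b (i - k)%nat) j) i.
Definition const2 (c : R) : series2 := fun i j =>
  match i, j with O, O => c | _, _ => 0 end.
Definition pd1 (a : series2) : series2 := fun i j => INR (S i) * a (S i) j.
Definition pd2 (a : series2) : series2 := fun i j => INR (S j) * a i (S j).
Definition flip2 (a : series2) : series2 := fun i j => a j i.

Lemma geom_bound_weaken (a : series2) (K r K' r' : R) :
  K <= K' -> r <= r' -> geom_bound a K r -> geom_bound a K' r'.
Proof.
  intros HK Hr [H0 [H1 H2]]. repeat split; try lra.
  intros i j. eapply Rle_trans; [apply H2|].
  apply Rmult_le_compat; try lra; [apply pow_le; lra|apply pow_incr; lra].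
Qed.

Lemma geom_bound_common (a b : series2) (K r K' r' : R) :
  geom_bound a K r -> geom_bound b K' r' ->
  geom_bound a (Rmax K K') (Rmax r r') /\ geom_bound b (Rmax K K') (Rmax r r').
Proof.
  intros Ha Hb. split.
  - apply (geom_bound_weaken a K r); auto using Rmax_l.
  - apply (geom_bound_weaken b K' r'); auto using Rmax_r.
Qed.

Lemma le_pow2 (n : nat) : INR (S n) <= 2 ^ n.
Proof.
  induction n as [|n IH]; [simpl; lra|].
  rewrite S_INR. simpl (2 ^ S n).
  assert (1 <= 2 ^ n) by (apply pow_R1_Rle; lra). lra.
Qed.

Lemma CV_radius_bound (a : nat -> R) (K r x : R) :
  0 < r -> (forall n, Rabs (a n) <= K * r ^ n) -> r * Rabs x < 1 ->
  Rbar_lt (Rabs x) (CV_radius a).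
Proof.
  intros Hr Ha Hx.
  apply Rbar_lt_le_trans with (Finite (/ r)).
  - simpl. apply (Rmult_lt_reg_l r); [easy|]. rewrite Rinv_r; lra.
  - apply (proj1 (CV_radius_bounded a)). exists K. intros n.
    rewrite Rabs_mult, <- RPow_abs, (Rabs_pos_eq (/ r)) by (left; now apply Rinv_0_lt_compat).
    eapply Rle_trans; [apply Rmult_le_compat_r; [apply pow_le; left; now apply Rinv_0_lt_compat|apply Ha]|].
    rewrite Rmult_assoc, <- Rpow_mult_distr, Rinv_r, pow1 by lra. lra.
Qed.

Lemma ex_pseries_bound (a : nat -> R) (K r x : R) :
  0 < r -> (forall n, Rabs (a n) <= K * r ^ n) -> r * Rabs x < 1 ->
  ex_pseries a x.
Proof.
  intros. apply CV_disk_correct, CV_disk_inside.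
  now apply (CV_radius_bound a K r).
Qed.

Lemma PSeries_bound (a : nat -> R) (K r x : R) :
  0 < r -> (forall n, Rabs (a n) <= K * r ^ n) -> r * Rabs x < 1 ->
  Rabs (PSeries a x) <= K / (1 - r * Rabs x).
Proof.
  intros Hr Ha Hx. apply Series_geom_bound.
  - split; [apply Rmult_le_pos; [lra|apply Rabs_pos]|easy].
  - intros n. rewrite Rabs_mult, Rpow_mult_distr, <- RPow_abs, <- Rmult_assoc.
    apply Rmult_le_compat_r; [apply pow_le, Rabs_pos|apply Ha].
Qed.

Lemma geom_bound_row (a : series2) (K r : R) (i : nat) :
  geom_bound a K r -> forall j, Rabs (a i j) <= K * r ^ i * r ^ j.
Proof.
  intros [_ [_ H]] j. eapply Rle_trans; [apply H|]. rewrite pow_add. right. ring.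
Qed.

Lemma geom_bound_rows (a : series2) (K r y : R) (i : nat) :
  geom_bound a K r -> r * Rabs y < 1 ->
  Rabs (PSeries (a i) y) <= K / (1 - r * Rabs y) * r ^ i.
Proof.
  intros Ha Hy. destruct (Ha) as [_ [H1 _]].
  eapply Rle_trans; [apply (PSeries_bound _ (K * r ^ i) r); [lra| |easy]|].
  - now apply geom_bound_row.
  - right. unfold Rdiv. ring.
Qed.

Section Eval.

Context {a : series2} {K r : R} (Ha : geom_bound a K r).
Context {x y : R} (Hx : r * Rabs x < 1) (Hy : r * Rabs y < 1).

Let r_pos : 0 < r.
Proof. destruct Ha as [_ [H _]]. lra. Qed.

Lemma row_radius (i : nat) : Rbar_lt (Rabs y) (CV_radius (a i)).
Proof. apply (CV_radius_bound _ (K * r ^ i) r); auto. now apply geom_bound_row. Qed.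

Lemma rows_radius : Rbar_lt (Rabs x) (CV_radius (fun i => PSeries (a i) y)).
Proof.
  apply (CV_radius_bound _ (K / (1 - r * Rabs y)) r); auto.
  intros i. now apply geom_bound_rows.
Qed.

Lemma row_ex_pseries (i : nat) : ex_pseries (a i) y.
Proof. apply CV_disk_correct, CV_disk_inside, row_radius. Qed.

Lemma rows_ex_pseries : ex_pseries (fun i => PSeries (a i) y) x.
Proof. apply CV_disk_correct, CV_disk_inside, rows_radius. Qed.

Lemma eval_eq_Series : eval a x y = Series (fun i => Series (fun j => a i j * x ^ i * y ^ j)).
Proof.
  unfold eval, PSeries. apply Series_ext. intros i.
  rewrite <- Series_scal_r. apply Series_ext. intros j. ring.
Qed.

Let q := Rmax (r * Rabs x) (r * Rabs y).

Let q_range : 0 <= q < 1.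
Proof.
  split.
  - eapply Rle_trans; [|apply Rmax_l]. apply Rmult_le_pos; [lra|apply Rabs_pos].
  - now apply Rmax_lub_lt.
Qed.

Let term_bound (i j : nat) : Rabs (a i j * x ^ i * y ^ j) <= K * q ^ (i + j).
Proof.
  destruct Ha as [H0 [H1 H2]].
  rewrite 2!Rabs_mult, <- 2!RPow_abs.
  apply Rle_trans with (K * ((r * Rabs x) ^ i * (r * Rabs y) ^ j)).
  - rewrite 2!Rpow_mult_distr.
    replace (K * (r ^ i * Rabs x ^ i * (r ^ j * Rabs y ^ j)))
      with (K * r ^ (i + j) * Rabs x ^ i * Rabs y ^ j) by (rewrite pow_add; ring).
    apply Rmult_le_compat_r; [apply pow_le, Rabs_pos|].
    apply Rmult_le_compat_r; [apply pow_le, Rabs_pos|]. apply H2.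
  - apply Rmult_le_compat_l; [lra|]. rewrite pow_add.
    assert (0 <= r * Rabs x) by (apply Rmult_le_pos; [lra|apply Rabs_pos]).
    assert (0 <= r * Rabs y) by (apply Rmult_le_pos; [lra|apply Rabs_pos]).
    apply Rmult_le_compat; try (apply pow_le; assumption);
      apply pow_incr; (split; [assumption|]); [apply Rmax_l|apply Rmax_r].
Qed.

Lemma eval_diag :
  is_series (fun n => sum_f_R0 (fun i => a i (n - i)%nat * x ^ i * y ^ (n - i)) n)
    (eval a x y).
Proof.
  rewrite eval_eq_Series.
  apply (is_series_diag (fun i j => a i j * x ^ i * y ^ j) K q q_range term_bound).
Qed.

Lemma eval_abs_diag :
  ex_series (fun n => sum_f_R0 (fun i => Rabs (a i (n - i)%nat * x ^ i * y ^ (n - i))) n).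
Proof.
  eexists.
  apply (is_series_diag (fun i j => Rabs (a i j * x ^ i * y ^ j)) K q q_range).
  intros i j. rewrite Rabs_Rabsolu. apply term_bound.
Qed.

(** Summation by rows treats the two variables differently; this restores the symmetry, so that
    facts about the second variable follow from those about the first. *)
Lemma eval_flip : eval (flip2 a) y x = eval a x y.
Proof.
  rewrite eval_eq_Series, (Series_switch _ K q q_range term_bound).
  unfold eval, PSeries, flip2. apply Series_ext. intros j.
  rewrite <- Series_scal_r. apply Series_ext. intros i. ring.
Qed.

Lemma is_derive_eval1 : is_derive (fun z => eval a z y) x (eval (pd1 a) x y).
Proof.
  unfold eval.
  replace (PSeries (fun i => PSeries (pd1 a i) y) x)
    with (PSeries (PS_derive (fun i => PSeries (a i) y)) x).
  - apply is_derive_PSeries, rows_radius.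
  - apply PSeries_ext. intros i. unfold PS_derive, pd1. symmetry.
    apply (PSeries_scal (INR (S i)) (a (S i)) y).
Qed.

End Eval.

Lemma geom_bound_flip (a : series2) (K r : R) :
  geom_bound a K r -> geom_bound (flip2 a) K r.
Proof.
  intros [H0 [H1 H2]]. repeat split; auto. intros i j. unfold flip2.
  rewrite Nat.add_comm. apply H2.
Qed.

(** The factor [S i] is at most [2 ^ i], which doubling [r] absorbs. *)
Lemma geom_bound_pd1 (a : series2) (K r : R) :
  geom_bound a K r -> geom_bound (pd1 a) (K * r) (2 * r).
Proof.
  intros [H0 [H1 H2]]. split; [nra|]. split; [lra|]. intros i j. unfold pd1.
  rewrite Rabs_mult, Rabs_pos_eq by apply pos_INR.
  apply Rle_trans with (2 ^ (i + j) * (K * r ^ (S i + j))).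
  - apply Rmult_le_compat; [apply pos_INR|apply Rabs_pos| |apply H2].
    eapply Rle_trans; [apply le_pow2|]. apply Rle_pow; [lra|lia].
  - rewrite Rpow_mult_distr. simpl. right. ring.
Qed.

Lemma geom_bound_pd2 (a : series2) (K r : R) :
  geom_bound a K r -> geom_bound (pd2 a) (K * r) (2 * r).
Proof.
  intros H. apply geom_bound_flip, geom_bound_pd1, geom_bound_flip in H. exact H.
Qed.

Lemma is_derive_eval2 (a : series2) (K r x y : R) :
  geom_bound a K r -> 2 * r * Rabs x < 1 -> 2 * r * Rabs y < 1 ->
  is_derive (fun z => eval a x z) y (eval (pd2 a) x y).
Proof.
  intros Ha Hx Hy. destruct (Ha) as [_ [H1 _]].
  assert (Hx' : r * Rabs x < 1) by (pose proof (Rabs_pos x); nra).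
  assert (Hy' : r * Rabs y < 1) by (pose proof (Rabs_pos y); nra).
  apply is_derive_ext_loc with (fun z => eval (flip2 a) z x).
  - assert (He : 0 < / r - Rabs y).
    { apply (Rmult_lt_reg_l r); [lra|]. rewrite Rmult_minus_distr_l, Rinv_r; lra. }
    exists (mkposreal _ He). intros z Hz. apply (eval_flip Ha Hx').
    change (Rabs (z - y) < / r - Rabs y) in Hz.
    pose proof (Rabs_triang_inv z y).
    apply (Rmult_lt_reg_l (/ r)); [apply Rinv_0_lt_compat; lra|].
    rewrite <- Rmult_assoc, Rinv_l; lra.
  - rewrite <- (eval_flip (geom_bound_pd2 _ _ _ Ha) Hx Hy).
    apply (is_derive_eval1 (geom_bound_flip _ _ _ Ha) Hy' Hx').
Qed.

Lemma eval_add (a b : series2) (K r x y : R) :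
  geom_bound a K r -> geom_bound b K r -> r * Rabs x < 1 -> r * Rabs y < 1 ->
  eval (add2 a b) x y = eval a x y + eval b x y.
Proof.
  intros Ha Hb Hx Hy. unfold eval.
  rewrite <- PSeries_plus by (eapply rows_ex_pseries; eassumption).
  apply PSeries_ext. intros i. unfold PS_plus, plus; simpl.
  rewrite <- PSeries_plus by (eapply row_ex_pseries; eassumption). easy.
Qed.

Lemma geom_bound_add (a b : series2) (K r : R) :
  geom_bound a K r -> geom_bound b K r -> geom_bound (add2 a b) (2 * K) r.
Proof.
  intros [H0 [H1 H2]] [_ [_ H3]]. repeat split; try lra. intros i j. unfold add2.
  eapply Rle_trans; [apply Rabs_triang|]. specialize (H2 i j). specialize (H3 i j). lra.
Qed.

Lemma geom_bound_const (c : R) : geom_bound (const2 c) (Rabs c) 1.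
Proof.
  repeat split; [apply Rabs_pos|lra|]. intros i j. rewrite pow1, Rmult_1_r.
  destruct i, j; simpl; try (rewrite Rabs_R0; apply Rabs_pos). lra.
Qed.

Lemma eval_at_0_l (a : series2) (y : R) : eval a 0 y = PSeries (a O) y.
Proof. apply PSeries_0. Qed.

Lemma eval_const (c x y : R) : eval (const2 c) x y = c.
Proof.
  assert (H : forall (f : nat -> R) z, (forall n, f (S n) = 0) -> PSeries f z = f O).
  { intros f z Hf. rewrite (PSeries_ext f (fun n => if Nat.eqb n 0 then f O else 0)).
    - rewrite PSeries_decr_1.
      + unfold PS_decr_1; simpl. rewrite PSeries_const_0. ring.
      (* Only the zeroth coefficient is nonzero, so any positive ratio is admissible; this one has
         product with [Rabs z] below 1. *)
      + apply (ex_pseries_bound _ (Rabs (f O)) (/ (Rabs z + 1))).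
        * apply Rinv_0_lt_compat. pose proof (Rabs_pos z). lra.
        * intros n. destruct n; simpl; [lra|]. rewrite Rabs_R0.
          apply Rmult_le_pos; [apply Rabs_pos|].
          apply (pow_le _ (S n)). left. apply Rinv_0_lt_compat. pose proof (Rabs_pos z). lra.
        * pose proof (Rabs_pos z).
          apply (Rmult_lt_reg_l (Rabs z + 1)); [lra|].
          rewrite <- Rmult_assoc, Rinv_r; lra.
    - intros [|n]; simpl; auto. }
  unfold eval. rewrite H; [now apply H|].
  intros n. rewrite H; easy.
Qed.

Lemma PSeries_sum (f : nat -> nat -> R) (n : nat) (x : R) :
  (forall k, (k <= n)%nat -> ex_pseries (f k) x) ->
  ex_pseries (fun j => sum_f_R0 (fun k => f k j) n) x /\
  PSeries (fun j => sum_f_R0 (fun k => f k j) n) x = sum_f_R0 (fun k => PSeries (f k) x) n.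
Proof.
  induction n as [|n IH]; intros H; simpl.
  - split; [apply H; lia|easy].
  - destruct IH as [IH1 IH2]; [intros; apply H; lia|].
    assert (H' : ex_pseries (f (S n)) x) by (apply H; lia).
    split.
    + apply (ex_pseries_plus (fun j => sum_f_R0 (fun k => f k j) n) (f (S n)) x); assumption.
    + rewrite <- IH2. rewrite <- PSeries_plus by assumption. easy.
Qed.

Lemma eval_mul (a b : series2) (K r x y : R) :
  geom_bound a K r -> geom_bound b K r -> r * Rabs x < 1 -> r * Rabs y < 1 ->
  eval (mul2 a b) x y = eval a x y * eval b x y.
Proof.
  intros Ha Hb Hx Hy. unfold eval.
  rewrite <- PSeries_mult by (eapply rows_radius; eassumption).
  apply PSeries_ext. intros i. unfold mul2.
  transitivity (sum_f_R0 (fun k => PSeries (PS_mult (a k) (b (i - k)%nat)) y) i).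
  { apply (PSeries_sum (fun k => PS_mult (a k) (b (i - k)%nat))). intros k _.
    apply (ex_pseries_mult (a k) (b (i - k)%nat)); eapply row_radius; eassumption. }
  unfold PS_mult at 2. apply sum_eq. intros k _.
  apply PSeries_mult; eapply row_radius; eassumption.
Qed.

Lemma geom_bound_mul (a b : series2) (K r : R) :
  geom_bound a K r -> geom_bound b K r -> geom_bound (mul2 a b) (K * K) (2 * r).
Proof.
  intros [H0 [H1 H2]] [_ [_ H3]]. split; [nra|]. split; [lra|]. intros i j. unfold mul2, PS_mult.
  apply Rle_trans with (INR (S i) * (INR (S j) * (K * K * r ^ (i + j)))).
  - eapply Rle_trans; [apply Rsum_abs|].
    eapply Rle_trans; [apply sum_Rle with (Bn := fun _ => INR (S j) * (K * K * r ^ (i + j)))|].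
    + intros k Hk. eapply Rle_trans; [apply Rsum_abs|].
      eapply Rle_trans; [apply sum_Rle with (Bn := fun _ => (K * K * r ^ (i + j)))|].
      * intros l Hl. rewrite Rabs_mult.
        replace (K * K * r ^ (i + j))
          with ((K * r ^ (k + l)) * (K * r ^ (i - k + (j - l)))).
        { apply Rmult_le_compat; auto using Rabs_pos. }
        replace (i + j)%nat with ((k + l) + (i - k + (j - l)))%nat by lia.
        rewrite (pow_add r (k + l)). ring.
      * rewrite sum_cte. right; ring.
    + rewrite sum_cte. right; ring.
  - assert (0 <= r ^ (i + j)) by (apply pow_le; lra).
    rewrite Rpow_mult_distr, (pow_add 2).
    apply Rle_trans with (2 ^ i * (2 ^ j * (K * K * r ^ (i + j)))).
    + apply Rmult_le_compat; [apply pos_INR| |apply le_pow2|].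
      * apply Rmult_le_pos; [apply pos_INR|]. apply Rmult_le_pos; nra.
      * apply Rmult_le_compat_r; [apply Rmult_le_pos; nra|apply le_pow2].
    + right; ring.
Qed.

(** * Binomial coefficients; translation and shear of double power series *)

(** Pascal's recursion gives 0 for [k > n], so that [vandermonde] holds with the full range of
    summation. *)
Fixpoint bin (n k : nat) : R :=
  match n, k with
  | _, O => 1
  | O, S _ => 0
  | S n, S k => bin n k + bin n (S k)
  end.

Lemma bin_0_r (n : nat) : bin n 0 = 1.
Proof. now destruct n. Qed.

Lemma bin_nonneg (n k : nat) : 0 <= bin n k.
Proof.
  revert k. induction n as [|n IH]; intros [|k]; simpl; try lra.
  apply Rplus_le_le_0_compat; apply IH.
Qed.

Lemma bin_gt (n k : nat) : (n < k)%nat -> bin n k = 0.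
Proof.
  revert k. induction n as [|n IH]; intros [|k] H; simpl; try lia; [easy|].
  rewrite 2!IH by lia. ring.
Qed.

Lemma bin_le_pow2 (n k : nat) : bin n k <= 2 ^ n.
Proof.
  revert k. induction n as [|n IH]; intros [|k]; simpl; try lra.
  - assert (1 <= 2 ^ n) by (apply pow_R1_Rle; lra). lra.
  - pose proof (IH k). pose proof (IH (S k)). lra.
Qed.

Lemma bin_ge_1 (n k : nat) : (k <= n)%nat -> 1 <= bin n k.
Proof.
  revert k. induction n as [|n IH]; intros [|k] H; simpl; try lia; try lra.
  pose proof (IH k ltac:(lia)). pose proof (bin_nonneg n (S k)). lra.
Qed.

Lemma bin_eq_C (n k : nat) : (k <= n)%nat -> bin n k = Binomial.C n k.
Proof.
  revert k. induction n as [|n IH]; intros [|k] H; try lia.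
  - simpl. now rewrite C_n_n.
  - simpl. now rewrite C_n_0.
  - simpl. destruct (Nat.eq_dec k n) as [->|Hn].
    + rewrite (bin_gt n (S n)), IH, 2!C_n_n by lia. ring.
    + rewrite 2!IH by lia. apply pascal. lia.
Qed.

(** Coefficient form of differentiating [(rho x + sg y)^(n+1)] in [x]: this is how the majorant of
    an [x]-derivative is read off. *)
Lemma bin_absorb (n i : nat) : (i <= n)%nat ->
  INR (S n) * bin n i = INR (S i) * bin (S n) (S i).
Proof.
  revert i. induction n as [|n IH]; intros [|i] H; try lia.
  - simpl. ring.
  - clear H. assert (IH0 : INR (S n) * 1 = 1 * bin (S n) 1).
    { pose proof (IH O (Nat.le_0_l n)) as H. now rewrite bin_0_r in H. }
    rewrite bin_0_r. change (bin (S (S n)) 1) with (bin (S n) 0 + bin (S n) 1).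
    rewrite bin_0_r, (S_INR (S n)). change (INR 1) with 1. lra.
  - change (bin (S (S n)) (S (S i))) with (bin (S n) (S i) + bin (S n) (S (S i))).
    pose proof (IH i ltac:(lia)) as H1.
    destruct (Nat.eq_dec i n) as [->|Hn].
    + rewrite (bin_gt (S n) (S (S n))) by lia. ring.
    + pose proof (IH (S i) ltac:(lia)) as H2.
      replace (INR (S (S i))) with (INR (S i) + 1) in * by (rewrite (S_INR (S i)); ring).
      rewrite (S_INR (S n)).
      change (bin (S n) (S i)) with (bin n i + bin n (S i)) at 1.
      rewrite Rmult_plus_distr_l, Rmult_plus_distr_r, Rmult_plus_distr_r, H1, H2.
      change (bin (S n) (S i)) with (bin n i + bin n (S i)). ring.
Qed.

Lemma binomial_bin (x y : R) (n : nat) :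
  (x + y) ^ n = sum_f_R0 (fun k => bin n k * x ^ k * y ^ (n - k)) n.
Proof.
  rewrite binomial. apply sum_eq. intros k Hk. now rewrite bin_eq_C.
Qed.

(** Taylor coefficients at [t]: entry [l] is the [l]-th derivative at [t] divided by [l!]. *)
Definition translate_seq (a : nat -> R) (t : R) : nat -> R := fun l =>
  Series (fun i => bin (l + i) l * a (l + i)%nat * t ^ i).

Lemma translate_term_bound (a : nat -> R) (K r t : R) (l i : nat) :
  0 < r -> (forall n, Rabs (a n) <= K * r ^ n) ->
  Rabs (bin (l + i) l * a (l + i)%nat * t ^ i) <= K * (2 * r) ^ l * (2 * r * Rabs t) ^ i.
Proof.
  intros Hr Ha.
  rewrite 2!Rabs_mult, <- RPow_abs, (Rabs_pos_eq (bin _ _)) by apply bin_nonneg.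
  apply Rle_trans with (2 ^ (l + i) * (K * r ^ (l + i)) * Rabs t ^ i).
  - apply Rmult_le_compat_r; [apply pow_le, Rabs_pos|].
    apply Rmult_le_compat; [apply bin_nonneg|apply Rabs_pos|apply bin_le_pow2|apply Ha].
  - right. rewrite !Rpow_mult_distr, !pow_add. ring.
Qed.

Lemma translate_seq_bound (a : nat -> R) (K r t : R) (l : nat) :
  0 < r -> (forall n, Rabs (a n) <= K * r ^ n) -> 2 * r * Rabs t < 1 ->
  Rabs (translate_seq a t l) <= K / (1 - 2 * r * Rabs t) * (2 * r) ^ l.
Proof.
  intros Hr Ha Ht. unfold translate_seq.
  eapply Rle_trans; [apply (Series_geom_bound _ (K * (2 * r) ^ l) (2 * r * Rabs t))|].
  - split; [|easy]. pose proof (Rabs_pos t). nra.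
  - intros i. now apply translate_term_bound.
  - right. unfold Rdiv. ring.
Qed.

(** Both sides sum the double family [c]: by rows on the left, and by antidiagonals on the right,
    where the binomial theorem collects [(t + h)^n]. *)
Lemma PSeries_translate (a : nat -> R) (K r t h : R) :
  0 < r -> (forall n, Rabs (a n) <= K * r ^ n) ->
  2 * r * Rabs t < 1 -> 2 * r * Rabs h < 1 ->
  PSeries (translate_seq a t) h = PSeries a (t + h).
Proof.
  intros Hr Ha Ht Hh.
  set (c := fun l i => bin (l + i) l * a (l + i)%nat * t ^ i * h ^ l).
  transitivity (Series (fun l => Series (c l))).
  { unfold PSeries, translate_seq. apply Series_ext. intros l.
    rewrite <- Series_scal_r. apply Series_ext. easy. }
  set (q := Rmax (2 * r * Rabs t) (2 * r * Rabs h)).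
  assert (Ht0 : 0 <= 2 * r * Rabs t) by (pose proof (Rabs_pos t); nra).
  assert (Hh0 : 0 <= 2 * r * Rabs h) by (pose proof (Rabs_pos h); nra).
  assert (Hq : 0 <= q < 1).
  { split; [apply Rle_trans with (2 * r * Rabs t); [easy|apply Rmax_l]|now apply Rmax_lub_lt]. }
  assert (HK : 0 <= K).
  { specialize (Ha O). simpl in Ha. pose proof (Rabs_pos (a O)). lra. }
  assert (Hc : forall l i, Rabs (c l i) <= K * q ^ (l + i)).
  { intros l i. unfold c. rewrite Rabs_mult, <- RPow_abs.
    eapply Rle_trans; [apply Rmult_le_compat_r;
      [apply pow_le, Rabs_pos|exact (translate_term_bound a K r t l i Hr Ha)]|].
    replace (K * (2 * r) ^ l * (2 * r * Rabs t) ^ i * Rabs h ^ l)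
      with (K * ((2 * r * Rabs h) ^ l * (2 * r * Rabs t) ^ i))
      by (rewrite (Rpow_mult_distr (2 * r) (Rabs h)); ring).
    apply Rmult_le_compat_l; [easy|]. rewrite pow_add.
    apply Rmult_le_compat; try (apply pow_le; easy);
      apply pow_incr; (split; [easy|]); [apply Rmax_r|apply Rmax_l]. }
  rewrite <- (is_series_unique _ _ (is_series_diag c K q Hq Hc)).
  unfold PSeries. apply Series_ext. intros n.
  rewrite (Rplus_comm t h), binomial_bin, scal_sum.
  apply sum_eq. intros i Hi. unfold c.
  replace (i + (n - i))%nat with n by lia. ring.
Qed.

Definition translate1 (a : series2) (t : R) : series2 := fun l j =>
  translate_seq (fun i => a i j) t l.

Lemma geom_bound_translate1 (a : series2) (K r t : R) :
  geom_bound a K r -> 2 * r * Rabs t < 1 ->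
  geom_bound (translate1 a t) (K / (1 - 2 * r * Rabs t)) (2 * r).
Proof.
  intros [H0 [H1 H2]] Ht. split; [|split].
  - apply Rdiv_le_0_compat; lra.
  - lra.
  - intros l j. unfold translate1.
    eapply Rle_trans; [apply (translate_seq_bound _ (K * r ^ j) r); [lra| |easy]|].
    + intros n. eapply Rle_trans; [apply H2|]. rewrite pow_add. right; ring.
    + rewrite (pow_add (2 * r)).
      replace (K * r ^ j / (1 - 2 * r * Rabs t) * (2 * r) ^ l)
        with (K / (1 - 2 * r * Rabs t) * ((2 * r) ^ l * r ^ j)) by (unfold Rdiv; ring).
      apply Rmult_le_compat_l; [apply Rdiv_le_0_compat; lra|].
      apply Rmult_le_compat_l; [apply pow_le; lra|apply pow_incr; lra].
Qed.

(** [translate1] acts on columns whereas [eval] sums each row first; exchanging the two inner sums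
    reconciles them. *)
Lemma eval_translate1 (a : series2) (K r t h y : R) :
  geom_bound a K r ->
  2 * r * Rabs t < 1 -> 2 * r * Rabs h < 1 -> 2 * r * Rabs y < 1 ->
  eval (translate1 a t) h y = eval a (t + h) y.
Proof.
  intros Ha Ht Hh Hy. destruct (Ha) as [H0 [H1 H2]].
  assert (Hy' : r * Rabs y < 1) by (pose proof (Rabs_pos y); nra).
  unfold eval at 2.
  rewrite <- (PSeries_translate _ (K / (1 - r * Rabs y)) r);
    [|lra|intros n; now apply geom_bound_rows|easy|easy].
  unfold eval. apply PSeries_ext. intros l.
  unfold PSeries at 1. unfold translate1, translate_seq.
  set (c := fun j i => bin (l + i) l * a (l + i)%nat j * t ^ i * y ^ j).
  transitivity (Series (fun j => Series (fun i => c j i))).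
  { apply Series_ext. intros j. rewrite <- Series_scal_r. now apply Series_ext. }
  set (q := Rmax (2 * r * Rabs t) (r * Rabs y)).
  assert (Ht0 : 0 <= 2 * r * Rabs t) by (pose proof (Rabs_pos t); nra).
  assert (Hy0 : 0 <= r * Rabs y) by (pose proof (Rabs_pos y); nra).
  assert (Hq : 0 <= q < 1).
  { split; [apply Rle_trans with (2 * r * Rabs t); [easy|apply Rmax_l]|now apply Rmax_lub_lt]. }
  rewrite (Series_switch c (K * (2 * r) ^ l) q Hq).
  - apply Series_ext. intros i. unfold PSeries.
    rewrite Rmult_assoc, (Rmult_comm (Series _) (t ^ i)), <- Rmult_assoc, <- Series_scal_l.
    apply Series_ext. intros j. unfold c. ring.
  - intros j i. unfold c. rewrite Rabs_mult, <- RPow_abs.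
    eapply Rle_trans; [apply Rmult_le_compat_r; [apply pow_le, Rabs_pos|]|].
    + apply (translate_term_bound (fun n => a n j) (K * r ^ j) r); [lra|].
      intros n. eapply Rle_trans; [apply H2|]. rewrite pow_add. right; ring.
    + replace (K * r ^ j * (2 * r) ^ l * (2 * r * Rabs t) ^ i * Rabs y ^ j)
        with (K * (2 * r) ^ l * ((r * Rabs y) ^ j * (2 * r * Rabs t) ^ i))
        by (rewrite (Rpow_mult_distr r (Rabs y)); ring).
      apply Rmult_le_compat_l; [apply Rmult_le_pos; [easy|apply pow_le; lra]|].
      rewrite pow_add.
      apply Rmult_le_compat; try (apply pow_le; easy);
        apply pow_incr; (split; [easy|]); [apply Rmax_r|apply Rmax_l].
Qed.

Lemma eval_analytic_at (a : series2) (K r t s : R) :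
  geom_bound a K r -> 4 * r * Rabs t < 1 -> 4 * r * Rabs s < 1 ->
  analytic_at (eval a) t s.
Proof.
  intros Ha Ht Hs. destruct (Ha) as [H0 [H1 H2]].
  pose proof (Rabs_pos t) as Pt. pose proof (Rabs_pos s) as Ps.
  assert (Hb := geom_bound_translate1 a K r t Ha ltac:(nra)).
  set (b := flip2 (translate1 a t)).
  apply geom_bound_flip in Hb. fold b in Hb.
  set (K' := K / (1 - 2 * r * Rabs t)) in Hb.
  assert (Hd := geom_bound_translate1 b _ _ s Hb ltac:(nra)).
  apply geom_bound_flip in Hd.
  set (d := flip2 (translate1 b s)) in Hd.
  assert (Hpos : 0 < / (8 * r)) by (apply Rinv_0_lt_compat; lra).
  exists d, (mkposreal _ Hpos). intros h k Hh Hk. simpl in Hh, Hk.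
  assert (Hsmall : forall z, Rabs z < / (8 * r) -> 8 * r * Rabs z < 1).
  { intros z Hz. apply (Rmult_lt_compat_l (8 * r)) in Hz; [|lra].
    rewrite Rinv_r in Hz; lra. }
  apply Hsmall in Hh. apply Hsmall in Hk.
  pose proof (Rabs_pos h) as Ph. pose proof (Rabs_pos k) as Pk.
  assert (E : eval d h k = eval a (t + h) (s + k)).
  { unfold d.
    rewrite <- (eval_flip Hd) by nra. unfold d.
    change (flip2 (flip2 ?x)) with x.
    rewrite (eval_translate1 b _ _ s k h Hb) by nra.
    assert (Hsk : 2 * r * Rabs (s + k) < 1) by (pose proof (Rabs_triang s k); nra).
    unfold b. rewrite <- (eval_flip Hb) by nra. unfold b. change (flip2 (flip2 ?x)) with x.
    apply (eval_translate1 a K r); auto; nra. }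
  split.
  - eapply ex_series_ext; [|apply (eval_abs_diag Hd (x := h) (y := k)); nra].
    intros n. simpl. now rewrite sum_n_Reals.
  - rewrite <- E.
    eapply is_series_ext; [|apply (eval_diag Hd (x := h) (y := k)); nra].
    intros n. simpl. now rewrite sum_n_Reals.
Qed.

(** Coefficients of [f (x + c y, y)]: the monomial [x^k y^m] receives a contribution from
    [(x + c y)^(k+l) y^(m-l)] for each [l <= m]. *)
Definition shear2 (c : R) (a : series2) : series2 := fun k m =>
  sum_f_R0 (fun l => bin (k + l) k * c ^ l * a (k + l)%nat (m - l)%nat) m.

Lemma geom_bound_shear2 (a : series2) (K r c : R) :
  geom_bound a K r -> geom_bound (shear2 c a) K (4 * (1 + Rabs c) * r).
Proof.
  intros [H0 [H1 H2]]. pose proof (Rabs_pos c) as Pc. split; [easy|]. split; [nra|].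
  intros k m. unfold shear2.
  eapply Rle_trans; [apply Rsum_abs|].
  eapply Rle_trans; [apply sum_Rle with
    (Bn := fun _ => 2 ^ (k + m) * (1 + Rabs c) ^ (k + m) * (K * r ^ (k + m)))|].
  - intros l Hl. rewrite 2!Rabs_mult, <- RPow_abs, (Rabs_pos_eq (bin _ _)) by apply bin_nonneg.
    replace (k + m)%nat with (k + l + (m - l))%nat at 3 by lia.
    apply Rmult_le_compat; [|apply Rabs_pos| |apply H2].
    + apply Rmult_le_pos; [apply bin_nonneg|apply pow_le; lra].
    + apply Rmult_le_compat; [apply bin_nonneg|apply pow_le; lra| |].
      * eapply Rle_trans; [apply bin_le_pow2|]. apply Rle_pow; [lra|lia].
      * apply Rle_trans with ((1 + Rabs c) ^ l); [apply pow_incr; lra|].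
        apply Rle_pow; [lra|lia].
  - rewrite sum_cte.
    replace (4 * (1 + Rabs c) * r) with (2 * (2 * ((1 + Rabs c) * r))) by ring.
    rewrite 2!(Rpow_mult_distr 2), (Rpow_mult_distr (1 + Rabs c)).
    assert (INR (S m) <= 2 ^ (k + m)).
    { eapply Rle_trans; [apply le_pow2|]. apply Rle_pow; [lra|lia]. }
    replace (K * (2 ^ (k + m) * (2 ^ (k + m) * ((1 + Rabs c) ^ (k + m) * r ^ (k + m)))))
      with (2 ^ (k + m) * (1 + Rabs c) ^ (k + m) * (K * r ^ (k + m)) * 2 ^ (k + m)) by ring.
    apply Rmult_le_compat_l; [|easy].
    repeat apply Rmult_le_pos; try apply pow_le; lra.
Qed.

(** A linear substitution preserves total degree, so the two series summed by total degree agree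
    term by term. *)
Lemma eval_shear2 (a : series2) (K r c x y : R) :
  geom_bound a K r ->
  4 * (1 + Rabs c) * r * Rabs x < 1 -> 4 * (1 + Rabs c) * r * Rabs y < 1 ->
  eval (shear2 c a) x y = eval a (x + c * y) y.
Proof.
  intros Ha Hx Hy. assert (Hs := geom_bound_shear2 a K r c Ha).
  destruct (Ha) as [H0 [H1 H2]].
  pose proof (Rabs_pos c) as Pc. pose proof (Rabs_pos x) as Px. pose proof (Rabs_pos y) as Py.
  assert (Hry : r * Rabs y < 1).
  { assert (0 <= Rabs c * (r * Rabs y)) by (apply Rmult_le_pos; [lra|apply Rmult_le_pos; lra]).
    nra. }
  assert (Hrx : r * Rabs (x + c * y) < 1).
  { pose proof (Rabs_triang x (c * y)) as T. rewrite Rabs_mult in T.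
    assert (Hrx0 : 0 <= r * Rabs x) by (apply Rmult_le_pos; lra).
    assert (Hry0 : 0 <= r * Rabs y) by (apply Rmult_le_pos; lra).
    assert (0 <= Rabs c * (r * Rabs x)) by (apply Rmult_le_pos; lra).
    assert (4 * (r * Rabs x + Rabs c * (r * Rabs x)) < 1) by lra.
    assert (4 * (r * Rabs y + Rabs c * (r * Rabs y)) < 1) by lra.
    nra. }
  rewrite <- (is_series_unique _ _ (eval_diag Hs Hx Hy)).
  apply is_series_unique.
  eapply is_series_ext; [|apply (eval_diag Ha Hrx Hry)].
  intros n. simpl.
  transitivity (sum_f_R0 (fun i => sum_f_R0 (fun k =>
    (fun k l => bin (k + l) k * c ^ l * a (k + l)%nat (n - k - l)%nat * x ^ k * y ^ (n - k))
    k (i - k)%nat) i) n).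
  - apply sum_eq. intros i Hi.
    rewrite (binomial_bin x (c * y)), Rmult_assoc, (Rmult_comm (sum_f_R0 _ _)),
      <- Rmult_assoc, scal_sum.
    apply sum_eq. intros k Hk.
    replace (k + (i - k))%nat with i by lia.
    replace (n - k - (i - k))%nat with (n - i)%nat by lia.
    replace (n - k)%nat with ((i - k) + (n - i))%nat by lia.
    rewrite pow_add, Rpow_mult_distr. ring.
  - rewrite (sum_f_R0_triangle_diag (fun k l =>
      bin (k + l) k * c ^ l * a (k + l)%nat (n - k - l)%nat * x ^ k * y ^ (n - k))).
    apply sum_eq. intros k Hk. unfold shear2.
    rewrite Rmult_assoc, Rmult_comm, scal_sum.
    apply sum_eq. intros l Hl. ring.
Qed.

(** * Germs of analytic functions at the origin *)

Definition near0 (P : R -> R -> Prop) : Prop := locally_2d P 0 0.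

Lemma near0_iff (P : R -> R -> Prop) :
  near0 P <-> exists d, 0 < d /\ forall x y, Rabs x < d -> Rabs y < d -> P x y.
Proof.
  split.
  - intros [d Hd]. exists d. split; [apply cond_pos|]. intros x y Hx Hy.
    apply Hd; now rewrite Rminus_0_r.
  - intros [d [H Hd]]. exists (mkposreal d H). intros x y Hx Hy. simpl in *.
    rewrite Rminus_0_r in *. now apply Hd.
Qed.

Lemma near0_mono (P Q : R -> R -> Prop) :
  (forall x y, P x y -> Q x y) -> near0 P -> near0 Q.
Proof. intros H. apply locally_2d_impl, locally_2d_forall, H. Qed.

Lemma near0_and (P Q : R -> R -> Prop) :
  near0 P -> near0 Q -> near0 (fun x y => P x y /\ Q x y).
Proof. apply locally_2d_and. Qed.

Lemma near0_all (P : R -> R -> Prop) : (forall x y, P x y) -> near0 P.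
Proof. apply locally_2d_forall. Qed.

Lemma near0_open (P : R -> R -> Prop) :
  near0 P -> near0 (fun x y => locally_2d P x y).
Proof.
  intros H. apply (locally_2d_impl_strong P); [|exact H].
  now apply locally_2d_forall.
Qed.

Lemma near0_box (r : R) : near0 (fun x y => r * Rabs x < 1 /\ r * Rabs y < 1).
Proof.
  apply near0_iff. exists (/ (1 + Rabs r)). pose proof (Rabs_pos r) as Pr.
  assert (P : 0 < / (1 + Rabs r)) by (apply Rinv_0_lt_compat; lra).
  split; [easy|].
  assert (H : forall z, Rabs z < / (1 + Rabs r) -> r * Rabs z < 1).
  { intros z Hz. apply Rle_lt_trans with ((1 + Rabs r) * Rabs z).
    - apply Rmult_le_compat_r; [apply Rabs_pos|]. pose proof (Rle_abs r). lra.
    - apply (Rmult_lt_compat_l (1 + Rabs r)) in Hz; [|lra]. rewrite Rinv_r in Hz; lra. }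
  auto.
Qed.

Lemma near0_shear (c : R) (P : R -> R -> Prop) :
  near0 P -> near0 (fun x y => P (x + c * y) y).
Proof.
  intros H. apply near0_iff in H. destruct H as [d [Hd H]].
  pose proof (Rabs_pos c) as Pc.
  apply near0_iff. exists (d / (1 + Rabs c)).
  assert (Hd' : 0 < d / (1 + Rabs c)) by (apply Rdiv_lt_0_compat; lra).
  assert (E : d / (1 + Rabs c) * (1 + Rabs c) = d) by (field; lra).
  split; [easy|]. intros x y Hx Hy. pose proof (Rabs_pos y).
  apply H.
  - eapply Rle_lt_trans; [apply Rabs_triang|]. rewrite Rabs_mult. nra.
  - nra.
Qed.

Lemma near0_swap (P : R -> R -> Prop) : near0 P -> near0 (fun x y => P y x).
Proof.
  intros H. apply near0_iff in H. destruct H as [d [Hd H]].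
  apply near0_iff. exists d. auto.
Qed.

Lemma near0_scal (c : R) (P : R -> R -> Prop) : near0 P -> locally 0 (fun y => P (c * y) y).
Proof.
  intros H. apply (near0_shear c) in H. apply near0_iff in H. destruct H as [d [Hd H]].
  exists (mkposreal d Hd). intros y Hy.
  replace (c * y) with (0 + c * y) by ring. apply H; [now rewrite Rabs_R0|].
  rewrite <- (Rminus_0_r y). exact Hy.
Qed.

Definition expands (f : field2) (a : series2) : Prop :=
  (exists K r, geom_bound a K r) /\ near0 (fun x y => f x y = eval a x y).

Definition germ (f : field2) : Prop := exists a, expands f a.

Lemma germ_ext (f g : field2) : near0 (fun x y => f x y = g x y) -> germ f -> germ g.
Proof.
  intros H [a [Ha Hf]]. exists a. split; [easy|].
  apply (near0_mono (fun x y => f x y = g x y /\ f x y = eval a x y)).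
  - intros x y [E1 E2]. now rewrite <- E1.
  - now apply near0_and.
Qed.

Lemma expands_const (c : R) : expands (fun _ _ => c) (const2 c).
Proof.
  split; [exists (Rabs c), 1; apply geom_bound_const|].
  apply near0_all. intros. now rewrite eval_const.
Qed.

Lemma expands_add (f g : field2) (a b : series2) :
  expands f a -> expands g b -> expands (fun x y => f x y + g x y) (add2 a b).
Proof.
  intros [[K [r Ha]] Hf] [[K' [r' Hb]] Hg].
  destruct (geom_bound_common _ _ _ _ _ _ Ha Hb) as [Ha' Hb'].
  split; [exists (2 * Rmax K K'), (Rmax r r'); now apply geom_bound_add|].
  eapply near0_mono; [|apply (near0_and _ _ (near0_box (Rmax r r')) (near0_and _ _ Hf Hg))].
  intros x y [[Hx Hy] [-> ->]]. symmetry. now apply (eval_add a b (Rmax K K') (Rmax r r')).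
Qed.

Lemma expands_mul (f g : field2) (a b : series2) :
  expands f a -> expands g b -> expands (fun x y => f x y * g x y) (mul2 a b).
Proof.
  intros [[K [r Ha]] Hf] [[K' [r' Hb]] Hg].
  destruct (geom_bound_common _ _ _ _ _ _ Ha Hb) as [Ha' Hb'].
  split; [exists (Rmax K K' * Rmax K K'), (2 * Rmax r r'); now apply geom_bound_mul|].
  eapply near0_mono; [|apply (near0_and _ _ (near0_box (Rmax r r')) (near0_and _ _ Hf Hg))].
  intros x y [[Hx Hy] [-> ->]]. symmetry. now apply (eval_mul a b (Rmax K K') (Rmax r r')).
Qed.

(** A derivative at a point depends on the values around that point, hence the passage through
    [near0_open]. *)
Lemma near0_D_ext (i : axis) (f g : field2) :
  near0 (fun x y => f x y = g x y) -> near0 (fun x y => D i f x y = D i g x y).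
Proof.
  intros H. eapply near0_mono; [|apply near0_open, H]. intros x y Hl.
  destruct i; simpl; apply Derive_ext_loc.
  - exact (locally_2d_1d_const_y _ _ _ Hl).
  - exact (locally_2d_1d_const_x _ _ _ Hl).
Qed.

Definition pd (i : axis) : series2 -> series2 := match i with X1 => pd1 | X2 => pd2 end.

Lemma expands_D (i : axis) (f : field2) (a : series2) :
  expands f a -> expands (D i f) (pd i a).
Proof.
  intros [[K [r Ha]] Hf]. split.
  - exists (K * r), (2 * r). destruct i; [now apply geom_bound_pd1|now apply geom_bound_pd2].
  - apply (near0_D_ext i) in Hf.
    eapply near0_mono; [|apply (near0_and _ _ (near0_box (2 * r)) Hf)].
    intros x y [[Hx Hy] ->]. destruct (Ha) as [_ [H1 _]].
    pose proof (Rabs_pos x). pose proof (Rabs_pos y).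
    destruct i; simpl; apply is_derive_unique.
    + apply (is_derive_eval1 Ha); nra.
    + now apply (is_derive_eval2 a K r).
Qed.

Lemma expands_swap (f : field2) (a : series2) :
  expands f a -> expands (fun x y => f y x) (flip2 a).
Proof.
  intros [[K [r Ha]] Hf]. split; [exists K, r; now apply geom_bound_flip|].
  apply near0_swap in Hf.
  eapply near0_mono; [|apply (near0_and _ _ (near0_box r) Hf)].
  intros x y [[Hx Hy] ->]. symmetry. now apply (eval_flip Ha).
Qed.

Lemma expands_shear (c : R) (f : field2) (a : series2) :
  expands f a -> expands (fun x y => f (x + c * y) y) (shear2 c a).
Proof.
  intros [[K [r Ha]] Hf].
  split; [exists K, (4 * (1 + Rabs c) * r); now apply geom_bound_shear2|].
  apply (near0_shear c) in Hf.
  eapply near0_mono; [|apply (near0_and _ _ (near0_box (4 * (1 + Rabs c) * r)) Hf)].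
  intros x y [[Hx Hy] ->]. symmetry. now apply (eval_shear2 a K r).
Qed.

Lemma germ_const (c : R) : germ (fun _ _ => c).
Proof. eexists. apply expands_const. Qed.

Lemma germ_add (f g : field2) : germ f -> germ g -> germ (fun x y => f x y + g x y).
Proof. intros [a Ha] [b Hb]. eexists. apply expands_add; eassumption. Qed.

Lemma germ_mul (f g : field2) : germ f -> germ g -> germ (fun x y => f x y * g x y).
Proof. intros [a Ha] [b Hb]. eexists. apply expands_mul; eassumption. Qed.

Lemma germ_opp (f : field2) : germ f -> germ (fun x y => - f x y).
Proof.
  intros H. apply (germ_ext (fun x y => (-1) * f x y)).
  - apply near0_all. intros. ring.
  - apply (germ_mul (fun _ _ => -1)); [apply germ_const|easy].
Qed.

Lemma germ_minus (f g : field2) : germ f -> germ g -> germ (fun x y => f x y - g x y).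
Proof. intros Hf Hg. apply germ_add; [easy|now apply germ_opp]. Qed.

Lemma germ_pow2 (f : field2) : germ f -> germ (fun x y => f x y ^ 2).
Proof.
  intros H. apply (germ_ext (fun x y => f x y * f x y)).
  - apply near0_all. intros. ring.
  - now apply germ_mul.
Qed.

Lemma germ_D (i : axis) (f : field2) : germ f -> germ (D i f).
Proof. intros [a Ha]. eexists. apply expands_D; eassumption. Qed.

Lemma germ_swap (f : field2) : germ f -> germ (fun x y => f y x).
Proof. intros [a Ha]. eexists. apply expands_swap; eassumption. Qed.

Lemma germ_shear (c : R) (f : field2) : germ f -> germ (fun x y => f (x + c * y) y).
Proof. intros [a Ha]. eexists. apply expands_shear; eassumption. Qed.

Lemma analytic_at_ext (f g : field2) (x y : R) :
  locally_2d (fun u v => f u v = g u v) x y -> analytic_at f x y -> analytic_at g x y.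
Proof.
  intros [d Hd] [a [r H]].
  exists a, (mkposreal _ (Rmin_pos _ _ (cond_pos d) (cond_pos r))). simpl. intros h k Hh Hk.
  rewrite <- Hd.
  - apply H; eapply Rlt_le_trans; try eassumption; apply Rmin_r.
  - replace (x + h - x) with h by ring. eapply Rlt_le_trans; [eassumption|apply Rmin_l].
  - replace (y + k - y) with k by ring. eapply Rlt_le_trans; [eassumption|apply Rmin_l].
Qed.

Lemma germ_analytic_near0 (f : field2) : germ f -> analytic_near0 f.
Proof.
  intros [a [[K [r Ha]] Hf]]. apply near0_open in Hf.
  unfold analytic_near0.
  eapply near0_mono; [|apply (near0_and _ _ (near0_box (4 * r)) Hf)].
  intros x y [[Hx Hy] Hl]. apply (analytic_at_ext (eval a)).
  - revert Hl. apply locally_2d_impl, locally_2d_forall. now intros.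
  - now apply (eval_analytic_at a K r).
Qed.

(** The expansion at the origin alone is used. Its absolutely convergent series at [(s, s)] has
    bounded terms, which yields a geometric bound of ratio [/ s]. *)
Lemma analytic_near0_germ (f : field2) : analytic_near0 f -> germ f.
Proof.
  intros H. apply locally_2d_singleton in H. destruct H as [a [r H]].
  (* [r / 2] stays inside the region of convergence; the cap 1 ensures [1 <= / s], as [geom_bound]
     demands. *)
  set (s := Rmin (r / 2) 1).
  assert (Hs : 0 < s <= 1).
  { split; [apply Rmin_pos; [|lra]|apply Rmin_r]. pose proof (cond_pos r). lra. }
  assert (Hsr : Rabs s < r).
  { rewrite Rabs_pos_eq by lra. pose proof (Rmin_l (r / 2) 1). fold s in H0.
    pose proof (cond_pos r). lra. }
  destruct (H s s Hsr Hsr) as [Hex _].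
  assert (Hb := ex_series_lim_0 _ Hex).
  destruct (filterlim_bounded (K := R_AbsRing) (V := R_NormedModule) _ (ex_intro _ 0 Hb))
    as [M HM].
  assert (Hgb : geom_bound a (Rabs M) (/ s)).
  { split; [apply Rabs_pos|]. split; [rewrite <- Rinv_1; apply Rinv_le_contravar; lra|].
    intros i j. specialize (HM (i + j)%nat).
    unfold norm in HM; simpl in HM; unfold abs in HM; simpl in HM.
    rewrite sum_n_Reals in HM.
    rewrite pow_inv.
    apply (Rmult_le_reg_r (s ^ (i + j))); [apply pow_lt; lra|].
    rewrite Rmult_assoc, Rinv_l, Rmult_1_r by (apply pow_nonzero; lra).
    eapply Rle_trans; [|apply (Rle_abs M)].
    eapply Rle_trans; [|apply HM]. eapply Rle_trans; [|apply Rle_abs].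
    set (g := fun k => Rabs (a k (i + j - k)%nat * s ^ k * s ^ (i + j - k))).
    apply Rle_trans with (g i).
    - unfold g. replace (i + j - i)%nat with j by lia.
      rewrite 2!Rabs_mult, !(Rabs_pos_eq (s ^ _)) by (apply pow_le; lra).
      rewrite pow_add. lra.
    - assert (Hg : forall n, (i <= n)%nat -> g i <= sum_f_R0 g n).
      { induction n as [|n IH]; intros Hi.
        - replace i with O by lia. simpl. lra.
        - destruct (Nat.eq_dec i (S n)) as [->|Hn].
          + rewrite tech5. pose proof (cond_pos_sum g n) as P.
            assert (0 <= sum_f_R0 g n) by (apply P; intros; apply Rabs_pos). lra.
          + rewrite tech5. assert (0 <= g (S n)) by apply Rabs_pos.
            specialize (IH ltac:(lia)). lra. }
      apply Hg. lia. }
  exists a. split; [eauto|].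
  eapply near0_mono; [|apply (near0_and _ _ (near0_box (/ s)) (near0_box (/ r)))].
  intros x y [[Hx Hy] [Hx' Hy']].
  assert (Hsmall : forall z, / r * Rabs z < 1 -> Rabs z < r).
  { intros z Hz. pose proof (cond_pos r) as P. apply (Rmult_lt_compat_l r) in Hz; [|easy].
    rewrite <- Rmult_assoc, Rinv_r in Hz; lra. }
  destruct (H x y (Hsmall x Hx') (Hsmall y Hy')) as [_ Hser].
  rewrite 2!Rplus_0_l in Hser.
  rewrite <- (is_series_unique _ _ (eval_diag Hgb Hx Hy)).
  symmetry. apply is_series_unique. revert Hser. apply is_series_ext.
  intros n. now rewrite sum_n_Reals.
Qed.

Lemma eval_bound (a : series2) (K r x y : R) :
  geom_bound a K r -> 2 * r * Rabs x <= 1 -> 2 * r * Rabs y <= 1 ->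
  Rabs (eval a x y) <= 4 * K.
Proof.
  intros Ha Hx Hy. destruct (Ha) as [H0 [H1 H2]].
  assert (Hinv : forall z C, 0 <= C -> 2 * r * Rabs z <= 1 -> C / (1 - r * Rabs z) <= 2 * C).
  { intros z C HC Hz. apply (Rmult_le_reg_r (1 - r * Rabs z)); [lra|].
    unfold Rdiv. rewrite Rmult_assoc, Rinv_l by lra. nra. }
  eapply Rle_trans; [apply (PSeries_bound _ (2 * K) r); [lra| |lra]|].
  - intros i. eapply Rle_trans; [apply geom_bound_rows; [eassumption|lra]|].
    apply Rmult_le_compat_r; [apply pow_le; lra|]. now apply Hinv.
  - eapply Rle_trans; [apply Hinv; [lra|easy]|]. lra.
Qed.

Lemma Rabs_between (a b c m : R) :
  Rmin a b <= c <= Rmax a b -> Rabs a <= m -> Rabs b <= m -> Rabs c <= m.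
Proof.
  intros [H1 H2] Ha Hb. apply Rabs_le_between in Ha. apply Rabs_le_between in Hb.
  apply Rabs_le_between. split.
  - eapply Rle_trans; [|apply H1]. apply Rmin_glb; lra.
  - eapply Rle_trans; [apply H2|]. apply Rmax_lub; lra.
Qed.

Lemma MVT_is_derive (f df : R -> R) (a b m : R) :
  Rabs a <= m -> Rabs b <= m -> (forall z, Rabs z <= m -> is_derive f z (df z)) ->
  exists c, Rmin a b <= c <= Rmax a b /\ f b - f a = df c * (b - a).
Proof.
  intros Ha Hb H. apply MVT_gen.
  - intros z Hz. apply H. apply (Rabs_between a b); auto. lra.
  - intros z Hz. apply continuity_pt_filterlim.
    apply (ex_derive_continuous (K := R_AbsRing) (V := R_NormedModule) f z).
    eexists. apply H. now apply (Rabs_between a b).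
Qed.

Lemma eval_lipschitz (a : series2) (K r m x y x' y' : R) :
  geom_bound a K r -> 4 * r * m <= 1 -> 0 <= m ->
  Rabs x <= m -> Rabs y <= m -> Rabs x' <= m -> Rabs y' <= m ->
  Rabs (eval a x y - eval a x' y') <= 4 * (K * r) * (Rabs (x - x') + Rabs (y - y')).
Proof.
  intros Ha Hm Hm0 Hx Hy Hx' Hy'. destruct (Ha) as [H0 [H1 _]].
  assert (Hin : forall z, Rabs z <= m -> 4 * r * Rabs z <= 1).
  { intros z Hz. assert (4 * r * Rabs z <= 4 * r * m) by (apply Rmult_le_compat_l; lra). lra. }
  assert (Hin2 : forall z, Rabs z <= m -> 2 * r * Rabs z < 1).
  { intros z Hz. pose proof (Hin z Hz). pose proof (Rabs_pos z). nra. }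
  assert (Hin1 : forall z, Rabs z <= m -> r * Rabs z < 1).
  { intros z Hz. pose proof (Hin z Hz). pose proof (Rabs_pos z). nra. }
  destruct (MVT_is_derive (fun z => eval a z y) (fun z => eval (pd1 a) z y) x' x m)
    as [c [Hc E1]]; auto.
  { intros z Hz. apply (is_derive_eval1 Ha); auto. }
  destruct (MVT_is_derive (fun z => eval a x' z) (fun z => eval (pd2 a) x' z) y' y m)
    as [d [Hd E2]]; auto.
  { intros z Hz. apply (is_derive_eval2 a K r); auto. }
  replace (eval a x y - eval a x' y')
    with (eval a x y - eval a x' y + (eval a x' y - eval a x' y')) by ring.
  rewrite E1, E2.
  eapply Rle_trans; [apply Rabs_triang|]. rewrite 2!Rabs_mult.
  assert (Hcm := Rabs_between _ _ _ _ Hc Hx' Hx).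
  assert (Hdm := Rabs_between _ _ _ _ Hd Hy' Hy).
  assert (B1 : Rabs (eval (pd1 a) c y) <= 4 * (K * r)).
  { apply (eval_bound _ _ (2 * r)); [now apply geom_bound_pd1| |].
    - pose proof (Hin c Hcm). lra.
    - pose proof (Hin y Hy). lra. }
  assert (B2 : Rabs (eval (pd2 a) x' d) <= 4 * (K * r)).
  { apply (eval_bound _ _ (2 * r)); [now apply geom_bound_pd2| |].
    - pose proof (Hin x' Hx'). lra.
    - pose proof (Hin d Hdm). lra. }
  pose proof (Rabs_pos (x - x')). pose proof (Rabs_pos (y - y')). nra.
Qed.

(** Joint differentiability is what the chain rule along oblique lines requires. The partial
    derivatives are Lipschitz, so the remainder is quadratic in the increment. *)
Lemma eval_differentiable (a : series2) (K r x y : R) :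
  geom_bound a K r -> 16 * r * Rabs x < 1 -> 16 * r * Rabs y < 1 ->
  differentiable_pt_lim (eval a) x y (eval (pd1 a) x y) (eval (pd2 a) x y).
Proof.
  intros Ha Hx Hy eps. destruct (Ha) as [H0 [H1 _]].
  set (m := / (8 * r)).
  assert (Hm : 8 * r * m = 1) by (unfold m; field; lra).
  assert (Hmp : 0 < m) by (unfold m; apply Rinv_0_lt_compat; lra).
  set (L := 4 * (K * r * (2 * r))).
  assert (HL : 0 <= L) by (unfold L; nra).
  (* The remainder is at most [3 * L * mx * mx]: [2 * L] comes from the [x]-increment, where both
     arguments move, and [L] from the [y]-increment. The bound [m / 2] keeps the moved point within
     [m]. *)
  assert (Hd : 0 < Rmin (m / 2) (eps / (3 * L + 1))).
  { apply Rmin_pos; [lra|]. apply Rdiv_lt_0_compat; [apply cond_pos|lra]. }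
  exists (mkposreal _ Hd). simpl. intros u v Hu Hv.
  assert (Hhalf : forall z, 16 * r * Rabs z < 1 -> Rabs z <= m / 2).
  { intros z Hz. apply (Rmult_le_reg_l (16 * r)); [lra|].
    replace (16 * r * (m / 2)) with (8 * r * m) by field. lra. }
  pose proof (Hhalf x Hx) as Hxm. pose proof (Hhalf y Hy) as Hym.
  assert (Hum : Rabs u <= m).
  { pose proof (Rabs_triang_inv u x). pose proof (Rmin_l (m / 2) (eps / (3 * L + 1))). lra. }
  assert (Hvm : Rabs v <= m).
  { pose proof (Rabs_triang_inv v y). pose proof (Rmin_l (m / 2) (eps / (3 * L + 1))). lra. }
  assert (Hin : forall z, Rabs z <= m -> 8 * r * Rabs z <= 1).
  { intros z Hz. assert (8 * r * Rabs z <= 8 * r * m) by (apply Rmult_le_compat_l; lra). lra. }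
  assert (Hin2 : forall z, Rabs z <= m -> 2 * r * Rabs z < 1).
  { intros z Hz. pose proof (Hin z Hz). pose proof (Rabs_pos z). nra. }
  assert (Hin1 : forall z, Rabs z <= m -> r * Rabs z < 1).
  { intros z Hz. pose proof (Hin z Hz). pose proof (Rabs_pos z). nra. }
  assert (Hxm' : Rabs x <= m) by lra. assert (Hym' : Rabs y <= m) by lra.
  destruct (MVT_is_derive (fun z => eval a z v) (fun z => eval (pd1 a) z v) x u m)
    as [c [Hc E1]]; auto.
  { intros z Hz. apply (is_derive_eval1 Ha); auto. }
  destruct (MVT_is_derive (fun z => eval a x z) (fun z => eval (pd2 a) x z) y v m)
    as [d [Hdd E2]]; auto.
  { intros z Hz. apply (is_derive_eval2 a K r); auto. }
  assert (Hcm := Rabs_between _ _ _ _ Hc Hxm' Hum).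
  assert (Hdm := Rabs_between _ _ _ _ Hdd Hym' Hvm).
  set (mx := Rmax (Rabs (u - x)) (Rabs (v - y))).
  assert (Mu : Rabs (u - x) <= mx) by apply Rmax_l.
  assert (Mv : Rabs (v - y) <= mx) by apply Rmax_r.
  assert (Hmid : forall p q s, Rmin p q <= s <= Rmax p q -> Rabs (s - p) <= Rabs (q - p)).
  { intros p q s Hs. unfold Rmin, Rmax in Hs. unfold Rabs.
    destruct (Rle_dec p q), (Rcase_abs (s - p)), (Rcase_abs (q - p)); lra. }
  assert (B1 : Rabs (eval (pd1 a) c v - eval (pd1 a) x y) <= L * (2 * mx)).
  { eapply Rle_trans; [apply (eval_lipschitz _ _ _ m _ _ _ _ (geom_bound_pd1 _ _ _ Ha)); auto; lra|].
    apply Rmult_le_compat_l; [exact HL|]. pose proof (Hmid _ _ _ Hc). lra. }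
  assert (B2 : Rabs (eval (pd2 a) x d - eval (pd2 a) x y) <= L * mx).
  { eapply Rle_trans; [apply (eval_lipschitz _ _ _ m _ _ _ _ (geom_bound_pd2 _ _ _ Ha)); auto; lra|].
    apply Rmult_le_compat_l; [exact HL|]. pose proof (Hmid _ _ _ Hdd).
    rewrite (Rminus_diag_eq x x), Rabs_R0 by easy. lra. }
  replace (eval a u v - eval a x y - (eval (pd1 a) x y * (u - x) + eval (pd2 a) x y * (v - y)))
    with ((eval (pd1 a) c v - eval (pd1 a) x y) * (u - x)
          + (eval (pd2 a) x d - eval (pd2 a) x y) * (v - y)) by lra.
  eapply Rle_trans; [apply Rabs_triang|]. rewrite 2!Rabs_mult.
  pose proof (Rabs_pos (u - x)). pose proof (Rabs_pos (v - y)).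
  apply Rle_trans with (L * (2 * mx) * mx + L * mx * mx).
  { apply Rplus_le_compat; apply Rmult_le_compat; auto using Rabs_pos. }
  replace (L * (2 * mx) * mx + L * mx * mx) with (3 * L * mx * mx) by ring.
  apply Rmult_le_compat_r; [lra|].
  assert (Hmx : mx < eps / (3 * L + 1)).
  { apply Rmax_lub_lt; (eapply Rlt_le_trans; [eassumption|apply Rmin_r]). }
  assert (E : eps / (3 * L + 1) * (3 * L + 1) = eps) by (field; lra).
  assert (mx * (3 * L + 1) <= eps) by (rewrite <- E; apply Rmult_le_compat_r; lra).
  lra.
Qed.

Lemma germ_differentiable (f : field2) : germ f ->
  near0 (fun x y => differentiable_pt_lim f x y (D X1 f x y) (D X2 f x y)).
Proof.
  intros [a Ha]. pose proof (expands_D X1 f a Ha) as [_ H1].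
  pose proof (expands_D X2 f a Ha) as [_ H2]. destruct Ha as [[K [r Ha]] Hf].
  apply near0_open in Hf.
  eapply near0_mono; [|apply (near0_and _ _ (near0_box (16 * r))
    (near0_and _ _ Hf (near0_and _ _ H1 H2)))].
  intros x y [[Hx Hy] [Hl [-> ->]]].
  apply differentiable_pt_lim_ext with (eval a).
  - revert Hl. apply locally_2d_impl, locally_2d_forall. now intros.
  - now apply (eval_differentiable a K r).
Qed.

Lemma germ_continuous0 (f : field2) : germ f -> continuity_2d_pt f 0 0.
Proof.
  intros H. apply differentiable_continuity_pt.
  apply germ_differentiable, locally_2d_singleton in H. now do 2 eexists; apply H.
Qed.

Lemma germ_pos (f : field2) : germ f -> 0 < f 0 0 -> near0 (fun x y => 0 < f x y).
Proof.
  intros Hf H. apply germ_continuous0 in Hf. specialize (Hf (mkposreal _ H)).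
  eapply near0_mono; [|exact Hf]. simpl. intros x y Hxy.
  apply Rabs_lt_between in Hxy. lra.
Qed.

Lemma germ_neq0 (f : field2) : germ f -> f 0 0 <> 0 -> near0 (fun x y => f x y <> 0).
Proof.
  intros Hf H. assert (Hg := germ_pos (fun x y => f x y * f x y) (germ_mul f f Hf Hf)).
  eapply near0_mono; [|apply Hg; nra]. simpl. intros x y Hxy E. rewrite E in Hxy. lra.
Qed.

Lemma germ_schwarz (f : field2) : germ f ->
  near0 (fun x y => D X1 (D X2 f) x y = D X2 (D X1 f) x y).
Proof.
  intros [a Ha].
  pose proof (expands_D X1 _ _ (expands_D X2 f a Ha)) as [_ H1].
  pose proof (expands_D X2 _ _ (expands_D X1 f a Ha)) as [_ H2].
  eapply near0_mono; [|apply (near0_and _ _ H1 H2)]. intros x y [-> ->].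
  unfold eval. apply PSeries_ext. intros i. apply PSeries_ext. intros j.
  simpl. unfold pd1, pd2. ring.
Qed.

(** * Majorants *)

(** [wt] reproduces itself under Cauchy products, and [wt'], which is comparable
    to the coefficients of the derivative of [sum_n wt n z^n], absorbs products
    with [wt]. *)
Definition wt (n : nat) : R := / INR (S n) ^ 2.
Definition wt' (n : nat) : R := / INR (S n).

Lemma S_INR_pos (n : nat) : 0 < INR (S n).
Proof. apply lt_0_INR. lia. Qed.

Lemma wt_pos (n : nat) : 0 < wt n.
Proof. apply Rinv_0_lt_compat, pow_lt, S_INR_pos. Qed.

Lemma wt'_pos (n : nat) : 0 < wt' n.
Proof. apply Rinv_0_lt_compat, S_INR_pos. Qed.

Lemma wt_le_wt' (n : nat) : wt n <= wt' n.
Proof.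
  unfold wt, wt'. pose proof (S_INR_pos n). pose proof (pos_INR n).
  apply Rinv_le_contravar; [easy|]. rewrite S_INR in *. nra.
Qed.

Lemma wt_S_le_wt' (n : nat) : INR (S n) * wt (S n) <= wt' n.
Proof.
  unfold wt, wt'. pose proof (S_INR_pos n). rewrite (S_INR (S n)). set (z := INR (S n)) in *.
  apply (Rmult_le_reg_r (z * (z + 1) ^ 2)); [apply Rmult_lt_0_compat; [easy|apply pow_lt; lra]|].
  field_simplify; [nra|lra|lra].
Qed.

Lemma wt'_le_wt_S (n : nat) : wt' n <= 4 * (INR (S n) * wt (S n)).
Proof.
  unfold wt, wt'. pose proof (S_INR_pos n). assert (1 <= INR (S n)) by (apply (le_INR 1); lia).
  rewrite (S_INR (S n)). set (z := INR (S n)) in *.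
  apply (Rmult_le_reg_r (z * (z + 1) ^ 2)); [apply Rmult_lt_0_compat; [easy|apply pow_lt; lra]|].
  field_simplify; [nra|lra|lra].
Qed.

Lemma sum_wt (n : nat) : sum_f_R0 wt n <= 2.
Proof.
  (* The sharper bound makes the induction telescope: [1 / (z + 1)^2 <= 1 / z - 1 / (z + 1)]. *)
  assert (H : sum_f_R0 wt n <= 2 - / INR (S n)).
  { induction n as [|n IH].
    - unfold wt; simpl. lra.
    - rewrite tech5. eapply Rle_trans; [apply Rplus_le_compat_r, IH|].
      unfold wt. pose proof (S_INR_pos n). rewrite (S_INR (S n)). set (z := INR (S n)) in *.
      apply (Rmult_le_reg_r (z * (z + 1) ^ 2)); [apply Rmult_lt_0_compat; [easy|apply pow_lt; lra]|].
      field_simplify; [nra|lra|lra]. }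
  pose proof (wt'_pos n). unfold wt' in *. lra.
Qed.

(** Put [p = k + 1] and [q = n - k + 1], so [n + 1 = p + q - 1]. From
    [(p + q - 1)^2 <= 2 (p^2 + q^2)], each term is at most [2 wt n (wt k + wt (n - k))]; the
    brackets add up to at most 4. *)
Lemma wt_conv (n : nat) : PS_mult wt wt n <= 8 * wt n.
Proof.
  unfold PS_mult.
  apply Rle_trans with (2 * wt n * (sum_f_R0 wt n + sum_f_R0 (fun k => wt (n - k)%nat) n)).
  - rewrite <- sum_plus, scal_sum. apply sum_Rle. intros k Hk.
    unfold wt. assert (E : INR (S n) = INR (S k) + INR (S (n - k)) - 1).
    { rewrite <- plus_INR. replace (S k + S (n - k))%nat with (S (S n)) by lia.
      rewrite (S_INR (S n)). ring. }
    assert (1 <= INR (S k)) by (apply (le_INR 1); lia).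
    assert (1 <= INR (S (n - k))) by (apply (le_INR 1); lia).
    rewrite E. set (p := INR (S k)) in *. set (q := INR (S (n - k))) in *.
    apply (Rmult_le_reg_r (p ^ 2 * q ^ 2 * (p + q - 1) ^ 2)).
    { repeat apply Rmult_lt_0_compat; try apply pow_lt; lra. }
    replace (/ p ^ 2 * / q ^ 2 * (p ^ 2 * q ^ 2 * (p + q - 1) ^ 2)) with ((p + q - 1) ^ 2)
      by (field; lra).
    replace ((/ p ^ 2 + / q ^ 2) * (2 * / (p + q - 1) ^ 2) * (p ^ 2 * q ^ 2 * (p + q - 1) ^ 2))
      with (2 * (p ^ 2 + q ^ 2)) by (field; lra).
    pose proof (pow2_ge_0 (p - q)). nra.
  - rewrite sum_f_R0_rev. pose proof (sum_wt n). pose proof (wt_pos n). nra.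
Qed.

(** The same splitting, now from [q (p + q - 1) <= 2 (p^2 + q^2)]. It lets a derivative be
    multiplied by a lower-order factor without changing its weight. *)
Lemma wt_wt'_conv (n : nat) : PS_mult wt wt' n <= 8 * wt' n.
Proof.
  unfold PS_mult.
  apply Rle_trans with (2 * wt' n * (sum_f_R0 wt n + sum_f_R0 (fun k => wt (n - k)%nat) n)).
  - rewrite <- sum_plus, scal_sum. apply sum_Rle. intros k Hk.
    unfold wt, wt'. assert (E : INR (S n) = INR (S k) + INR (S (n - k)) - 1).
    { rewrite <- plus_INR. replace (S k + S (n - k))%nat with (S (S n)) by lia.
      rewrite (S_INR (S n)). ring. }
    assert (1 <= INR (S k)) by (apply (le_INR 1); lia).
    assert (1 <= INR (S (n - k))) by (apply (le_INR 1); lia).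
    rewrite E. set (p := INR (S k)) in *. set (q := INR (S (n - k))) in *.
    apply (Rmult_le_reg_r (p ^ 2 * q ^ 2 * (p + q - 1))).
    { repeat apply Rmult_lt_0_compat; try apply pow_lt; lra. }
    replace (/ p ^ 2 * / q * (p ^ 2 * q ^ 2 * (p + q - 1))) with (q * (p + q - 1))
      by (field; lra).
    replace ((/ p ^ 2 + / q ^ 2) * (2 * / (p + q - 1)) * (p ^ 2 * q ^ 2 * (p + q - 1)))
      with (2 * (p ^ 2 + q ^ 2)) by (field; lra).
    pose proof (pow2_ge_0 (p - q)). nra.
  - rewrite sum_f_R0_rev. pose proof (sum_wt n). pose proof (wt'_pos n). nra.
Qed.

(** Expresses [z^m z^r = z^(m+r)] for [z = rho x + sg y], through which majorants multiply. *)
Lemma vandermonde (m r i : nat) :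
  sum_f_R0 (fun k => bin m k * bin r (i - k)%nat) i = bin (m + r) i.
Proof.
  revert i. induction m as [|m IH]; intros i.
  - destruct i as [|i]; [simpl; ring|].
    rewrite decomp_sum by lia. simpl pred.
    rewrite (sum_eq _ (fun _ => 0)) by (intros k Hk; simpl; ring).
    rewrite sum_cte. simpl. ring.
  - destruct i as [|i].
    + simpl. rewrite bin_0_r. ring.
    + rewrite decomp_sum by lia. simpl pred.
      rewrite (sum_eq _ (fun k => bin m k * bin r (i - k)%nat
        + bin m (S k) * bin r (S i - S k)%nat)) by (intros k Hk; simpl; ring).
      rewrite sum_plus, IH.
      pose proof (IH (S i)) as E. rewrite decomp_sum in E by lia. simpl pred in E.
      rewrite bin_0_r in E. rewrite bin_0_r. change (S m + r)%nat with (S (m + r)).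
      change (bin (S (m + r)) (S i)) with (bin (m + r) i + bin (m + r) (S i)).
      rewrite <- E. ring.
Qed.

Lemma bin_sym (i j : nat) : bin (i + j) i = bin (i + j) j.
Proof.
  rewrite 2!bin_eq_C by lia. rewrite (pascal_step1 _ i) by lia. f_equal. lia.
Qed.

Lemma bin_absorb_r (i j : nat) :
  INR (S j) * bin (S (i + j)) i = INR (S (i + j)) * bin (i + j) i.
Proof.
  rewrite (bin_sym i j), bin_absorb by lia. f_equal.
  rewrite <- (Nat.add_succ_r i j). apply bin_sym.
Qed.

Lemma sum_shift_le (h : nat -> R) (k j n : nat) :
  (forall m, 0 <= h m) -> (k + j <= n)%nat ->
  sum_f_R0 (fun l => h (k + l)%nat) j <= sum_f_R0 h n.
Proof.
  intros Hh Hn.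
  assert (H1 : sum_f_R0 (fun l => h (k + l)%nat) j <= sum_f_R0 h (k + j)).
  { clear Hn. induction j as [|j IH].
    - rewrite Nat.add_0_r. simpl. rewrite Nat.add_0_r. destruct k as [|k]; [simpl; lra|].
      rewrite tech5. pose proof (sum_f_R0_nonneg h k (fun i _ => Hh i)). lra.
    - rewrite tech5, Nat.add_succ_r, tech5. lra. }
  eapply Rle_trans; [apply H1|]. clear H1. induction Hn as [|n Hn IH]; [lra|].
  rewrite tech5. pose proof (Hh (S n)). lra.
Qed.

(** Coefficientwise domination of [a] by [sum_n al n (rho x + sg y)^n]. *)
Definition majorized (a : series2) (al : nat -> R) (rho sg : R) : Prop :=
  forall i j, Rabs (a i j) <= al (i + j)%nat * bin (i + j) i * (rho ^ i * sg ^ j).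

Lemma majorized_weaken (a : series2) (al be : nat -> R) (rho sg : R) :
  0 <= rho -> 0 <= sg -> (forall n, al n <= be n) ->
  majorized a al rho sg -> majorized a be rho sg.
Proof.
  intros Hr Hs H Ha i j. eapply Rle_trans; [apply Ha|].
  apply Rmult_le_compat_r; [apply Rmult_le_pos; now apply pow_le|].
  apply Rmult_le_compat_r; [apply bin_nonneg|apply H].
Qed.

Lemma majorized_add (a b : series2) (al be : nat -> R) (rho sg : R) :
  majorized a al rho sg -> majorized b be rho sg ->
  majorized (add2 a b) (fun n => al n + be n) rho sg.
Proof.
  intros Ha Hb i j. unfold add2. eapply Rle_trans; [apply Rabs_triang|].
  rewrite 2!Rmult_plus_distr_r. apply Rplus_le_compat; auto.
Qed.

(** Both majorants are series in the single quantity [z = rho x + sg y], so their product is the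
    Cauchy product in [z]. In the proof [m = k + l] is the degree of the first factor; its range is
    enlarged to all [m <= n], which only adds nonnegative terms. *)
Lemma majorized_mul (a b : series2) (al be : nat -> R) (rho sg : R) :
  0 <= rho -> 0 <= sg -> (forall n, 0 <= al n) -> (forall n, 0 <= be n) ->
  majorized a al rho sg -> majorized b be rho sg ->
  majorized (mul2 a b) (PS_mult al be) rho sg.
Proof.
  intros Hr Hs Hal Hbe Ha Hb i j. set (n := (i + j)%nat).
  set (h := fun k m => al m * be (n - m)%nat * (bin m k * bin (n - m) (i - k))).
  assert (Hh : forall k m, 0 <= h k m).
  { intros. repeat apply Rmult_le_pos; auto using bin_nonneg. }
  assert (Hrs : 0 <= rho ^ i * sg ^ j) by (apply Rmult_le_pos; now apply pow_le).
  unfold mul2, PS_mult at 1.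
  apply Rle_trans with (sum_f_R0 (fun k => sum_f_R0 (h k) n) i * (rho ^ i * sg ^ j)).
  - eapply Rle_trans; [apply Rsum_abs|].
    rewrite (Rmult_comm (sum_f_R0 _ i)), scal_sum. apply sum_Rle. intros k Hk.
    eapply Rle_trans; [apply Rsum_abs|].
    apply Rle_trans with (sum_f_R0 (fun l => h k (k + l)%nat) j * (rho ^ i * sg ^ j)).
    + rewrite (Rmult_comm (sum_f_R0 _ j)), scal_sum. apply sum_Rle. intros l Hl.
      rewrite Rabs_mult.
      eapply Rle_trans; [apply Rmult_le_compat; [apply Rabs_pos|apply Rabs_pos|apply Ha|apply Hb]|].
      unfold h. replace (n - (k + l))%nat with (i - k + (j - l))%nat by (unfold n; lia).
      replace (rho ^ i * sg ^ j)
        with (rho ^ k * sg ^ l * (rho ^ (i - k) * sg ^ (j - l))).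
      * right; ring.
      * replace i with (k + (i - k))%nat at 2 by lia.
        replace j with (l + (j - l))%nat at 2 by lia.
        rewrite 2!pow_add. ring.
    + apply Rmult_le_compat_r; [easy|]. apply sum_shift_le; [apply Hh|unfold n; lia].
  - apply Rmult_le_compat_r; [easy|]. rewrite sum_f_R0_swap. right.
    unfold PS_mult. rewrite Rmult_comm, scal_sum. apply sum_eq. intros m Hm. unfold h.
    replace (bin n i) with (bin (m + (n - m)) i) by (f_equal; lia).
    rewrite <- vandermonde, scal_sum. apply sum_eq. intros k Hk. ring.
Qed.

Lemma sqr_le_pow2 (n : nat) : INR (S n) ^ 2 <= 4 * 2 ^ n.
Proof.
  destruct n as [|n]; [simpl; lra|]. induction n as [|n IH]; [simpl; lra|].
  rewrite (S_INR (S (S n))). change (2 ^ S (S n)) with (2 * 2 ^ S n).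
  assert (2 <= INR (S (S n))) by (apply (le_INR 2); lia).
  destruct n as [|n]; [simpl; lra|].
  assert (3 <= INR (S (S (S n)))).
  { replace 3 with (INR 3) by (simpl; ring). apply le_INR. lia. }
  set (z := INR (S (S (S n)))) in *. set (w := 2 ^ S (S n)) in *. nra.
Qed.

Lemma one_le_wt_pow2 (n : nat) : 1 <= 4 * wt n * 2 ^ n.
Proof.
  unfold wt. pose proof (sqr_le_pow2 n).
  assert (0 < INR (S n) ^ 2) by (apply pow_lt, S_INR_pos).
  apply (Rmult_le_reg_l (INR (S n) ^ 2)); [easy|].
  replace (INR (S n) ^ 2 * (4 * / INR (S n) ^ 2 * 2 ^ n)) with (4 * 2 ^ n); [lra|].
  field. pose proof (S_INR_pos n). lra.
Qed.

(** The factor 4 and the doubling of [r] pay for the weight, since [(n + 1)^2 <= 4 * 2^n]. *)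
Lemma geom_bound_majorized (a : series2) (K r rho sg : R) :
  geom_bound a K r -> 2 * r <= sg -> sg <= rho ->
  majorized a (fun n => 4 * K * wt n) rho sg.
Proof.
  intros [H0 [H1 H2]] Hs Hr i j. eapply Rle_trans; [apply H2|].
  pose proof (one_le_wt_pow2 (i + j)) as Hw. pose proof (wt_pos (i + j)) as Hp.
  pose proof (bin_ge_1 (i + j) i ltac:(lia)) as Hb.
  assert (Hrs : (2 * r) ^ (i + j) <= rho ^ i * sg ^ j).
  { rewrite pow_add. apply Rmult_le_compat; try (apply pow_le; lra); apply pow_incr; lra. }
  assert (Hp2 : 0 <= (2 * r) ^ (i + j)) by (apply pow_le; lra).
  apply Rle_trans with (4 * K * wt (i + j) * 1 * (2 * r) ^ (i + j)).
  - rewrite Rpow_mult_distr.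
    assert (0 <= K * r ^ (i + j)) by (apply Rmult_le_pos; [easy|apply pow_le; lra]).
    replace (4 * K * wt (i + j) * 1 * (2 ^ (i + j) * r ^ (i + j)))
      with ((K * r ^ (i + j)) * (4 * wt (i + j) * 2 ^ (i + j))) by ring.
    rewrite <- (Rmult_1_r (K * r ^ (i + j))) at 1. apply Rmult_le_compat_l; easy.
  - assert (0 <= 4 * K * wt (i + j)) by (apply Rmult_le_pos; lra).
    apply Rmult_le_compat; try easy; [lra|]. apply Rmult_le_compat_l; easy.
Qed.

Lemma majorized_geom_bound (a : series2) (A rho sg : R) :
  0 <= A -> 1 <= sg -> sg <= rho -> majorized a (fun n => A * wt n) rho sg ->
  geom_bound a A (2 * rho).
Proof.
  intros HA Hs Hr Ha. split; [easy|]. split; [lra|]. intros i j.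
  eapply Rle_trans; [apply Ha|].
  assert (Hw : wt (i + j) <= 1).
  { unfold wt. rewrite <- Rinv_1. apply Rinv_le_contravar; [lra|].
    assert (1 <= INR (S (i + j))) by (apply (le_INR 1); lia). nra. }
  pose proof (wt_pos (i + j)). pose proof (bin_nonneg (i + j) i). pose proof (bin_le_pow2 (i + j) i).
  rewrite Rpow_mult_distr, (pow_add rho).
  assert (0 <= rho ^ i) by (apply pow_le; lra). assert (0 <= sg ^ j) by (apply pow_le; lra).
  rewrite <- (Rmult_assoc A (2 ^ (i + j))).
  apply Rmult_le_compat.
  - repeat apply Rmult_le_pos; lra.
  - now apply Rmult_le_pos.
  - apply Rmult_le_compat; try easy; nra.
  - apply Rmult_le_compat_l; [easy|]. apply pow_incr; lra.
Qed.

(** * Quasilinear expressions *)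

(** Right-hand sides are syntax because each is read in several ways: as a function ([val0],
    [val1]), as a formal series ([formal0], [formal1]), and after a change of variables
    ([shear_lower], [shear_quasilinear]). The majorant estimates go by induction on it. *)
Inductive lower (K : Type) : Type :=
  | Coef (f : field2)
  | Var (k : K)
  | Add0 (e1 e2 : lower K)
  | Mul0 (e1 e2 : lower K).
Arguments Coef {K}. Arguments Var {K}. Arguments Add0 {K}. Arguments Mul0 {K}.

(** The separate level forces linearity in the [y]-derivatives: the weight [wt'] survives a product
    with [wt], but the Cauchy square of [wt'] grows by a logarithm. *)
Inductive quasilinear (K : Type) : Type :=
  | Low (e : lower K)
  | Dy (k : K)
  | Add1 (q1 q2 : quasilinear K)
  | Mul1 (e : lower K) (q : quasilinear K).
Arguments Low {K}. Arguments Dy {K}. Arguments Add1 {K}. Arguments Mul1 {K}.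

Fixpoint coefs0 {K} (P : field2 -> Prop) (e : lower K) : Prop :=
  match e with
  | Coef f => P f
  | Var _ => True
  | Add0 e1 e2 | Mul0 e1 e2 => coefs0 P e1 /\ coefs0 P e2
  end.

Fixpoint coefs1 {K} (P : field2 -> Prop) (q : quasilinear K) : Prop :=
  match q with
  | Low e => coefs0 P e
  | Dy _ => True
  | Add1 q1 q2 => coefs1 P q1 /\ coefs1 P q2
  | Mul1 e q => coefs0 P e /\ coefs1 P q
  end.

Fixpoint val0 {K} (W : K -> field2) (e : lower K) (x y : R) : R :=
  match e with
  | Coef f => f x y
  | Var k => W k x y
  | Add0 e1 e2 => val0 W e1 x y + val0 W e2 x y
  | Mul0 e1 e2 => val0 W e1 x y * val0 W e2 x y
  end.

Fixpoint val1 {K} (W W' : K -> field2) (q : quasilinear K) (x y : R) : R :=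
  match q with
  | Low e => val0 W e x y
  | Dy k => W' k x y
  | Add1 q1 q2 => val1 W W' q1 x y + val1 W W' q2 x y
  | Mul1 e q => val0 W e x y * val1 W W' q x y
  end.

(** [germ] only asserts that an expansion exists, so one is chosen; for a function that is not a
    germ the value is unspecified. *)
Definition ser (f : field2) : series2 := epsilon (inhabits (fun _ _ => 0)) (expands f).

Lemma expands_ser (f : field2) : germ f -> expands f (ser f).
Proof. intros H. unfold ser. apply (epsilon_spec (inhabits (fun _ _ => 0))). exact H. Qed.

Fixpoint formal0 {K} (w : K -> series2) (e : lower K) : series2 :=
  match e with
  | Coef f => ser f
  | Var k => w k
  | Add0 e1 e2 => add2 (formal0 w e1) (formal0 w e2)
  | Mul0 e1 e2 => mul2 (formal0 w e1) (formal0 w e2)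
  end.

Fixpoint formal1 {K} (w : K -> series2) (q : quasilinear K) : series2 :=
  match q with
  | Low e => formal0 w e
  | Dy k => pd2 (w k)
  | Add1 q1 q2 => add2 (formal1 w q1) (formal1 w q2)
  | Mul1 e q => mul2 (formal0 w e) (formal1 w q)
  end.

Lemma expands_formal0 {K} (W : K -> field2) (w : K -> series2) (e : lower K) :
  (forall k, expands (W k) (w k)) -> coefs0 germ e -> expands (val0 W e) (formal0 w e).
Proof.
  intros HW. induction e as [f|k|e1 IH1 e2 IH2|e1 IH1 e2 IH2]; simpl; intros H.
  - now apply expands_ser.
  - apply HW.
  - apply expands_add; tauto.
  - apply expands_mul; tauto.
Qed.

Lemma expands_formal1 {K} (W : K -> field2) (w : K -> series2) (q : quasilinear K) :
  (forall k, expands (W k) (w k)) -> coefs1 germ q ->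
  expands (val1 W (fun k => D X2 (W k)) q) (formal1 w q).
Proof.
  intros HW. induction q as [e|k|q1 IH1 q2 IH2|e q IH]; simpl; intros H.
  - now apply expands_formal0.
  - apply (expands_D X2), HW.
  - apply expands_add; tauto.
  - apply expands_mul; [|tauto]. now apply expands_formal0.
Qed.

Definition agree {K} (n : nat) (w w' : K -> series2) : Prop :=
  forall k i j, (i <= n)%nat -> w k i j = w' k i j.

Lemma mul2_agree (a b a' b' : series2) (n : nat) :
  (forall i j, (i <= n)%nat -> a i j = a' i j) ->
  (forall i j, (i <= n)%nat -> b i j = b' i j) ->
  forall i j, (i <= n)%nat -> mul2 a b i j = mul2 a' b' i j.
Proof.
  intros Ha Hb i j Hi. unfold mul2, PS_mult. apply sum_eq. intros k Hk.
  apply sum_eq. intros l Hl. rewrite Ha, Hb by lia. easy.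
Qed.

Lemma formal0_agree {K} (w w' : K -> series2) (n : nat) (e : lower K) :
  agree n w w' -> forall i j, (i <= n)%nat -> formal0 w e i j = formal0 w' e i j.
Proof.
  intros H. induction e as [f|k|e1 IH1 e2 IH2|e1 IH1 e2 IH2]; simpl.
  - easy.
  - apply H.
  - intros i j Hi. unfold add2. now rewrite IH1, IH2.
  - now apply mul2_agree.
Qed.

(** No [x]-derivative occurs on the right and [pd2] acts within rows, so rows up to [n] of the
    result depend only on rows up to [n] of the unknowns. The formal solution can therefore be built
    row by row. *)
Lemma formal1_agree {K} (w w' : K -> series2) (n : nat) (q : quasilinear K) :
  agree n w w' -> forall i j, (i <= n)%nat -> formal1 w q i j = formal1 w' q i j.
Proof.
  intros H. induction q as [e|k|q1 IH1 q2 IH2|e q IH]; simpl.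
  - now apply formal0_agree.
  - intros i j Hi. unfold pd2. now rewrite H.
  - intros i j Hi. unfold add2. now rewrite IH1, IH2.
  - apply mul2_agree; [now apply formal0_agree|easy].
Qed.

(** [B] must not depend on [rho] and [sg]: [rho] is chosen last. *)
Definition major0 {K} (e : lower K) (A B s : R) : Prop :=
  forall sg rho, s <= sg -> sg <= rho -> forall w : K -> series2,
    (forall k, majorized (w k) (fun n => A * wt n) rho sg) ->
    majorized (formal0 w e) (fun n => B * wt n) rho sg.

Definition major1 {K} (A : R) (q : quasilinear K) (B s : R) : Prop :=
  forall sg rho, s <= sg -> sg <= rho -> forall w : K -> series2,
    (forall k, majorized (w k) (fun n => A * wt n) rho sg) ->
    majorized (formal1 w q) (fun n => B * sg * wt' n) rho sg.

Lemma formal0_major {K} (e : lower K) (A : R) : 0 <= A -> coefs0 germ e ->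
  exists B s, 0 <= B /\ 1 <= s /\ major0 e A B s.
Proof.
  intros HA. induction e as [f|k|e1 IH1 e2 IH2|e1 IH1 e2 IH2]; simpl; intros H.
  - destruct (expands_ser f H) as [[C [r Hf]] _]. destruct (Hf) as [H0 [H1 _]].
    exists (4 * C), (2 * r). split; [lra|]. split; [lra|]. intros sg rho Hs Hr w _.
    now apply (geom_bound_majorized _ C r).
  - exists A, 1. split; [easy|]. split; [lra|]. intros sg rho Hs Hr w Hw. apply Hw.
  - destruct IH1 as [B1 [s1 [P1 [Q1 M1]]]]; [tauto|].
    destruct IH2 as [B2 [s2 [P2 [Q2 M2]]]]; [tauto|].
    exists (B1 + B2), (Rmax s1 s2). split; [lra|].
    pose proof (Rmax_l s1 s2). pose proof (Rmax_r s1 s2). split; [lra|].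
    intros sg rho Hs Hr w Hw.
    apply (majorized_weaken _ (fun n => B1 * wt n + B2 * wt n)); [lra|lra|intros; lra|].
    apply majorized_add; [apply M1|apply M2]; auto; lra.
  - destruct IH1 as [B1 [s1 [P1 [Q1 M1]]]]; [tauto|].
    destruct IH2 as [B2 [s2 [P2 [Q2 M2]]]]; [tauto|].
    exists (8 * B1 * B2), (Rmax s1 s2). split; [nra|].
    pose proof (Rmax_l s1 s2). pose proof (Rmax_r s1 s2). split; [lra|].
    intros sg rho Hs Hr w Hw.
    apply (majorized_weaken _ (PS_mult (fun n => B1 * wt n) (fun n => B2 * wt n))); [lra|lra| |].
    + intros n. replace (8 * B1 * B2 * wt n) with ((B1 * B2) * (8 * wt n)) by ring.
      eapply Rle_trans; [|apply Rmult_le_compat_l; [nra|apply wt_conv]].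
      unfold PS_mult. rewrite scal_sum. right. apply sum_eq. intros. ring.
    + apply majorized_mul; try lra;
        try (intros; apply Rmult_le_pos; [lra|left; apply wt_pos]);
        [apply M1|apply M2]; auto; lra.
Qed.

(** A [y]-derivative of the majorant produces one factor [sg] and none of [rho]; by linearity in the
    derivatives, [sg] enters the bound only to the first power. Terms without derivative fit as well
    because [1 <= sg]. *)
Lemma formal1_major {K} (q : quasilinear K) (A : R) : 0 <= A -> coefs1 germ q ->
  exists B s, 0 <= B /\ 1 <= s /\ major1 A q B s.
Proof.
  intros HA. induction q as [e|k|q1 IH1 q2 IH2|e q IH]; simpl; intros H.
  - destruct (formal0_major e A HA H) as [B [s [P [Q M]]]].
    exists B, s. split; [easy|]. split; [easy|]. intros sg rho Hs Hr w Hw.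
    apply (majorized_weaken _ (fun n => B * wt n)); [lra|lra| |now apply M].
    intros n. pose proof (wt_le_wt' n). pose proof (wt_pos n).
    assert (B * wt n <= B * wt' n) by (apply Rmult_le_compat_l; lra).
    assert (0 <= B * wt' n) by (apply Rmult_le_pos; lra). nra.
  - exists A, 1. split; [easy|]. split; [lra|]. intros sg rho Hs Hr w Hw i j.
    simpl. unfold pd2. rewrite Rabs_mult, Rabs_pos_eq by apply pos_INR.
    apply Rle_trans with (INR (S j) * (A * wt (i + S j) * bin (i + S j) i * (rho ^ i * sg ^ S j))).
    + apply Rmult_le_compat_l; [apply pos_INR|apply Hw].
    + rewrite Nat.add_succ_r.
      replace (INR (S j) * (A * wt (S (i + j)) * bin (S (i + j)) i * (rho ^ i * sg ^ S j)))
        with (A * wt (S (i + j)) * (INR (S j) * bin (S (i + j)) i) * (rho ^ i * sg ^ S j)) by ring.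
      rewrite bin_absorb_r.
      replace (A * wt (S (i + j)) * (INR (S (i + j)) * bin (i + j) i) * (rho ^ i * sg ^ S j))
        with (A * (bin (i + j) i * (rho ^ i * sg ^ S j)) * (INR (S (i + j)) * wt (S (i + j)))) by ring.
      replace (A * sg * wt' (i + j) * bin (i + j) i * (rho ^ i * sg ^ j))
        with (A * (bin (i + j) i * (rho ^ i * sg ^ S j)) * wt' (i + j)) by (simpl; ring).
      apply Rmult_le_compat_l; [|apply wt_S_le_wt'].
      repeat apply Rmult_le_pos; try apply pow_le; try lra. apply bin_nonneg.
  - destruct IH1 as [B1 [s1 [P1 [Q1 M1]]]]; [tauto|].
    destruct IH2 as [B2 [s2 [P2 [Q2 M2]]]]; [tauto|].
    exists (B1 + B2), (Rmax s1 s2). split; [lra|].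
    pose proof (Rmax_l s1 s2). pose proof (Rmax_r s1 s2). split; [lra|].
    intros sg rho Hs Hr w Hw.
    apply (majorized_weaken _ (fun n => B1 * sg * wt' n + B2 * sg * wt' n)); [lra|lra|intros; lra|].
    apply majorized_add; [apply M1|apply M2]; auto; lra.
  - destruct (formal0_major e A HA) as [B1 [s1 [P1 [Q1 M1]]]]; [tauto|].
    destruct IH as [B2 [s2 [P2 [Q2 M2]]]]; [tauto|].
    exists (8 * B1 * B2), (Rmax s1 s2). split; [nra|].
    pose proof (Rmax_l s1 s2). pose proof (Rmax_r s1 s2). split; [lra|].
    intros sg rho Hs Hr w Hw.
    apply (majorized_weaken _ (PS_mult (fun n => B1 * wt n) (fun n => B2 * sg * wt' n))); [lra|lra| |].
    + intros n. replace (8 * B1 * B2 * sg * wt' n) with ((B1 * (B2 * sg)) * (8 * wt' n)) by ring.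
      eapply Rle_trans; [|apply Rmult_le_compat_l; [|apply wt_wt'_conv]].
      * unfold PS_mult. rewrite scal_sum. right. apply sum_eq. intros. ring.
      * repeat apply Rmult_le_pos; lra.
    + apply majorized_mul; try lra;
        try (intros; repeat apply Rmult_le_pos; try (left; apply wt_pos);
             try (left; apply wt'_pos); lra);
        [apply M1|apply M2]; auto; lra.
Qed.

(** * The Cauchy-Kovalevskaya theorem *)

Lemma finite_uniform {K} (l : list K) (P : K -> R -> R -> Prop) :
  (forall k B s B' s', B <= B' -> s <= s' -> P k B s -> P k B' s') ->
  (forall k, exists B s, P k B s) ->
  exists B s, forall k, In k l -> P k B s.
Proof.
  intros Hmono Hex. induction l as [|k l [B [s IH]]].
  - exists 0, 0. intros k [].
  - destruct (Hex k) as [B' [s' H']].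
    exists (Rmax B B'), (Rmax s s'). intros k' [<-|Hk].
    + apply (Hmono k B' s'); auto using Rmax_r.
    + apply (Hmono k' B s); auto using Rmax_l.
Qed.

Lemma major1_mono {K} (A : R) (q : quasilinear K) (B s B' s' : R) :
  1 <= s -> B <= B' -> s <= s' -> major1 A q B s -> major1 A q B' s'.
Proof.
  intros H1 HB Hs H sg rho Hsg Hrho w Hw.
  apply (majorized_weaken _ (fun n => B * sg * wt' n)); [lra|lra| |apply H; auto; lra].
  intros n. apply Rmult_le_compat_r; [left; apply wt'_pos|]. apply Rmult_le_compat_r; lra.
Qed.

Section CauchyKovalevskaya.

Context {K : Type} (l : list K) (Hl : forall k, In k l).
Context (rhs : K -> quasilinear K) (Hrhs : forall k, coefs1 germ (rhs k)).
Context (ini : K -> field2) (Hini : forall k, germ (ini k)).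

(** The recursion is on stages rather than on rows, because [formal1] takes whole series as
    arguments. Stage [n] has its rows up to [n] final. *)
Fixpoint approx (n : nat) (k : K) (i j : nat) : R :=
  match i with
  | O => ser (ini k) O j
  | S i' =>
    match n with
    | O => 0
    | S n' => formal1 (approx n') (rhs k) i' j / INR (S i')
    end
  end.

Lemma approx_agree (n : nat) : agree n (approx n) (approx (S n)).
Proof.
  induction n as [|n IH]; intros k i j Hi.
  - now replace i with O by lia.
  - destruct i as [|i]; [easy|].
    change (formal1 (approx n) (rhs k) i j / INR (S i)
            = formal1 (approx (S n)) (rhs k) i j / INR (S i)).
    f_equal. apply (formal1_agree _ _ n); [exact IH|lia].
Qed.

(** Row [i] of [approx n] no longer changes once [n >= i]. *)
Definition solution (k : K) : series2 := fun i j => approx i k i j.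

Lemma solution_agree (n : nat) : agree n solution (approx n).
Proof.
  intros k i j Hi. unfold solution. induction Hi as [|n Hi IH]; [easy|].
  rewrite IH. now apply approx_agree.
Qed.

Lemma solution_equation (k : K) (i j : nat) : pd1 (solution k) i j = formal1 solution (rhs k) i j.
Proof.
  unfold pd1. rewrite (formal1_agree _ (approx i) i) by (try apply solution_agree; lia).
  change (solution k (S i) j) with (formal1 (approx i) (rhs k) i j / INR (S i)).
  pose proof (S_INR_pos i). field. lra.
Qed.

(** Induction on stages. Unknowns dominated with weight [A * wt] have right-hand sides dominated
    with weight [B * sg * wt'], while the [x]-derivative of the majorant has weight
    [A * rho * (n + 1) * wt (n + 1)], at least [A * rho * wt' n / 4]. Hence [rho >= 4 * B * sg]
    reproduces the same [A]. *)
Lemma solution_majorized : exists C s, forall k, geom_bound (solution k) C s.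
Proof.
  destruct (finite_uniform l (fun k C r => geom_bound (ser (ini k)) C r)) as [C [r HC]].
  { intros k B s B' s' HB Hs. now apply geom_bound_weaken. }
  { intros k. apply (expands_ser (ini k) (Hini k)). }
  (* The order of choice matters: [A] comes from the initial data, [B] from [A], then [sg], and
     [rho] last. [1 <= A] is used to close the final inequality. *)
  set (A := Rmax 1 (4 * C)).
  assert (HA : 1 <= A) by apply Rmax_l.
  destruct (finite_uniform l (fun k B s => 0 <= B /\ 1 <= s /\ major1 A (rhs k) B s))
    as [B [s HB]].
  { intros k B s B' s' H1 H2 [H3 [H4 H5]]. repeat split; try lra.
    now apply (major1_mono A (rhs k) B s). }
  { intros k. apply formal1_major; [lra|apply Hrhs]. }
  set (sg := Rmax (Rmax 1 s) (2 * r)).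
  set (rho := Rmax sg (4 * Rabs B * sg)).
  assert (Hsg1 : Rmax 1 s <= sg) by apply Rmax_l.
  assert (Hsg2 : 2 * r <= sg) by apply Rmax_r.
  pose proof (Rmax_l 1 s). pose proof (Rmax_r 1 s).
  assert (Hrho1 : sg <= rho) by apply Rmax_l.
  assert (Hrho2 : 4 * Rabs B * sg <= rho) by apply Rmax_r.
  assert (Hrow : forall k j, Rabs (ser (ini k) O j)
    <= A * wt (0 + j)%nat * bin (0 + j) O * (rho ^ 0 * sg ^ j)).
  { intros k j. eapply Rle_trans.
    - apply (geom_bound_majorized _ C r rho sg (HC k (Hl k)) Hsg2 Hrho1).
    - assert (4 * C <= A) by apply Rmax_r.
      apply Rmult_le_compat_r; [apply Rmult_le_pos; apply pow_le; lra|].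
      apply Rmult_le_compat_r; [apply bin_nonneg|].
      apply Rmult_le_compat_r; [left; apply wt_pos|easy]. }
  assert (Hap : forall n k, majorized (approx n k) (fun n => A * wt n) rho sg).
  { induction n as [|n IH]; intros k [|i] j; try apply Hrow.
    - simpl approx. rewrite Rabs_R0. repeat apply Rmult_le_pos; try apply pow_le; try lra.
      + left; apply wt_pos.
      + apply bin_nonneg.
    - change (approx (S n) k (S i) j) with (formal1 (approx n) (rhs k) i j / INR (S i)).
      destruct (HB k (Hl k)) as [HB0 [_ HM]].
      rewrite Rabs_pos_eq in Hrho2 by easy.
      pose proof (HM sg rho ltac:(lra) Hrho1 (approx n) IH i j) as E.
      pose proof (S_INR_pos i) as Pi. pose proof (S_INR_pos (i + j)) as Pij.
      unfold Rdiv. rewrite Rabs_mult, (Rabs_pos_eq (/ _)) by (left; now apply Rinv_0_lt_compat).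
      apply (Rmult_le_reg_l (INR (S i))); [easy|].
      rewrite (Rmult_comm (Rabs _)), <- Rmult_assoc, Rinv_r, Rmult_1_l by lra.
      eapply Rle_trans; [exact E|].
      change (S i + j)%nat with (S (i + j)).
      replace (INR (S i) * (A * wt (S (i + j)) * bin (S (i + j)) (S i) * (rho ^ S i * sg ^ j)))
        with (A * rho * (wt (S (i + j)) * (INR (S i) * bin (S (i + j)) (S i)) * (rho ^ i * sg ^ j)))
        by (simpl; ring).
      rewrite <- bin_absorb by lia.
      replace (wt (S (i + j)) * (INR (S (i + j)) * bin (i + j) i))
        with (INR (S (i + j)) * wt (S (i + j)) * bin (i + j) i) by ring.
      assert (0 <= bin (i + j) i) by apply bin_nonneg.
      assert (0 <= rho ^ i * sg ^ j) by (apply Rmult_le_pos; apply pow_le; lra).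
      pose proof (wt'_le_wt_S (i + j)) as Hw. pose proof (wt'_pos (i + j)).
      replace (B * sg * wt' (i + j) * bin (i + j) i * (rho ^ i * sg ^ j))
        with (B * sg * wt' (i + j) * (bin (i + j) i * (rho ^ i * sg ^ j))) by ring.
      replace (A * rho * (INR (S (i + j)) * wt (S (i + j)) * bin (i + j) i * (rho ^ i * sg ^ j)))
        with (A * rho * (INR (S (i + j)) * wt (S (i + j))) * (bin (i + j) i * (rho ^ i * sg ^ j))) by ring.
      apply Rmult_le_compat_r; [now apply Rmult_le_pos|].
      set (z := INR (S (i + j)) * wt (S (i + j))) in *.
      assert (0 <= B * sg) by (apply Rmult_le_pos; lra).
      assert (B * sg * wt' (i + j) <= B * sg * (4 * z)) by now apply Rmult_le_compat_l.
      assert (0 <= z) by lra. assert (4 * B * sg * z <= rho * z) by now apply Rmult_le_compat_r.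
      assert (rho * z <= A * (rho * z)) by (assert (0 <= rho * z) by (apply Rmult_le_pos; lra); nra).
      lra. }
  exists A, (2 * rho). intros k. apply (majorized_geom_bound _ A rho sg); try lra.
  intros i j. apply (Hap i k i j).
Qed.

Theorem cauchy_kovalevskaya : exists W : K -> field2,
  (forall k, germ (W k)) /\
  (forall k, locally 0 (fun y => W k 0 y = ini k 0 y)) /\
  (forall k, near0 (fun x y => D X1 (W k) x y = val1 W (fun k' => D X2 (W k')) (rhs k) x y)).
Proof.
  destruct solution_majorized as [C [s Hgb]].
  set (W := fun k => eval (solution k)).
  assert (HW : forall k, expands (W k) (solution k)).
  { intros k. split; [eauto|]. now apply near0_all. }
  exists W. split; [|split].
  - intros k. now exists (solution k).
  - intros k. destruct (expands_ser (ini k) (Hini k)) as [_ H].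
    apply (near0_scal 0) in H. eapply filter_imp; [|exact H].
    intros y Hy. cbv beta in Hy. rewrite Rmult_0_l in Hy. rewrite Hy. unfold W. now rewrite 2!eval_at_0_l.
  - intros k. destruct (expands_D X1 _ _ (HW k)) as [_ H1].
    destruct (expands_formal1 W solution (rhs k) HW (Hrhs k)) as [_ H2].
    eapply near0_mono; [|apply (near0_and _ _ H1 H2)]. intros x y [-> ->].
    unfold eval. apply PSeries_ext. intros i. apply PSeries_ext. intros j.
    apply solution_equation.
Qed.

End CauchyKovalevskaya.

(** * Derivatives along curves, and data on an oblique line *)

Lemma germ_is_derive (f : field2) : germ f ->
  near0 (fun x y => is_derive (fun z => f z y) x (D X1 f x y) /\
                    is_derive (fun z => f x z) y (D X2 f x y)).
Proof.
  intros [a [[K [r Ha]] Hf]]. apply near0_open in Hf.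
  eapply near0_mono; [|apply (near0_and _ _ (near0_box (2 * r)) Hf)].
  intros x y [[Hx Hy] Hl]. destruct (Ha) as [_ [H1 _]].
  pose proof (Rabs_pos x). pose proof (Rabs_pos y).
  split; apply Derive_correct.
  - apply ex_derive_ext_loc with (fun z => eval a z y).
    + generalize (locally_2d_1d_const_y _ _ _ Hl). apply filter_imp. now intros.
    + eexists. apply (is_derive_eval1 Ha); nra.
  - apply ex_derive_ext_loc with (fun z => eval a x z).
    + generalize (locally_2d_1d_const_x _ _ _ Hl). apply filter_imp. now intros.
    + eexists. now apply (is_derive_eval2 a K r).
Qed.

(** The curves are quantified inside [near0], so that one neighbourhood serves all of them. *)
Lemma germ_derive_along (f : field2) : germ f ->
  near0 (fun x y => forall (a b : R -> R) (t a' b' : R),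
    a t = x -> b t = y -> is_derive a t a' -> is_derive b t b' ->
    is_derive (fun z => f (a z) (b z)) t (D X1 f x y * a' + D X2 f x y * b')).
Proof.
  intros H. apply germ_differentiable in H.
  eapply near0_mono; [|exact H]. intros x y Hd a b t a' b' <- <- Ha Hb.
  apply is_derive_Reals, derivable_pt_lim_comp_2d; [exact Hd| |]; now apply is_derive_Reals.
Qed.

Lemma constant_on_box (g : field2) (d : R) :
  (forall x y, Rabs x < d -> Rabs y < d -> is_derive (fun z => g z y) x 0) ->
  forall x x' y, Rabs x < d -> Rabs x' < d -> Rabs y < d -> g x y = g x' y.
Proof.
  intros H x x' y Hx Hx' Hy.
  destruct (MVT_is_derive (fun z => g z y) (fun _ => 0) x' x (Rmax (Rabs x) (Rabs x')))
    as [c [_ E]]; [apply Rmax_r|apply Rmax_l| |lra].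
  intros z Hz. apply H; [|easy]. eapply Rle_lt_trans; [exact Hz|]. now apply Rmax_lub_lt.
Qed.

(** Each horizontal line near the origin meets the line [x = - e * y], and [g] is constant along it.
    All constraints are propagated through this lemma. *)
Lemma zero_from_line (e : R) (g : field2) :
  near0 (fun x y => is_derive (fun z => g z y) x 0) ->
  locally 0 (fun y => g (- e * y) y = 0) -> near0 (fun x y => g x y = 0).
Proof.
  intros H [d' H0]. apply near0_iff in H. destruct H as [d [Hd H]].
  pose proof (constant_on_box g d H) as Hc.
  destruct (near0_scal (- e) (fun x y => Rabs x < d /\ Rabs y < d)) as [d2 H2].
  { apply near0_iff. exists d. auto. }
  apply near0_iff. exists (Rmin d (Rmin d' d2)).
  split; [repeat apply Rmin_pos; auto; apply cond_pos|].
  intros x y Hx Hy.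
  pose proof (Rmin_l d (Rmin d' d2)). pose proof (Rmin_r d (Rmin d' d2)).
  pose proof (Rmin_l d' d2). pose proof (Rmin_r d' d2).
  assert (Hb : forall q : posreal, Rabs y < q -> ball 0 q y).
  { intros q Hq. change (Rabs (y - 0) < q). now rewrite Rminus_0_r. }
  destruct (H2 y) as [Hye Hyd]; [apply Hb; lra|].
  rewrite <- (H0 y) by (apply Hb; lra). apply Hc; lra.
Qed.

Lemma D1_shear (c : R) (f : field2) (x y : R) :
  D X1 (fun x y => f (x + c * y) y) x y = D X1 f (x + c * y) y.
Proof.
  simpl. unfold Derive. f_equal. apply Lim_ext. intros h.
  replace (x + h + c * y) with (x + c * y + h) by ring. reflexivity.
Qed.

Lemma D2_shear (c : R) (f : field2) : germ f ->
  near0 (fun x y => D X2 (fun x y => f (x + c * y) y) x y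
    = c * D X1 f (x + c * y) y + D X2 f (x + c * y) y).
Proof.
  intros H. apply germ_derive_along, (near0_shear c) in H.
  eapply near0_mono; [|exact H]. simpl. intros x y Hxy.
  apply is_derive_unique. rewrite Rmult_comm, <- (Rmult_1_r (Derive (fun z => f (x + c * y) z) y)).
  apply (Hxy (fun z => x + c * z) (fun z => z)); auto.
  - auto_derive; [easy|ring].
  - auto_derive; [easy|ring].
Qed.

(** [D2 - e D1] differentiates along the line [x + e y = const]. *)
Definition Dt (e : R) (f : field2) : field2 := fun x y => D X2 f x y - e * D X1 f x y.

Lemma Dt_on_line (e : R) (f : field2) : germ f ->
  locally 0 (fun y => is_derive (fun z => f (- e * z) z) y (Dt e f (- e * y) y)).
Proof.
  intros H. apply germ_derive_along, (near0_scal (- e)) in H.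
  eapply filter_imp; [|exact H]. intros y Hy.
  replace (Dt e f (- e * y) y) with (D X1 f (- e * y) y * - e + D X2 f (- e * y) y * 1)
    by (unfold Dt; ring).
  apply (Hy (fun z => - e * z) (fun z => z)); auto.
  - auto_derive; [easy|ring].
  - auto_derive; [easy|ring].
Qed.

Fixpoint shear_lower {K} (e : R) (q : lower K) : lower K :=
  match q with
  | Coef f => Coef (fun x y => f (x + - e * y) y)
  | Var k => Var k
  | Add0 e1 e2 => Add0 (shear_lower e e1) (shear_lower e e2)
  | Mul0 e1 e2 => Mul0 (shear_lower e e1) (shear_lower e e2)
  end.

Fixpoint shear_quasilinear {K} (e : R) (q : quasilinear K) : quasilinear K :=
  match q with
  | Low q => Low (shear_lower e q)
  | Dy k => Dy k
  | Add1 q1 q2 => Add1 (shear_quasilinear e q1) (shear_quasilinear e q2)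
  | Mul1 p q => Mul1 (shear_lower e p) (shear_quasilinear e q)
  end.

Lemma shear_lower_coefs {K} (e : R) (q : lower K) :
  coefs0 germ q -> coefs0 germ (shear_lower e q).
Proof. induction q; simpl; try tauto. apply germ_shear. Qed.

Lemma shear_quasilinear_coefs {K} (e : R) (q : quasilinear K) :
  coefs1 germ q -> coefs1 germ (shear_quasilinear e q).
Proof.
  induction q; simpl; try tauto.
  - apply shear_lower_coefs.
  - intros [H1 H2]. split; [now apply shear_lower_coefs|auto].
Qed.

Lemma val0_shear {K} (W : K -> field2) (e : R) (q : lower K) (x y : R) :
  val0 W (shear_lower e q) (x + e * y) y = val0 (fun k x y => W k (x + e * y) y) q x y.
Proof.
  induction q; simpl; try congruence. f_equal. ring.
Qed.

Lemma val1_shear {K} (W W' V : K -> field2) (e : R) (q : quasilinear K) (x y : R) :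
  (forall k, V k x y = W' k (x + e * y) y) ->
  val1 W W' (shear_quasilinear e q) (x + e * y) y
  = val1 (fun k x y => W k (x + e * y) y) V q x y.
Proof.
  intros HV. induction q; simpl.
  - apply val0_shear.
  - now rewrite HV.
  - congruence.
  - rewrite val0_shear. congruence.
Qed.

Lemma near0_list {K} (l : list K) (P : K -> R -> R -> Prop) :
  (forall k, near0 (P k)) -> near0 (fun x y => forall k, In k l -> P k x y).
Proof.
  intros H. induction l as [|k l IH].
  - apply near0_all. intros x y k [].
  - eapply near0_mono; [|apply (near0_and _ _ (H k) IH)].
    intros x y [H1 H2] k' [<-|Hk]; auto.
Qed.

(** The shear [(x, y) -> (x + e y, y)] turns the initial line [x + e y = 0] into
    [x = 0] and [Dt e] into [D X2]. *)
Theorem cauchy_kovalevskaya_line {K : Type} (l : list K) (Hl : forall k, In k l) (e : R)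
  (rhs : K -> quasilinear K) (Hrhs : forall k, coefs1 germ (rhs k))
  (ini : K -> field2) (Hini : forall k, germ (ini k)) :
  exists W : K -> field2,
  (forall k, germ (W k)) /\
  (forall k, locally 0 (fun y => W k (- e * y) y = ini k 0 y)) /\
  near0 (fun x y => forall k, D X1 (W k) x y = val1 W (fun k' => Dt e (W k')) (rhs k) x y).
Proof.
  destruct (cauchy_kovalevskaya l Hl (fun k => shear_quasilinear e (rhs k))
    (fun k => shear_quasilinear_coefs e (rhs k) (Hrhs k)) ini Hini) as [V [HV [HV0 HV1]]].
  exists (fun k x y => V k (x + e * y) y). split; [|split].
  - intros k. now apply germ_shear.
  - intros k. eapply filter_imp; [|apply (HV0 k)]. intros y <-. f_equal. ring.
  - assert (HD : near0 (fun x y => forall k, In k l ->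
      D X2 (fun x y => V k (x + e * y) y) x y
      = e * D X1 (V k) (x + e * y) y + D X2 (V k) (x + e * y) y)).
    { apply near0_list. intros k. now apply D2_shear. }
    assert (HE : near0 (fun x y => forall k, In k l -> D X1 (V k) x y
      = val1 V (fun k' => D X2 (V k')) (shear_quasilinear e (rhs k)) x y)).
    { apply near0_list. apply HV1. }
    apply (near0_shear e) in HE.
    eapply near0_mono; [|apply (near0_and _ _ HD HE)]. intros x y [H1 H2] k.
    rewrite D1_shear, H2 by apply Hl. apply val1_shear. intros k'.
    unfold Dt. rewrite D1_shear, H1 by apply Hl. ring.
Qed.

(** * Reciprocals of germs and linear ordinary differential equations *)

Lemma germ_inv (f : field2) : germ f -> f 0 0 <> 0 -> germ (fun x y => / f x y).
Proof.
  (* The reciprocal [r] solves [D1 r = - r^2 D1 f]; its values on [x = 0] come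
     from the same equation with the coordinates exchanged. *)
  assert (Hsolve : forall g h : field2, germ g -> germ h -> h 0 0 * g 0 0 = 1 ->
    exists r, germ r /\ locally 0 (fun y => r 0 y = h 0 y) /\
      exists d, 0 < d /\ forall x y, Rabs x < d -> Rabs y < d ->
        h 0 y * g 0 y = 1 -> r x y * g x y = 1).
  { intros g h Hg Hh E0.
    destruct (cauchy_kovalevskaya_line (tt :: nil) (fun k => match k with tt => or_introl eq_refl end)
      0 (fun _ => Low (Mul0 (Coef (fun x y => - D X1 g x y)) (Mul0 (Var tt) (Var tt))))
      (fun _ => conj (germ_opp _ (germ_D X1 g Hg)) (conj I I))
      (fun _ => h) (fun _ => Hh)) as [W [HW [HW0 HW1]]].
    set (r := W tt). exists r. specialize (HW tt). specialize (HW0 tt).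
    fold r in HW, HW0.
    assert (HW0' : locally 0 (fun y => r 0 y = h 0 y)).
    { eapply filter_imp; [|exact HW0]. intros y <-. f_equal. ring. }
    split; [easy|]. split; [easy|].
    assert (Hr0 : r 0 0 <> 0).
    { rewrite (locally_singleton 0 (fun y : R => r 0 y = h 0 y) HW0'). intros E.
      rewrite E in E0. lra. }
    (* The equation for [r] says exactly that [/ r] and [g] have the same [x]-derivative wherever
       [r] does not vanish. *)
    assert (Hn : near0 (fun x y => is_derive (fun z => / r z y - g z y) x 0 /\ r x y <> 0)).
    { eapply near0_mono; [|apply (near0_and _ _ HW1 (near0_and _ _ (germ_neq0 r HW Hr0)
        (near0_and _ _ (germ_is_derive r HW) (germ_is_derive g Hg))))].
      intros x y [E [Hnz [[Hd _] [Hd' _]]]]. specialize (E tt). cbn [val1 val0] in E.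
      split; [|easy]. fold r in E. rewrite E in Hd.
      replace 0 with (minus (- (- D X1 g x y * (r x y * r x y)) / r x y ^ 2) (D X1 g x y)).
      - apply (is_derive_minus (K := R_AbsRing) (V := R_NormedModule)); [|exact Hd'].
        exact (is_derive_inv (fun z => r z y) x _ Hd Hnz).
      - unfold minus, plus, opp; simpl. field. exact Hnz. }
    apply near0_iff in Hn. destruct Hn as [d [Hd Hn]].
    destruct HW0' as [d' HW0'].
    exists (Rmin d d'). split; [apply Rmin_pos; [easy|apply cond_pos]|].
    intros x y Hx Hy E1.
    pose proof (Rmin_l d d'). pose proof (Rmin_r d d').
    assert (E2 : / r x y - g x y = / r 0 y - g 0 y).
    { apply (constant_on_box (fun x y => / r x y - g x y) d); try lra.
      - intros. now apply Hn.
      - now rewrite Rabs_R0. }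
    assert (Hrn : r x y <> 0) by (apply Hn; lra).
    assert (Hrn0 : r 0 y <> 0) by (apply Hn; rewrite ?Rabs_R0; lra).
    assert (E3 : r 0 y = h 0 y).
    { apply HW0'. change (Rabs (y - 0) < d'). rewrite Rminus_0_r. lra. }
    rewrite <- E3 in E1.
    assert (E4 : / r 0 y = g 0 y) by (apply (Rmult_eq_reg_l (r 0 y)); [rewrite E1; now apply Rinv_r|easy]).
    assert (E5 : g x y = / r x y) by lra.
    rewrite E5. now apply Rinv_r. }
  intros Hf H0.
  destruct (Hsolve (fun x y => f y x) (fun _ _ => / f 0 0)) as [r1 [Hr1 [Hi1 [d1 [Hd1 H1]]]]].
  { now apply germ_swap. }
  { apply germ_const. }
  { now apply Rinv_l. }
  assert (H1' : forall x, Rabs x < d1 -> r1 x 0 * f 0 x = 1).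
  { intros x Hx. apply H1; [easy|now rewrite Rabs_R0|now apply Rinv_l]. }
  destruct (Hsolve f (fun x y => r1 y x)) as [r2 [Hr2 [_ [d2 [Hd2 H2]]]]].
  { easy. }
  { now apply germ_swap. }
  { apply H1'. now rewrite Rabs_R0. }
  apply (germ_ext r2); [|easy].
  apply near0_iff. exists (Rmin d1 d2). split; [now apply Rmin_pos|]. intros x y Hx Hy.
  pose proof (Rmin_l d1 d2). pose proof (Rmin_r d1 d2).
  assert (E : r2 x y * f x y = 1) by (apply H2; try lra; apply H1'; lra).
  assert (Hfn : f x y <> 0) by (intros Z; rewrite Z in E; lra).
  apply (Rmult_eq_reg_r (f x y)); [|easy]. rewrite E. symmetry. now apply Rinv_l.
Qed.

Lemma germ_div (f g : field2) : germ f -> germ g -> g 0 0 <> 0 ->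
  germ (fun x y => f x y / g x y).
Proof. intros. apply germ_mul; [easy|now apply germ_inv]. Qed.

(** An ordinary differential equation is a system without [y]-derivatives. The line is parametrised
    by the first variable; the second is a dummy parameter, set to 0 at the end, before the
    variables are exchanged. *)
Lemma linear_ode_on_line (e : R) (al be : field2) : germ al -> germ be ->
  exists f : field2, germ f /\ f 0 0 = 0 /\
    locally 0 (fun y => is_derive (fun z => f 0 z) y
      (al (- e * y) y * f 0 y + be (- e * y) y)).
Proof.
  intros Hal Hbe.
  set (al' := fun x y => al (y + - e * x) x). set (be' := fun x y => be (y + - e * x) x).
  assert (Hal' : germ al') by (apply (germ_swap (fun x y => al (x + - e * y) y)), germ_shear, Hal).
  assert (Hbe' : germ be') by (apply (germ_swap (fun x y => be (x + - e * y) y)), germ_shear, Hbe).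
  destruct (cauchy_kovalevskaya_line (tt :: nil) (fun k => match k with tt => or_introl eq_refl end)
      0 (fun _ => Low (Add0 (Mul0 (Coef al') (Var tt)) (Coef be')))
      (fun _ => conj (conj Hal' I) Hbe')
      (fun _ _ _ => 0) (fun _ => germ_const 0)) as [W [HW [HW0 HW1]]].
  specialize (HW tt). specialize (HW0 tt).
  exists (fun x y => W tt y x). split; [now apply germ_swap|]. split.
  - apply locally_singleton in HW0. rewrite Rmult_0_r in HW0. exact HW0.
  - pose proof (near0_swap _ (near0_and _ _ (germ_is_derive _ HW) HW1)) as H.
    apply (near0_scal 0) in H. eapply filter_imp; [|exact H].
    intros y. cbv beta. rewrite Rmult_0_l. intros [[Hd _] E].
    specialize (E tt). rewrite E in Hd. simpl in Hd. unfold al', be' in Hd.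
    rewrite !Rplus_0_l in Hd. exact Hd.
Qed.

(** * Reduction of the Gauss-Codazzi equations to a Cauchy problem *)

(** Right-hand sides of the Codazzi equations solved for [d_2 g12] and
    [d_1 g12]; [aL], [bL], [mL], [nL] are [A / L], [B / L], [M / L], [N / L] for
    [A = d_1 N - d_2 M], [B = - d_1 M + d_2 L], and similarly over [N]. *)
Definition codazzi_rhs2 (aL bL mL nL E F E1 E2 G1 : R) : R :=
  - (E * aL + F * bL) + / 2 * G1 + mL * E2 - / 2 * (nL * E1).

Definition codazzi_rhs1 (aN bN mN lN F G E2 G1 G2 : R) : R :=
  - (F * aN + G * bN) - / 2 * (lN * G2) + mN * G1 + / 2 * E2.

(** The Gauss equation reads [d_22 g11 - 2 d_12 g12 + d_11 g22 = gauss_rhs]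
    when [q = 1 / det g] and [k] is the prescribed curvature. *)
Definition gauss_rhs (k E F G E1 E2 F1 F2 G1 G2 q : R) : R :=
  - 2 * k * (E * G - F * F)
  + 2 * q * (/ 4 * (G * (E2 * E2) - 2 * F * (E2 * G1) + E * (G1 * G1))
     - (/ 2 * (G * E1 * (F2 - / 2 * G1))
        - F * (/ 4 * (E1 * G2) + (F1 - / 2 * E2) * (F2 - / 2 * G1))
        + / 2 * (E * (F1 - / 2 * E2) * G2))).

(** [uE], [uF], [uG] are [g11], [g12], [g22]; [uE1], [uG1] stand for [x]-derivatives, [uEy], [uGy]
    for derivatives [Dt e] along the initial line, and [uq] for [1 / det g]. Derivatives of [g12]
    need no unknown, as the Codazzi equations give them. *)
Inductive unknown : Set := uE | uF | uG | uE1 | uG1 | uEy | uGy | uq.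

Definition unknowns : list unknown := uE :: uF :: uG :: uE1 :: uG1 :: uEy :: uGy :: uq :: nil.

Lemma in_unknowns (k : unknown) : In k unknowns.
Proof. destruct k; simpl; tauto. Qed.

Create HintDb germs.
#[local] Hint Resolve germ_const germ_add germ_mul germ_opp germ_minus germ_pow2 germ_D : germs.

Declare Scope lower_scope.
Delimit Scope lower_scope with low.
Notation "a + b" := (Add0 a b) : lower_scope.
Notation "a * b" := (Mul0 a b) : lower_scope.
Notation cst c := (Coef (fun _ _ => c%R)).
Notation "- a" := (Mul0 (Coef (fun _ _ => (-1)%R)) a) : lower_scope.
Notation "a - b" := (Add0 a (Mul0 (Coef (fun _ _ => (-1)%R)) b)) : lower_scope.

Section CauchyProblem.

Context (e : R) (L M N iD : field2).
Context (aL bL mL nL aN bN mN lN f0 q0 : field2).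
Context (HL : germ L) (HM : germ M) (HN : germ N) (HiD : germ iD).
Context (HaL : germ aL) (HbL : germ bL) (HmL : germ mL) (HnL : germ nL).
Context (HaN : germ aN) (HbN : germ bN) (HmN : germ mN) (HlN : germ lN).
Context (Hf0 : germ f0) (Hq0 : germ q0).

(** [D X2] is [e * D X1 + Dt e]. *)
Let E2 : lower unknown := (cst e * Var uE1 + Var uEy)%low.
Let G2 : lower unknown := (cst e * Var uG1 + Var uGy)%low.

Let P : lower unknown :=
  (- (Var uE * Coef aL + Var uF * Coef bL) + cst (/ 2) * Var uG1 + Coef mL * E2
   - cst (/ 2) * (Coef nL * Var uE1))%low.

Let Q : lower unknown :=
  (- (Var uF * Coef aN + Var uG * Coef bN) - cst (/ 2) * (Coef lN * G2) + Coef mN * Var uG1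
   + cst (/ 2) * E2)%low.

Let Rg : lower unknown :=
  (cst (-2) * Coef (fun x y => (L x y * N x y - M x y ^ 2)%R) * (Var uE * Var uG - Var uF * Var uF)
  + cst 2 * Var uq * (cst (/ 4) * (Var uG * (E2 * E2) - cst 2 * Var uF * (E2 * Var uG1)
                                + Var uE * (Var uG1 * Var uG1))
     - (cst (/ 2) * (Var uG * Var uE1 * (P - cst (/ 2) * Var uG1))
        - Var uF * (cst (/ 4) * (Var uE1 * G2)
                    + (Q - cst (/ 2) * E2) * (P - cst (/ 2) * Var uG1))
        + cst (/ 2) * (Var uE * (Q - cst (/ 2) * E2) * G2))))%low.

(** Lower-order part of [d_1 P]. *)
Let p1 : lower unknown :=
  (- (Var uE1 * Coef aL + Var uE * Coef (D X1 aL) + Q * Coef bL + Var uF * Coef (D X1 bL))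
   + Coef (D X1 mL) * E2 - cst (/ 2) * (Coef (D X1 nL) * Var uE1))%low.

(** Lower-order part of [d_2 Q], up to the term [- aN * (d_2 - e d_1) F]. *)
Let q2 : lower unknown :=
  (- (cst e * Q * Coef aN + Var uF * Coef (D X2 aN) + G2 * Coef bN + Var uG * Coef (D X2 bN))
   - cst (/ 2) * (Coef (D X2 lN) * G2) + Coef (D X2 mN) * Var uG1)%low.

(** With [D2 = e D1 + Dt] and [e * e = 1], the operator [N D11 - 2 M D12 + L D22] becomes [(N - 2 e
    M + L) D11 + 2 (e L - M) Dt D1 + L Dt Dt], and [iD] is the inverse of the leading coefficient.
    The equations for [uEy] and [uGy] state that [D1] and [Dt] commute; the one for [uq]
    differentiates [q * det g = 1]. [Dy uF] appears because [D2 Q] contains [D2 g12], that is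
    [e * Q + Dt g12]. *)
Let rhs (k : unknown) : quasilinear unknown :=
  match k with
  | uE => Low (Var uE1)
  | uG => Low (Var uG1)
  | uF => Low Q
  | uEy => Dy uE1
  | uGy => Dy uG1
  | uq => Low (- (Var uq * Var uq * (Var uE1 * Var uG + Var uE * Var uG1
                                     - cst 2 * Var uF * Q)))%low
  | uE1 => Add1 (Low (Coef iD * (Coef L * (Rg + cst 2 * p1)))%low)
      (Add1 (Mul1 (Coef iD * (cst (-2) * (cst e * Coef L - Coef M)))%low (Dy uE1))
            (Mul1 (Coef iD * (cst (-1) * Coef L))%low (Dy uEy)))
  | uG1 => Add1 (Low (Coef iD * (Coef N * (Rg + cst 2 * q2)))%low)
      (Add1 (Mul1 (Coef iD * (Coef N * (cst (-2) * Coef aN)))%low (Dy uF))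
      (Add1 (Mul1 (Coef iD * (cst (-2) * (cst e * Coef L - Coef M)))%low (Dy uG1))
            (Mul1 (Coef iD * (cst (-1) * Coef L))%low (Dy uGy))))
  end.

Let ini (k : unknown) : field2 :=
  match k with
  | uE | uG => fun _ _ => 1
  | uF => f0
  | uq => q0
  | _ => fun _ _ => 0
  end.

Lemma cauchy_problem : exists E F G E1 G1 Ey Gy q : field2,
  (germ E /\ germ F /\ germ G /\ germ E1 /\ germ G1 /\ germ Ey /\ germ Gy /\ germ q) /\
  locally 0 (fun y => let x := - e * y in
    E x y = 1 /\ G x y = 1 /\ F x y = f0 0 y /\ q x y = q0 0 y /\
    E1 x y = 0 /\ G1 x y = 0 /\ Ey x y = 0 /\ Gy x y = 0) /\
  near0 (fun x y =>
    let E2 := e * E1 x y + Ey x y in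
    let G2 := e * G1 x y + Gy x y in
    let P := codazzi_rhs2 (aL x y) (bL x y) (mL x y) (nL x y)
               (E x y) (F x y) (E1 x y) E2 (G1 x y) in
    let Q := codazzi_rhs1 (aN x y) (bN x y) (mN x y) (lN x y)
               (F x y) (G x y) E2 (G1 x y) G2 in
    let S := gauss_rhs (L x y * N x y - M x y ^ 2) (E x y) (F x y) (G x y)
               (E1 x y) E2 Q P (G1 x y) G2 (q x y) in
    D X1 E x y = E1 x y /\ D X1 G x y = G1 x y /\
    D X1 F x y = Q /\
    D X1 Ey x y = Dt e E1 x y /\ D X1 Gy x y = Dt e G1 x y /\
    D X1 q x y = - (q x y * q x y
      * (E1 x y * G x y + E x y * G1 x y - 2 * F x y * Q)) /\
    D X1 E1 x y = iD x y * (L x y * (S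
      + 2 * (- (E1 x y * aL x y + E x y * D X1 aL x y + Q * bL x y + F x y * D X1 bL x y)
             + D X1 mL x y * E2 - / 2 * (D X1 nL x y * E1 x y)))
      - 2 * (e * L x y - M x y) * Dt e E1 x y - L x y * Dt e Ey x y) /\
    D X1 G1 x y = iD x y * (N x y * (S
      + 2 * (- ((e * Q + Dt e F x y) * aN x y + F x y * D X2 aN x y + G2 * bN x y
                + G x y * D X2 bN x y)
             - / 2 * (D X2 lN x y * G2) + D X2 mN x y * G1 x y))
      - 2 * (e * L x y - M x y) * Dt e G1 x y - L x y * Dt e Gy x y)).
Proof.
  assert (Hrhs : forall k, coefs1 germ (rhs k)).
  { intros []; cbn -[D]; repeat split; auto with germs. }
  assert (Hini : forall k, germ (ini k)) by (intros []; simpl; auto with germs).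
  destruct (cauchy_kovalevskaya_line unknowns in_unknowns e rhs Hrhs ini Hini)
    as [W [HW [HW0 HW1]]].
  exists (W uE), (W uF), (W uG), (W uE1), (W uG1), (W uEy), (W uGy), (W uq).
  split; [repeat split; apply HW|]. split.
  - eapply filter_imp;
      [|apply (filter_and _ _ (HW0 uE) (filter_and _ _ (HW0 uG) (filter_and _ _ (HW0 uF)
         (filter_and _ _ (HW0 uq) (filter_and _ _ (HW0 uE1) (filter_and _ _ (HW0 uG1)
         (filter_and _ _ (HW0 uEy) (HW0 uGy))))))))].
    intros y H. exact H.
  - eapply near0_mono; [|exact HW1]. intros x y H. cbv zeta.
    repeat split.
    + exact (H uE).
    + exact (H uG).
    + rewrite (H uF). unfold codazzi_rhs1. cbn -[D Dt]. ring.
    + exact (H uEy).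
    + exact (H uGy).
    + rewrite (H uq). unfold codazzi_rhs1. cbn -[D Dt]. ring.
    + rewrite (H uE1). unfold gauss_rhs, codazzi_rhs1, codazzi_rhs2. cbn -[D Dt]. ring.
    + rewrite (H uG1). unfold gauss_rhs, codazzi_rhs1, codazzi_rhs2. cbn -[D Dt]. ring.
Qed.

End CauchyProblem.

Lemma near0_mp (P Q : R -> R -> Prop) :
  near0 P -> near0 (fun x y => P x y -> Q x y) -> near0 Q.
Proof. intros H1 H2. exact (locally_2d_impl _ _ _ _ H2 H1). Qed.

Lemma locally_mp (P Q : R -> Prop) :
  locally 0 P -> locally 0 (fun y => P y -> Q y) -> locally 0 Q.
Proof.
  intros H1 H2. eapply filter_imp; [|apply (filter_and _ _ H1 H2)].
  intros y [Hy1 Hy2]. auto.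
Qed.

Lemma germ_ex_derive1 (f : field2) : germ f -> near0 (fun x y => ex_derive (fun z => f z y) x).
Proof.
  intros H. eapply near0_mono; [|apply (germ_is_derive f H)]. intros x y [H1 _]. eexists; apply H1.
Qed.

Lemma germ_ex_derive2 (f : field2) : germ f -> near0 (fun x y => ex_derive (fun z => f x z) y).
Proof.
  intros H. eapply near0_mono; [|apply (germ_is_derive f H)]. intros x y [_ H1]. eexists; apply H1.
Qed.

Ltac near_use H := refine (near0_mp _ _ H _).
Ltac near_ex1 H := refine (near0_mp _ _ (germ_ex_derive1 _ H) _).
Ltac near_ex2 H := refine (near0_mp _ _ (germ_ex_derive2 _ H) _).
Ltac near_intro x y := apply near0_all; intros x y; cbv beta zeta.

Lemma Dt_on_line_unique (e : R) (f : field2) (g h : R -> R) : germ f ->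
  locally 0 (fun y => f (- e * y) y = g y) ->
  locally 0 (fun y => is_derive g y (h y)) ->
  locally 0 (fun y => Dt e f (- e * y) y = h y).
Proof.
  intros Hf Hg Hh. apply Dt_on_line with (e := e) in Hf.
  refine (locally_mp _ _ (locally_locally _ _ Hg) _).
  refine (locally_mp _ _ Hf _). eapply filter_imp; [|exact Hh].
  intros y H1 H2 H3. apply is_derive_unique in H1, H2. rewrite <- H1, <- H2.
  apply Derive_ext_loc. exact H3.
Qed.

(** Identifies the auxiliary unknown [ft] with [Dt e f]: by symmetry of second derivatives their
    difference has zero [x]-derivative, and it vanishes on the initial line. *)
Lemma transport_Dt (e : R) (f f1 ft : field2) : germ f -> germ f1 -> germ ft ->
  near0 (fun x y => D X1 f x y = f1 x y) ->
  near0 (fun x y => D X1 ft x y = Dt e f1 x y) ->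
  locally 0 (fun y => Dt e f (- e * y) y = ft (- e * y) y) ->
  near0 (fun x y => D X2 f x y = e * f1 x y + ft x y).
Proof.
  intros Hf Hf1 Hft H1 Ht H0.
  assert (Hg1 := germ_D X1 f Hf). assert (Hg2 := germ_D X2 f Hf).
  assert (Hs := germ_schwarz f Hf).
  assert (H11 := near0_D_ext X1 _ _ H1). assert (H12 := near0_D_ext X2 _ _ H1).
  set (d1 := D X1 f) in *. set (d2 := D X2 f) in *.
  assert (HC : near0 (fun x y => ft x y - (d2 x y - e * d1 x y) = 0)).
  { apply (zero_from_line e).
    - near_ex1 Hft. near_ex1 Hg1. near_ex1 Hg2. near_use Hs. near_use H11. near_use H12.
      near_use Ht. near_intro x y. clearbody d1 d2. intros E1 E2 E3 E4 X1' X2' X3'.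
      auto_derive; [tauto|].
      change (Derive (fun z => ft z y) x) with (D X1 ft x y).
      change (Derive (fun z => d1 z y) x) with (D X1 d1 x y).
      change (Derive (fun z => d2 z y) x) with (D X1 d2 x y).
      rewrite E4, E1, E3. unfold Dt. rewrite E2. change (D X1 (fun x y => f1 x y) x y) with (D X1 f1 x y).
      change (D X2 (fun x y => f1 x y) x y) with (D X2 f1 x y). ring.
    - eapply filter_imp; [|exact H0]. unfold Dt. fold d1 d2. intros y Hy. lra. }
  near_use HC. near_use H1. near_intro x y. intros E1 E2. rewrite E1 in E2. lra.
Qed.

(** [S], [T] are [D1 E1], [D1 G1]; [a], [b], [c], [d] are [Dt] of [E1], [Ey], [G1], [Gy]; [r] is the
    Gauss right-hand side; [p], [q] are the lower-order parts of [D1 P], [D2 Q]. As [S + 2 e a + b]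
    is [D22 g11], the two evolution equations say that [2 D1 P] and [2 D2 Q] have one common
    value. *)
Lemma compatibility_algebra (e L M N S T r p q a b c d : R) :
  L <> 0 -> N <> 0 -> L - 2 * e * M + N <> 0 -> e * e = 1 ->
  S = / (L - 2 * e * M + N) * (L * (r + 2 * p) - 2 * (e * L - M) * a - L * b) ->
  T = / (L - 2 * e * M + N) * (N * (r + 2 * q) - 2 * (e * L - M) * c - L * d) ->
  2 * (p + / 2 * T + M / L * (e * S + a) - / 2 * (N / L * S)) = S + 2 * e * a + b + T - r /\
  2 * (q - / 2 * (L / N * (T + 2 * e * c + d)) + M / N * (e * T + c)
    + / 2 * (S + 2 * e * a + b)) = S + 2 * e * a + b + T - r.
Proof.
  intros HL HN HD He HS HT.
  set (Dl := L - 2 * e * M + N) in *.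
  assert (HS' : Dl * S = L * (r + 2 * p) - 2 * (e * L - M) * a - L * b)
    by (rewrite HS, <- Rmult_assoc, Rinv_r, Rmult_1_l; easy).
  assert (HT' : Dl * T = N * (r + 2 * q) - 2 * (e * L - M) * c - L * d)
    by (rewrite HT, <- Rmult_assoc, Rinv_r, Rmult_1_l; easy).
  clear HS HT. unfold Dl in *.
  split.
  - apply (Rmult_eq_reg_l L); [|easy].
    replace (L * (2 * (p + / 2 * T + M / L * (e * S + a) - / 2 * (N / L * S))))
      with (2 * L * p + L * T + 2 * M * (e * S + a) - N * S) by (field; easy).
    lra.
  - apply (Rmult_eq_reg_l N); [|easy].
    replace (N * (2 * (q - / 2 * (L / N * (T + 2 * e * c + d)) + M / N * (e * T + c)
        + / 2 * (S + 2 * e * a + b))))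
      with (2 * N * q - L * (T + 2 * e * c + d) + 2 * M * (e * T + c)
        + N * (S + 2 * e * a + b)) by (field; easy).
    lra.
Qed.

Definition Aof (M N : field2) : field2 := fun x y => D X1 N x y - D X2 M x y.
Definition Bof (L M : field2) : field2 := fun x y => - D X1 M x y + D X2 L x y.

(** After solving the first-order system, four identities remain: [Ey] and [Gy] are tangential
    derivatives ([tE], [tG]), [D2 F = P] ([tC]), and [q] is the reciprocal determinant ([tq]). Each
    is propagated from the initial line. *)
Lemma gauss_codazzi_local (e : R) (L M N : field2) :
  germ L -> germ M -> germ N -> e * e = 1 ->
  L 0 0 <> 0 -> N 0 0 <> 0 -> L 0 0 - 2 * e * M 0 0 + N 0 0 <> 0 ->
  exists E F G q : field2, germ E /\ germ F /\ germ G /\ germ q /\ F 0 0 = 0 /\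
  locally 0 (fun y => let x := - e * y in
    E x y = 1 /\ G x y = 1 /\
    D X1 E x y = 0 /\ D X2 E x y = 0 /\ D X1 G x y = 0 /\ D X2 G x y = 0) /\
  near0 (fun x y =>
    D X2 F x y = codazzi_rhs2 (Aof M N x y / L x y) (Bof L M x y / L x y)
      (M x y / L x y) (N x y / L x y) (E x y) (F x y) (D X1 E x y) (D X2 E x y) (D X1 G x y) /\
    D X1 F x y = codazzi_rhs1 (Aof M N x y / N x y) (Bof L M x y / N x y)
      (M x y / N x y) (L x y / N x y) (F x y) (G x y) (D X2 E x y) (D X1 G x y) (D X2 G x y) /\
    D X2 (D X2 E) x y - 2 * D X1 (D X2 F) x y + D X1 (D X1 G) x y
      = gauss_rhs (L x y * N x y - M x y ^ 2) (E x y) (F x y) (G x y) (D X1 E x y) (D X2 E x y)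
          (D X1 F x y) (D X2 F x y) (D X1 G x y) (D X2 G x y) (q x y) /\
    q x y * (E x y * G x y - F x y * F x y) = 1).
Proof.
  intros HL HM HN He HL0 HN0 HD0.
  assert (HA : germ (Aof M N)) by (unfold Aof; auto with germs).
  assert (HB : germ (Bof L M)) by (unfold Bof; auto with germs).
  assert (HiD : germ (fun x y => / (L x y - 2 * e * M x y + N x y))).
  { apply (germ_inv (fun x y => L x y - 2 * e * M x y + N x y)); auto with germs. }
  assert (HaL : germ (fun x y => Aof M N x y / L x y)) by now apply germ_div.
  assert (HbL : germ (fun x y => Bof L M x y / L x y)) by now apply germ_div.
  assert (HmL : germ (fun x y => M x y / L x y)) by now apply germ_div.
  assert (HnL : germ (fun x y => N x y / L x y)) by now apply germ_div.
  assert (HaN : germ (fun x y => Aof M N x y / N x y)) by now apply germ_div.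
  assert (HbN : germ (fun x y => Bof L M x y / N x y)) by now apply germ_div.
  assert (HmN : germ (fun x y => M x y / N x y)) by now apply germ_div.
  assert (HlN : germ (fun x y => L x y / N x y)) by now apply germ_div.
  set (aL := fun x y => Aof M N x y / L x y) in *.
  set (bL := fun x y => Bof L M x y / L x y) in *.
  set (mL := fun x y => M x y / L x y) in *.
  set (nL := fun x y => N x y / L x y) in *.
  set (aN := fun x y => Aof M N x y / N x y) in *.
  set (bN := fun x y => Bof L M x y / N x y) in *.
  set (mN := fun x y => M x y / N x y) in *.
  set (lN := fun x y => L x y / N x y) in *.
  (* Where [g11 = g22 = 1] with vanishing first derivatives, [Dt e F = P - e * Q] reduces to this
     linear equation; its solution makes [D2 F - P] vanish on the line. *)
  destruct (linear_ode_on_line e (fun x y => - bL x y + e * aN x y)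
    (fun x y => - aL x y + e * bN x y)) as [f0 [Hf0 [Hf00 Hode]]].
  { apply germ_add; [|apply germ_mul]; auto with germs. }
  { apply germ_add; [|apply germ_mul]; auto with germs. }
  assert (Hd0 : germ (fun x y => 1 - f0 x y * f0 x y)).
  { apply germ_minus; auto with germs. }
  assert (Hd00 : 1 - f0 0 0 * f0 0 0 <> 0) by (rewrite Hf00; lra).
  assert (Hq0 : germ (fun x y => / (1 - f0 x y * f0 x y)))
    by now apply (germ_inv (fun x y => 1 - f0 x y * f0 x y)).
  destruct (cauchy_problem e L M N (fun x y => / (L x y - 2 * e * M x y + N x y))
    aL bL mL nL aN bN mN lN f0 (fun x y => / (1 - f0 x y * f0 x y)))
    as [E [F [G [E1 [G1 [Ey [Gy [q [[HE [HF [HG [HE1 [HG1 [HEy [HGy Hq]]]]]]] [Hini Heq]]]]]]]]]];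
    auto.
  cbv zeta in Hini, Heq.
  exists E, F, G, q. do 4 (split; [assumption|]).
  assert (eE : near0 (fun x y => D X1 E x y = E1 x y)) by (near_use Heq; near_intro x y; tauto).
  assert (eG : near0 (fun x y => D X1 G x y = G1 x y)) by (near_use Heq; near_intro x y; tauto).
  assert (eEy : near0 (fun x y => D X1 Ey x y = Dt e E1 x y)) by (near_use Heq; near_intro x y; tauto).
  assert (eGy : near0 (fun x y => D X1 Gy x y = Dt e G1 x y)) by (near_use Heq; near_intro x y; tauto).
  set (Qf := fun x y => codazzi_rhs1 (aN x y) (bN x y) (mN x y) (lN x y)
    (F x y) (G x y) (e * E1 x y + Ey x y) (G1 x y) (e * G1 x y + Gy x y)).
  set (Pf := fun x y => codazzi_rhs2 (aL x y) (bL x y) (mL x y) (nL x y)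
    (E x y) (F x y) (E1 x y) (e * E1 x y + Ey x y) (G1 x y)).
  assert (eF : near0 (fun x y => D X1 F x y = Qf x y)) by (near_use Heq; near_intro x y; tauto).
  assert (iE : locally 0 (fun y => Dt e E (- e * y) y = 0)).
  { apply (Dt_on_line_unique e E (fun _ => 1) (fun _ => 0)); [easy| |].
    - eapply filter_imp; [|exact Hini]. intros y H. apply H.
    - apply filter_forall. intros y. apply (is_derive_const (K := R_AbsRing) (V := R_NormedModule)). }
  assert (iG : locally 0 (fun y => Dt e G (- e * y) y = 0)).
  { apply (Dt_on_line_unique e G (fun _ => 1) (fun _ => 0)); [easy| |].
    - eapply filter_imp; [|exact Hini]. intros y H. apply H.
    - apply filter_forall. intros y. apply (is_derive_const (K := R_AbsRing) (V := R_NormedModule)). }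
  assert (iF : locally 0 (fun y => Dt e F (- e * y) y = - bL (- e * y) y * f0 0 y
    + e * aN (- e * y) y * f0 0 y + (- aL (- e * y) y + e * bN (- e * y) y))).
  { apply (Dt_on_line_unique e F (fun y => f0 0 y)); [easy| |].
    - eapply filter_imp; [|exact Hini]. intros y H. apply H.
    - eapply filter_imp; [|exact Hode]. intros y H. cbv beta in H.
      rewrite Rmult_plus_distr_r in H. exact H. }
  assert (tE : near0 (fun x y => D X2 E x y = e * E1 x y + Ey x y)).
  { apply transport_Dt; auto. refine (locally_mp _ _ Hini _).
    eapply filter_imp; [|exact iE]. intros y -> H. symmetry. apply H. }
  assert (tG : near0 (fun x y => D X2 G x y = e * G1 x y + Gy x y)).
  { apply transport_Dt; auto. refine (locally_mp _ _ Hini _).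
    eapply filter_imp; [|exact iG]. intros y -> H. symmetry. apply H. }
  assert (HL' := germ_neq0 L HL HL0). assert (HN' := germ_neq0 N HN HN0).
  assert (HD' : near0 (fun x y => L x y - 2 * e * M x y + N x y <> 0)).
  { apply (germ_neq0 (fun x y => L x y - 2 * e * M x y + N x y)); auto with germs. }
  assert (HPf : germ Pf) by (unfold Pf, codazzi_rhs2; auto 20 with germs).
  assert (HQf : germ Qf) by (unfold Qf, codazzi_rhs1; auto 20 with germs).
  (* [Z] is the value that the Gauss equation assigns to [2 D12 g12], with [D22 g11] written as
     [D2 (e E1 + Ey)]. *)
  assert (Hcompat : near0 (fun x y =>
    let Z := e * D X2 E1 x y + D X2 Ey x y + D X1 G1 x y
      - gauss_rhs (L x y * N x y - M x y ^ 2) (E x y) (F x y) (G x y)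
          (E1 x y) (e * E1 x y + Ey x y) (Qf x y) (Pf x y) (G1 x y) (e * G1 x y + Gy x y) (q x y) in
    2 * D X1 Pf x y = Z /\ 2 * D X2 Qf x y = Z)).
  { near_ex2 HF. near_ex2 HG. near_ex2 HE1. near_ex2 HG1. near_ex2 HEy. near_ex2 HGy.
    near_ex2 HaN. near_ex2 HbN. near_ex2 HmN. near_ex2 HlN.
    near_ex1 HE. near_ex1 HF. near_ex1 HE1. near_ex1 HG1. near_ex1 HEy.
    near_ex1 HaL. near_ex1 HbL. near_ex1 HmL. near_ex1 HnL.
    near_use Heq. near_use tG. near_use HL'. near_use HN'. near_use HD'.
    near_intro x y. intros hD hN hL htG heq.
    destruct heq as [h1 [h2 [h3 [h4 [h5 [h6 [h7 h8]]]]]]].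
    fold (Qf x y) (Pf x y) in h3, h7, h8.
    match type of h7 with D X1 E1 x y = _ * (_ * (?r + 2 * ?p) - _ - _) =>
      match type of h8 with D X1 G1 x y = _ * (_ * (_ + 2 * ?qq) - _ - _) =>
        destruct (compatibility_algebra e (L x y) (M x y) (N x y) (D X1 E1 x y) (D X1 G1 x y)
          r p qq (Dt e E1 x y) (Dt e Ey x y) (Dt e G1 x y) (Dt e Gy x y) hL hN hD He h7 h8)
          as [c1 c2]
      end end.
    change (M x y / L x y) with (mL x y) in c1. change (N x y / L x y) with (nL x y) in c1.
    change (M x y / N x y) with (mN x y) in c2. change (L x y / N x y) with (lN x y) in c2.
    clear h7 h8. clearbody aL bL mL nL aN bN mN lN. intros.
    assert (hsq : forall a b s, e * (a + e * s) + (b + e * a) = s + 2 * e * a + b).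
    { intros a b s. replace s with (e * e * s) at 2 by (rewrite He; ring). ring. }
    assert (hdt : forall f : field2, D X2 f x y = Dt e f x y + e * D X1 f x y)
      by (intros f; unfold Dt; ring).
    assert (hP : D X1 Pf x y =
      - (D X1 E x y * aL x y + E x y * D X1 aL x y + D X1 F x y * bL x y + F x y * D X1 bL x y)
      + / 2 * D X1 G1 x y
      + (D X1 mL x y * (e * E1 x y + Ey x y) + mL x y * (e * D X1 E1 x y + D X1 Ey x y))
      - / 2 * (D X1 nL x y * E1 x y + nL x y * D X1 E1 x y)).
    { apply is_derive_unique. unfold Pf, codazzi_rhs2. auto_derive; [tauto|]. simpl D. ring. }
    assert (hQ : D X2 Qf x y =
      - (D X2 F x y * aN x y + F x y * D X2 aN x y + D X2 G x y * bN x y + G x y * D X2 bN x y)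
      - / 2 * (D X2 lN x y * (e * G1 x y + Gy x y) + lN x y * (e * D X2 G1 x y + D X2 Gy x y))
      + (D X2 mN x y * G1 x y + mN x y * D X2 G1 x y)
      + / 2 * (e * D X2 E1 x y + D X2 Ey x y)).
    { apply is_derive_unique. unfold Qf, codazzi_rhs1. auto_derive; [tauto|]. simpl D. ring. }
    rewrite hP, hQ, (hdt E1), (hdt Ey), (hdt G1), (hdt Gy), (hdt F), htG, h1, h3, h4, h5, 2!hsq.
    clear - c1 c2. split; lra. }
  assert (tC : near0 (fun x y => D X2 F x y - Pf x y = 0)).
  { apply (zero_from_line e).
    - assert (Hs := germ_schwarz F HF). assert (eF2 := near0_D_ext X2 _ _ eF).
      near_use Hcompat. near_use Hs. near_use eF2.
      near_use (germ_is_derive _ (germ_D X2 F HF)). near_use (germ_is_derive _ HPf).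
      near_intro x y. intros [d1 _] [d2 _] hF2 hs [c1 c2].
      replace 0 with (minus (D X1 (D X2 F) x y) (D X1 Pf x y)).
      + now apply (is_derive_minus (K := R_AbsRing) (V := R_NormedModule)).
      + change (D X2 (D X1 F) x y = D X2 Qf x y) in hF2. rewrite hs, hF2.
        change (D X2 Qf x y - D X1 Pf x y = 0). clear - c1 c2. lra.
    - refine (locally_mp _ _ (near0_scal (- e) _ tE) _).
      refine (locally_mp _ _ (near0_scal (- e) _ eF) _).
      refine (locally_mp _ _ iF _). eapply filter_imp; [|exact Hini].
      intros y [i1 [i2 [i3 [i4 [i5 [i6 [i7 i8]]]]]]] h1 h2 h3.
      replace (D X2 F (- e * y) y) with (Dt e F (- e * y) y + e * D X1 F (- e * y) y)
        by (unfold Dt; ring).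
      rewrite h1, h2. unfold Qf, Pf, codazzi_rhs1, codazzi_rhs2.
      rewrite i1, i2, i3, i5, i6, i7, i8. ring. }
  assert (Hq00 : q 0 0 <> 0).
  { apply locally_singleton in Hini. rewrite Rmult_0_r in Hini.
    destruct Hini as [_ [_ [_ [-> _]]]]. now apply Rinv_neq_0_compat. }
  (* The equation for [q] says that [/ q] and the determinant have the same [x]-derivative; on the
     line both equal [1 - f0^2]. *)
  assert (tq : near0 (fun x y => / q x y - (E x y * G x y - F x y * F x y) = 0)).
  { apply (zero_from_line e).
    - near_ex1 Hq. near_ex1 HE. near_ex1 HF. near_ex1 HG. near_use (germ_neq0 q Hq Hq00).
      near_use Heq. near_intro x y. intros [h1 [h2 [h3 [h4 [h5 [h6 _]]]]]] hq ? ? ? ?.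
      fold (Qf x y) in h3, h6.
      auto_derive; [tauto|].
      repeat match goal with
      | |- context [Derive (fun z => ?f z y) x] =>
          progress change (Derive (fun z => f z y) x) with (D X1 f x y)
      end.
      rewrite h1, h2, h3, h6. field. exact hq.
    - assert (Hdn := locally_2d_1d_const_x _ _ _ (germ_neq0 _ Hd0 Hd00)).
      refine (locally_mp _ _ Hdn _). eapply filter_imp; [|exact Hini].
      intros y [-> [-> [-> [-> _]]]] h. rewrite Rinv_inv. ring. }
  split; [|split].
  - apply locally_singleton in Hini. rewrite Rmult_0_r in Hini.
    destruct Hini as [_ [_ [-> _]]]. exact Hf00.
  - refine (locally_mp _ _ (near0_scal (- e) _ tE) _). refine (locally_mp _ _ (near0_scal (- e) _ tG) _).
    refine (locally_mp _ _ (near0_scal (- e) _ eE) _). refine (locally_mp _ _ (near0_scal (- e) _ eG) _).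
    eapply filter_imp; [|exact Hini].
    intros y [i1 [i2 [i3 [i4 [i5 [i6 [i7 i8]]]]]]] h1 h2 h3 h4. cbv zeta.
    rewrite h1, h2, h3, h4, i5, i6, i7, i8. repeat split; auto; ring.
  - assert (eF2 := near0_D_ext X2 _ _ eF). assert (tE2 := near0_D_ext X2 _ _ tE).
    assert (eG1 := near0_D_ext X1 _ _ eG).
    near_ex2 HE1. near_ex2 HEy. near_use (germ_schwarz F HF). near_use Hcompat.
    near_use (germ_neq0 q Hq Hq00). near_use tq. near_use tC. near_use eF. near_use eE. near_use eG.
    near_use tE. near_use tG. near_use eF2. near_use tE2. near_use eG1.
    near_intro x y. intros hG1 hE2 hF2 htG htE heG heE heF hC hq hqn [_ c2] hs hEy hE1.
    change (D X2 (D X1 F) x y = D X2 Qf x y) in hF2.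
    change (D X1 (D X1 G) x y = D X1 G1 x y) in hG1.
    assert (hE2' : D X2 (D X2 E) x y = e * D X2 E1 x y + D X2 Ey x y).
    { etransitivity; [exact hE2|]. apply is_derive_unique. auto_derive; [tauto|]. simpl D. ring. }
    assert (hC' : D X2 F x y = Pf x y) by lra.
    rewrite hE2', hs, hF2, hG1, htG, htE, heG, heE, heF, hC'.
    repeat split.
    + clear - c2. lra.
    + replace (E x y * G x y - F x y * F x y) with (/ q x y) by (clear - hq; lra).
      now apply Rinv_r.
Qed.

(** * Christoffel symbols, Gauss curvature and the Codazzi equations *)

(** Christoffel symbols of the first kind. *)
Definition lower_Gamma (E F G : field2) (l i j : axis) : field2 := fun x y =>
  match l, i, j with
  | X1, X1, X1 => / 2 * D X1 E x y
  | X1, X2, X2 => D X2 F x y - / 2 * D X1 G x y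
  | X1, _, _ => / 2 * D X2 E x y
  | X2, X1, X1 => D X1 F x y - / 2 * D X2 E x y
  | X2, X2, X2 => / 2 * D X2 G x y
  | X2, _, _ => / 2 * D X1 G x y
  end.

Lemma Christoffel_formula (E F G : field2) (k i j : axis) (x y : R) :
  Gamma (Metric E F G) k i j x y =
  match k with
  | X1 => G x y * lower_Gamma E F G X1 i j x y - F x y * lower_Gamma E F G X2 i j x y
  | X2 => - F x y * lower_Gamma E F G X1 i j x y + E x y * lower_Gamma E F G X2 i j x y
  end / (E x y * G x y - F x y ^ 2).
Proof.
  unfold Gamma, sum_axis, ginv, gdet.
  destruct k, i, j; cbn -[D pow]; unfold Rdiv;
    generalize (/ (E x y * G x y - F x y ^ 2)); intros; field.
Qed.

(** The curvature is affine in the second derivatives of the metric, so the assumed equation, solved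
    for [D22 g11], can be substituted into it; what is left is an identity of rational functions. *)
Lemma gauss_curvature_formula (E F G : field2) : germ E -> germ F -> germ G ->
  near0 (fun x y => E x y * G x y - F x y ^ 2 <> 0) ->
  near0 (fun x y => forall k q,
    q * (E x y * G x y - F x y * F x y) = 1 ->
    D X2 (D X2 E) x y - 2 * D X1 (D X2 F) x y + D X1 (D X1 G) x y
      = gauss_rhs k (E x y) (F x y) (G x y) (D X1 E x y) (D X2 E x y)
          (D X1 F x y) (D X2 F x y) (D X1 G x y) (D X2 G x y) q ->
    k = gauss_curvature (Metric E F G) x y).
Proof.
  intros HE HF HG Hdet.
  assert (HE1 := germ_D X1 E HE). assert (HE2 := germ_D X2 E HE).
  assert (HF1 := germ_D X1 F HF). assert (HF2 := germ_D X2 F HF).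
  assert (HG1 := germ_D X1 G HG). assert (HG2 := germ_D X2 G HG).
  near_ex1 HE. near_ex1 HF. near_ex1 HG. near_ex2 HE. near_ex2 HF. near_ex2 HG.
  near_ex1 HE1. near_ex1 HE2. near_ex1 HF1. near_ex1 HF2. near_ex1 HG1. near_ex1 HG2.
  near_ex2 HE1. near_ex2 HE2. near_ex2 HF1. near_ex2 HF2. near_ex2 HG1. near_ex2 HG2.
  near_use (germ_schwarz E HE). near_use (germ_schwarz F HF). near_use (germ_schwarz G HG).
  near_use Hdet.
  near_intro x y. intros hdet sG sF sE.
  unfold gauss_curvature, Riem, sum_axis.
  set (e1 := D X1 E) in *. set (e2 := D X2 E) in *. set (f1 := D X1 F) in *.
  set (f2 := D X2 F) in *. set (g1 := D X1 G) in *. set (g2 := D X2 G) in *.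
  assert (K : forall k i j u v, Gamma (Metric E F G) k i j u v = _)
    by exact (Christoffel_formula E F G).
  unfold lower_Gamma in K. fold e1 e2 f1 f2 g1 g2 in K.
  intros.
  assert (D1 : D X1 (Gamma (Metric E F G) X1 X2 X2) x y =
    ((D X1 G x y * (f2 x y - / 2 * g1 x y) + G x y * (D X1 f2 x y - / 2 * D X1 g1 x y)
      - D X1 F x y * (/ 2 * g2 x y) - F x y * (/ 2 * D X1 g2 x y))
     - (G x y * (f2 x y - / 2 * g1 x y) - F x y * (/ 2 * g2 x y))
       * (D X1 E x y * G x y + E x y * D X1 G x y - 2 * F x y * D X1 F x y)
       / (E x y * G x y - F x y ^ 2)) / (E x y * G x y - F x y ^ 2)).
  { simpl D. clearbody e1 e2 f1 f2 g1 g2. erewrite Derive_ext by (intros; apply K).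
    apply is_derive_unique. auto_derive; [tauto|]. field. exact hdet. }
  assert (D2 : D X1 (Gamma (Metric E F G) X2 X2 X2) x y =
    ((- D X1 F x y * (f2 x y - / 2 * g1 x y) - F x y * (D X1 f2 x y - / 2 * D X1 g1 x y)
      + D X1 E x y * (/ 2 * g2 x y) + E x y * (/ 2 * D X1 g2 x y))
     - (- F x y * (f2 x y - / 2 * g1 x y) + E x y * (/ 2 * g2 x y))
       * (D X1 E x y * G x y + E x y * D X1 G x y - 2 * F x y * D X1 F x y)
       / (E x y * G x y - F x y ^ 2)) / (E x y * G x y - F x y ^ 2)).
  { simpl D. clearbody e1 e2 f1 f2 g1 g2. erewrite Derive_ext by (intros; apply K).
    apply is_derive_unique. auto_derive; [tauto|]. field. exact hdet. }
  assert (D3 : D X2 (Gamma (Metric E F G) X1 X1 X2) x y =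
    ((D X2 G x y * (/ 2 * e2 x y) + G x y * (/ 2 * D X2 e2 x y)
      - D X2 F x y * (/ 2 * g1 x y) - F x y * (/ 2 * D X2 g1 x y))
     - (G x y * (/ 2 * e2 x y) - F x y * (/ 2 * g1 x y))
       * (D X2 E x y * G x y + E x y * D X2 G x y - 2 * F x y * D X2 F x y)
       / (E x y * G x y - F x y ^ 2)) / (E x y * G x y - F x y ^ 2)).
  { simpl D. clearbody e1 e2 f1 f2 g1 g2. erewrite Derive_ext by (intros; apply K).
    apply is_derive_unique. auto_derive; [tauto|]. field. exact hdet. }
  assert (D4 : D X2 (Gamma (Metric E F G) X2 X1 X2) x y =
    ((- D X2 F x y * (/ 2 * e2 x y) - F x y * (/ 2 * D X2 e2 x y)
      + D X2 E x y * (/ 2 * g1 x y) + E x y * (/ 2 * D X2 g1 x y))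
     - (- F x y * (/ 2 * e2 x y) + E x y * (/ 2 * g1 x y))
       * (D X2 E x y * G x y + E x y * D X2 G x y - 2 * F x y * D X2 F x y)
       / (E x y * G x y - F x y ^ 2)) / (E x y * G x y - F x y ^ 2)).
  { simpl D. clearbody e1 e2 f1 f2 g1 g2. erewrite Derive_ext by (intros; apply K).
    apply is_derive_unique. auto_derive; [tauto|]. field. exact hdet. }
  rewrite D1, D2, D3, D4, !K.
  clear D1 D2 D3 D4 K.
  change (D X1 E) with e1. change (D X2 E) with e2. change (D X1 F) with f1.
  change (D X2 F) with f2. change (D X1 G) with g1. change (D X2 G) with g2.
  (* Once identified, the two mixed derivatives of [g22] cancel. *)
  rewrite sG. unfold gdet. cbn -[D pow].
  assert (hq : q = / (E x y * G x y - F x y ^ 2)).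
  { apply (Rmult_eq_reg_r (E x y * G x y - F x y ^ 2)); [|exact hdet].
    rewrite Rinv_l by exact hdet. rewrite <- H17. ring. }
  assert (hk : D X2 e2 x y = gauss_rhs k (E x y) (F x y) (G x y) (e1 x y) (e2 x y)
    (f1 x y) (f2 x y) (g1 x y) (g2 x y) q + 2 * D X1 f2 x y - D X1 g1 x y) by lra.
  rewrite hk, hq. unfold gauss_rhs. field. exact hdet.
Qed.

(** Lowering the index uncouples the two equations: the first then contains only [D2 g12], with
    coefficient [L], and the second only [D1 g12], with coefficient [N]. Raising it again needs the
    determinant to be nonzero. *)
Lemma codazzi_formula (L M N E F G : field2) (x y : R) :
  L x y <> 0 -> N x y <> 0 -> E x y * G x y - F x y ^ 2 <> 0 ->
  D X2 F x y = codazzi_rhs2 (Aof M N x y / L x y) (Bof L M x y / L x y)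
    (M x y / L x y) (N x y / L x y) (E x y) (F x y) (D X1 E x y) (D X2 E x y) (D X1 G x y) ->
  D X1 F x y = codazzi_rhs1 (Aof M N x y / N x y) (Bof L M x y / N x y)
    (M x y / N x y) (L x y / N x y) (F x y) (G x y) (D X2 E x y) (D X1 G x y) (D X2 G x y) ->
  codazzi_term L M N (Metric E F G) X1 x y = D X2 M x y - D X1 N x y /\
  codazzi_term L M N (Metric E F G) X2 x y = D X1 M x y - D X2 L x y.
Proof.
  intros hL hN hdet h2 h1.
  unfold codazzi_term, Gamma, sum_axis, ginv, gdet. cbn -[D pow].
  rewrite h1, h2. unfold codazzi_rhs1, codazzi_rhs2, Aof, Bof.
  split; field; auto.
Qed.

(** * The Poisson equation in terms of [L], [M], [N] *)

Lemma near0_D_add (i : axis) (f g : field2) : germ f -> germ g ->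
  near0 (fun x y => D i (fun a b => f a b + g a b) x y = D i f x y + D i g x y).
Proof.
  intros Hf Hg. near_use (germ_is_derive f Hf). near_use (germ_is_derive g Hg).
  near_intro x y. intros [g1 g2] [f1 f2]. destruct i; apply is_derive_unique.
  - exact (is_derive_plus (K := R_AbsRing) (V := R_NormedModule) _ _ _ _ _ f1 g1).
  - exact (is_derive_plus (K := R_AbsRing) (V := R_NormedModule) _ _ _ _ _ f2 g2).
Qed.

Lemma near0_D2_add (i j : axis) (f g : field2) : germ f -> germ g ->
  near0 (fun x y => D i (D j (fun a b => f a b + g a b)) x y = D i (D j f) x y + D i (D j g) x y).
Proof.
  intros Hf Hg. near_use (near0_D_ext i _ _ (near0_D_add j f g Hf Hg)).
  near_use (near0_D_add i _ _ (germ_D j f Hf) (germ_D j g Hg)).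
  near_intro x y. intros H1 H2. now rewrite H2.
Qed.

Lemma near0_D_minus (i : axis) (f g : field2) : germ f -> germ g ->
  near0 (fun x y => D i (fun a b => f a b - g a b) x y = D i f x y - D i g x y).
Proof.
  intros Hf Hg. near_use (germ_is_derive f Hf). near_use (germ_is_derive g Hg).
  near_intro x y. intros [g1 g2] [f1 f2]. destruct i; apply is_derive_unique.
  - exact (is_derive_minus (K := R_AbsRing) (V := R_NormedModule) _ _ _ _ _ f1 g1).
  - exact (is_derive_minus (K := R_AbsRing) (V := R_NormedModule) _ _ _ _ _ f2 g2).
Qed.

Lemma D_opp (i : axis) (f : field2) (x y : R) : D i (fun a b => - f a b) x y = - D i f x y.
Proof. destruct i; apply Derive_opp. Qed.

Lemma D2_opp (i j : axis) (f : field2) (x y : R) :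
  D i (D j (fun a b => - f a b)) x y = - D i (D j f) x y.
Proof.
  rewrite <- D_opp. destruct i; apply Derive_ext; intros z; apply D_opp.
Qed.

(** The two terms of the Laplacian of [p] are absorbed by [N] and [L]. The left side is minus the
    divergence of the right-hand sides in the Codazzi equations. *)
Lemma pressure_equation_LMN (u v p : field2) : germ u -> germ v -> germ p ->
  pressure_equation u v p ->
  near0 (fun x y => D X1 (D X1 (Nof u v p)) x y - 2 * D X1 (D X2 (Mof u v p)) x y
    + D X2 (D X2 (Lof u v p)) x y = 0).
Proof.
  intros Hu Hv Hp H.
  near_use H. near_use (near0_D2_add X1 X1 _ _ (germ_pow2 u Hu) Hp).
  near_use (near0_D2_add X2 X2 _ _ (germ_pow2 v Hv) Hp).
  near_intro x y. unfold laplacian. intros hL hN h.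
  unfold Lof, Mof, Nof. rewrite D2_opp, hL, hN. lra.
Qed.

(** * The coordinates [(x1', x2')] *)

Lemma near0_primed (P : R -> R -> Prop) :
  near0 P -> near0 (fun a b => P ((a + b) / 2) ((a - b) / 2)).
Proof.
  intros H. apply near0_iff in H. destruct H as [d [Hd H]]. apply near0_iff.
  exists d. split; [easy|]. intros a b Ha Hb.
  apply Rabs_def2 in Ha. apply Rabs_def2 in Hb. apply H; apply Rabs_def1; lra.
Qed.

Lemma D_primed (f : field2) : germ f -> near0 (fun a b =>
  D X1 (primed f) a b
    = (D X1 f ((a + b) / 2) ((a - b) / 2) + D X2 f ((a + b) / 2) ((a - b) / 2)) / 2 /\
  D X2 (primed f) a b
    = (D X1 f ((a + b) / 2) ((a - b) / 2) - D X2 f ((a + b) / 2) ((a - b) / 2)) / 2).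
Proof.
  intros Hf. near_use (near0_primed _ (germ_derive_along f Hf)). near_intro a b. intros H.
  split; apply is_derive_unique; unfold primed.
  - replace ((D X1 f ((a + b) / 2) ((a - b) / 2) + D X2 f ((a + b) / 2) ((a - b) / 2)) / 2)
      with (D X1 f ((a + b) / 2) ((a - b) / 2) * / 2 + D X2 f ((a + b) / 2) ((a - b) / 2) * / 2)
      by field.
    apply (H (fun z => (z + b) / 2) (fun z => (z - b) / 2)); auto; auto_derive; auto; field.
  - replace ((D X1 f ((a + b) / 2) ((a - b) / 2) - D X2 f ((a + b) / 2) ((a - b) / 2)) / 2)
      with (D X1 f ((a + b) / 2) ((a - b) / 2) * / 2 + D X2 f ((a + b) / 2) ((a - b) / 2) * - / 2)
      by field.
    apply (H (fun z => (a + z) / 2) (fun z => (a - z) / 2)); auto; auto_derive; auto; field.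
Qed.

Lemma locally_contract (c : R) (P : R -> Prop) : Rabs c <= 1 -> locally 0 P -> locally 0 (fun y => P (c * y)).
Proof.
  intros Hc [d Hd]. exists d. intros y Hy. apply Hd.
  change (Rabs (y - 0) < d) in Hy. change (Rabs (c * y - 0) < d).
  rewrite Rminus_0_r in *. rewrite Rabs_mult. pose proof (Rabs_pos y). pose proof (Rabs_pos c). nra.
Qed.

(** * From the fluid variables to the metric *)

Section Assembly.

Context (u v p : field2) (s t : R).
Context (Hu : germ u) (Hv : germ v) (Hp : germ p).
Context (Hdiv : divergence_free u v) (Hpoisson : pressure_equation u v p).
Context (Hpos : near0 (fun x y => 0 < p x y)) (Hbranch : velocity_branch s t u v p).

Let L := Lof u v p.
Let M := Mof u v p.
Let N := Nof u v p.

Lemma germ_Lof : germ L.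
Proof. unfold L, Lof. auto with germs. Qed.
Lemma germ_Mof : germ M.
Proof. unfold M, Mof. auto with germs. Qed.
Lemma germ_Nof : germ N.
Proof. unfold N, Nof. auto with germs. Qed.

(** [e = 1] is the line [x1' = 0] and [e = -1] the line [x2' = 0]. Both partial derivatives of [g12]
    on the line are recorded, since the prescribed slopes are their half difference and half sum. *)
Lemma metric_exists (e : R) : e * e = 1 ->
  exists g : metric, (forall i j, germ (gcomp g i j)) /\
    riemannian g /\ solves_system s t L M N g /\ g12 g 0 0 = 0 /\
    locally 0 (fun y => let x := - e * y in
      g11 g x y = 1 /\ g22 g x y = 1 /\
      D X1 (g11 g) x y = 0 /\ D X2 (g11 g) x y = 0 /\
      D X1 (g22 g) x y = 0 /\ D X2 (g22 g) x y = 0 /\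
      D X1 (g12 g) x y
        = - (g12 g x y * (D X1 N x y - D X2 M x y) + (- D X1 M x y + D X2 L x y)) / N x y /\
      D X2 (g12 g) x y
        = - ((D X1 N x y - D X2 M x y) + g12 g x y * (- D X1 M x y + D X2 L x y)) / L x y /\
      L x y <> 0 /\ N x y <> 0).
Proof.
  intros He. assert (HL := germ_Lof). assert (HM := germ_Mof). assert (HN := germ_Nof).
  assert (hp : 0 < p 0 0) by exact (locally_2d_singleton _ _ _ Hpos).
  assert (hL0 : L 0 0 <> 0) by (unfold L, Lof; nra).
  assert (hN0 : N 0 0 <> 0) by (unfold N, Nof; nra).
  assert (hD0 : L 0 0 - 2 * e * M 0 0 + N 0 0 <> 0).
  { assert (0 < L 0 0 - 2 * e * M 0 0 + N 0 0); [|lra].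
    unfold L, M, N, Lof, Mof, Nof.
    replace (v 0 0 ^ 2 + p 0 0 - 2 * e * - (u 0 0 * v 0 0) + (u 0 0 ^ 2 + p 0 0))
      with ((u 0 0 + e * v 0 0) ^ 2 + 2 * p 0 0 + (1 - e * e) * v 0 0 ^ 2) by ring.
    rewrite He. pose proof (pow2_ge_0 (u 0 0 + e * v 0 0)). lra. }
  destruct (gauss_codazzi_local e L M N HL HM HN He hL0 hN0 hD0)
    as [E [F [G [q [HE [HF [HG [Hq [HF0 [Hline Heq]]]]]]]]]].
  exists (Metric E F G). cbn [g11 g12 g22].
  assert (hE0 : E 0 0 = 1 /\ G 0 0 = 1).
  { apply locally_singleton in Hline. cbv zeta in Hline. rewrite Rmult_0_r in Hline. tauto. }
  assert (Hdet : germ (fun x y => E x y * G x y - F x y ^ 2)) by auto with germs.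
  assert (Hdpos : near0 (fun x y => 0 < E x y * G x y - F x y ^ 2)).
  { apply (germ_pos _ Hdet). destruct hE0 as [-> ->]. rewrite HF0. lra. }
  assert (Hepos : near0 (fun x y => 0 < E x y)).
  { apply (germ_pos _ HE). destruct hE0 as [-> _]. lra. }
  assert (HL' := germ_neq0 L HL hL0). assert (HN' := germ_neq0 N HN hN0).
  assert (Hdn : near0 (fun x y => E x y * G x y - F x y ^ 2 <> 0)).
  { near_use Hdpos. near_intro x y. lra. }
  assert (Hcod : near0 (fun x y =>
    codazzi_term L M N (Metric E F G) X1 x y = D X2 M x y - D X1 N x y /\
    codazzi_term L M N (Metric E F G) X2 x y = D X1 M x y - D X2 L x y)).
  { near_use Heq. near_use HL'. near_use HN'. near_use Hdn. near_intro x y.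
    intros hdn hN hL [h2 [h1 _]]. now apply codazzi_formula. }
  split; [intros [] []; simpl; assumption|].
  split; [near_use Hepos; near_use Hdpos; near_intro x y; auto|].
  split; [|split; [exact HF0|]].
  - assert (Hc1 : near0 (fun x y => codazzi_term L M N (Metric E F G) X1 x y = D X2 M x y - D X1 N x y))
      by (near_use Hcod; near_intro x y; tauto).
    assert (Hc2 : near0 (fun x y => codazzi_term L M N (Metric E F G) X2 x y = D X1 M x y - D X2 L x y))
      by (near_use Hcod; near_intro x y; tauto).
    destruct Hbranch as [_ [_ Hb]].
    (* The branch identities hold on a neighbourhood, so they can be differentiated; the first
       equation of the system then becomes [div_free]. *)
    assert (Hb1 : near0 (fun x y => s * Uof L M N x y = u x y))
      by (near_use Hb; near_intro x y; now intros [-> _]).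
    assert (Hb2 : near0 (fun x y => t * Vof L M N x y = v x y))
      by (near_use Hb; near_intro x y; now intros [_ ->]).
    unfold solves_system.
    near_use Hdiv. near_use (near0_D_ext X1 _ _ Hb1). near_use (near0_D_ext X2 _ _ Hb2).
    near_use Hcod. near_use Heq. near_use (gauss_curvature_formula E F G HE HF HG Hdn).
    near_use (near0_D_ext X1 _ _ Hc1). near_use (near0_D_ext X2 _ _ Hc2).
    near_use (near0_D_minus X1 _ _ (germ_D X2 M HM) (germ_D X1 N HN)).
    near_use (near0_D_minus X2 _ _ (germ_D X1 M HM) (germ_D X2 L HL)).
    near_use (germ_schwarz M HM). near_use (pressure_equation_LMN u v p Hu Hv Hp Hpoisson).
    fold L M N.
    near_intro x y. intros hP hS m2 m1 d2 d1 hK [_ [_ [hG hq]]] [c1 c2] b2 b1 hdiv.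
    split; [|split; [|split; [|split]]].
    + transitivity (D X1 u x y + D X2 v x y); [f_equal; assumption|exact hdiv].
    + transitivity (D X1 (fun a b => D X2 M a b - D X1 N a b) x y
        + D X2 (fun a b => D X1 M a b - D X2 L a b) x y); [f_equal; assumption|].
      rewrite m1, m2, <- hS. lra.
    + unfold codazzi_term in c1. lra.
    + unfold codazzi_term in c2. lra.
    + now apply (hK _ (q x y)).
  - refine (locally_mp _ _ (near0_scal (- e) _ HL') _). refine (locally_mp _ _ (near0_scal (- e) _ HN') _).
    refine (locally_mp _ _ (near0_scal (- e) _ Heq) _).
    eapply filter_imp; [|exact Hline]. cbv zeta. intros y [i1 [i2 [i3 [i4 [i5 i6]]]]] [h2 [h1 _]] hN hL.
    rewrite h1, h2, i1, i2, i3, i4, i5, i6. unfold codazzi_rhs1, codazzi_rhs2, Aof, Bof.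
    repeat split; auto; field; auto.
Qed.

End Assembly.

Theorem lemma4p1 (u v p : field2) (s t : R)
  (u_analytic : analytic_near0 u) (v_analytic : analytic_near0 v)
  (div_free : divergence_free u v)
  (uv_neq0 : u 0 0 * v 0 0 <> 0)
  (p_analytic : analytic_near0 p)
  (p_poisson : pressure_equation u v p)
  (p_pos : locally_2d (fun x y => 0 < p x y) 0 0)
  (branch : velocity_branch s t u v p) :
  (exists g : metric,
     analytic_metric g /\ riemannian g /\
     initial_data_x1' (Lof u v p) (Mof u v p) (Nof u v p) g /\
     solves_system s t (Lof u v p) (Mof u v p) (Nof u v p) g) /\
  (exists g : metric,
     analytic_metric g /\ riemannian g /\
     initial_data_x2' (Lof u v p) (Mof u v p) (Nof u v p) g /\
     solves_system s t (Lof u v p) (Mof u v p) (Nof u v p) g).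
Proof.
  apply analytic_near0_germ in u_analytic, v_analytic, p_analytic.
  split.
  - destruct (metric_exists u v p s t u_analytic v_analytic p_analytic div_free p_poisson p_pos
      branch 1) as [g [Hg [Hr [Hs [H0 Hl]]]]]; [ring|].
    exists g. split; [intros i j; apply germ_analytic_near0, Hg|]. split; [easy|]. split; [|easy].
    assert (P11 := locally_2d_1d_const_x _ _ _ (D_primed _ (Hg X1 X1))).
    assert (P12 := locally_2d_1d_const_x _ _ _ (D_primed _ (Hg X1 X2))).
    assert (P22 := locally_2d_1d_const_x _ _ _ (D_primed _ (Hg X2 X2))).
    cbn [gcomp] in P11, P12, P22. cbv beta in P11, P12, P22.
    split.
    + refine (locally_mp _ _ P11 _). refine (locally_mp _ _ P12 _). refine (locally_mp _ _ P22 _).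
      (* The point with primed coordinates [(0, b)] is [(b / 2, - b / 2)], which has parameter
         [y = - b / 2] on the line [x = - y]. *)
      apply (locally_contract (- / 2)) in Hl; [|rewrite Rabs_left; lra].
      eapply filter_imp; [|exact Hl]. intros b. cbv beta zeta.
      replace (- (1) * (- / 2 * b)) with ((0 + b) / 2) by field.
      replace (- / 2 * b) with ((0 - b) / 2) by field.
      intros [i1 [i2 [i3 [i4 [i5 [i6 [i7 [i8 [i9 i10]]]]]]]]] [-> _] [_ ->] [-> _].
      unfold primed at 1 2 3, slope_x2'. rewrite i1, i2, i3, i4, i5, i6, i7, i8.
      repeat split; try lra. field. auto.
    + unfold primed. replace ((0 + 0) / 2) with 0 by field. replace ((0 - 0) / 2) with 0 by field.
      exact H0.
  - destruct (metric_exists u v p s t u_analytic v_analytic p_analytic div_free p_poisson p_pos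
      branch (-1)) as [g [Hg [Hr [Hs [H0 Hl]]]]]; [ring|].
    exists g. split; [intros i j; apply germ_analytic_near0, Hg|]. split; [easy|]. split; [|easy].
    assert (P11 := locally_2d_1d_const_y _ _ _ (D_primed _ (Hg X1 X1))).
    assert (P12 := locally_2d_1d_const_y _ _ _ (D_primed _ (Hg X1 X2))).
    assert (P22 := locally_2d_1d_const_y _ _ _ (D_primed _ (Hg X2 X2))).
    cbn [gcomp] in P11, P12, P22. cbv beta in P11, P12, P22.
    split.
    + refine (locally_mp _ _ P11 _). refine (locally_mp _ _ P12 _). refine (locally_mp _ _ P22 _).
      (* Here primed coordinates [(b, 0)] give [(b / 2, b / 2)], with parameter [y = b / 2] on the
         line [x = y]. *)
      apply (locally_contract (/ 2)) in Hl; [|rewrite Rabs_pos_eq; lra].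
      eapply filter_imp; [|exact Hl]. intros b. cbv beta zeta.
      replace (- (-1) * (/ 2 * b)) with ((b + 0) / 2) by field.
      replace (/ 2 * b) with ((b - 0) / 2) by field.
      intros [i1 [i2 [i3 [i4 [i5 [i6 [i7 [i8 [i9 i10]]]]]]]]] [_ ->] [-> _] [_ ->].
      unfold primed at 1 2 3, slope_x1'. rewrite i1, i2, i3, i4, i5, i6, i7, i8.
      repeat split; try lra. field. auto.
    + unfold primed. replace ((0 + 0) / 2) with 0 by field. replace ((0 - 0) / 2) with 0 by field.
      exact H0.
Qed.
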